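(* Let $m,d,p\in\mathbb{N}$, $q\in\mathbb{N}_0$, and let $(Z_t)_{t\in\mathbb{Z}}$ be an i.i.d. sequence of $\mathbb{C}^d$-valued random vectors. Let $\Psi_1,\ldots,\Psi_p\in\mathbb{C}^{m\times m}$ and $\Theta_0,\ldots,\Theta_q\in\mathbb{C}^{m\times d}$, and define $$P(z):=\mathrm{Id}_m-\sum_{k=1}^p\Psi_kz^k,\qquad Q(z):=\sum_{k=0}^q\Theta_kz^k,\qquad z\in\mathbb{C}.$$ Define the linear subspace $$K:=\{a\in\mathbb{C}^d:\text{the distribution of }a^*Z_0\text{ is degenerate to a Dirac measure}\}$$ of $\mathbb{C}^d$, denote by $K^\perp$ its orthogonal complement in $\mathbb{C}^d$, and let $s:=\dim K^\perp$. Let $U\in\mathbb{C}^{d\times d}$ be unitary such that $U\,K^\perp=\mathbb{C}^s\times\{0_{d-s}\}$ and $U\,K=\{0_s\}\times\mathbb{C}^{d-s}$, and define the $\mathbb{C}^{m\times d}$-valued rational function $$M(z):=P^{-1}(z)Q(z)U^*\begin{pmatrix}\mathrm{Id}_s&0_{s,d-s}\\0_{d-s,s}&0_{d-s,d-s}\end{pmatrix}.$$ Then there is a constant $u\in\mathbb{C}^{d-s}$ and a $\mathbb{C}^s$-valued i.i.d. sequence $(w_t)_{t\in\mathbb{Z}}$ such that $$UZ_t=\begin{pmatrix}w_t\\ u\end{pmatrix}\quad\text{a.s.}\quad\forall\,t\in\mathbb{Z},$$ and the distribution of $b^*w_0$ is not degenerate to a Dirac measure for any $b\in\mathbb{C}^s\setminus\{0\}$.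 Further, a strictly stationary solution to the ARMA$(p,q)$ equation $$Y_t-\Psi_1Y_{t-1}-\ldots-\Psi_pY_{t-p}=\Theta_0Z_t+\ldots+\Theta_qZ_{t-q},\quad t\in\mathbb{Z},\qquad( * )$$ exists if and only if the following statements (i)--(iii) hold: (i) All singularities on the unit circle of the meromorphic function $M(z)$ are removable. (ii) If $M(z)=\sum_{j=-\infty}^\infty M_jz^j$ denotes the Laurent expansion of $M$ in a neighbourhood of the unit circle, then $$\mathbb{E}\log^+\|M_jUZ_0\|<\infty\quad\forall\,j\in\{mp+q-p+1,\ldots,mp+q\}\cup\{-p,\ldots,-1\}.$$ (iii) There exist $v\in\mathbb{C}^s$ and $g\in\mathbb{C}^m$ such that $g$ is a solution to the linear equation $$P(1)g=Q(1)U^*(v^T,u^T)^T.\qquad( ** )$$ Further, if (i) holds, then condition (ii) can be replaced by (ii') If $M(z)=\sum_{j=-\infty}^\infty M_jz^j$ denotes the Laurent expansion of $M$ in a neighbourhood of the unit circle, then $\sum_{j=-\infty}^\infty M_jUZ_{t-j}$ converges almost surely absolutely for every $t\in\mathbb{Z}$, and condition (iii) can be replaced by (iii') For all $v\in\mathbb{C}^s$ there exists a solution $g=g(v)$ to the linear equation $( ** )$. If conditions (i)--(iii) are satisfied, then a strictly stationary solution $Y$ of $( * )$ is given by $$Y_t=g+\sum_{j=-\infty}^\infty M_j\bigl(UZ_{t-j}-(v^T,u^T)^T\bigr),\quad t\in\mathbb{Z},\qquad( *** )$$ (with $v,g$ as in (iii)), the series converging almost surely absolutely. Further, provided that the underlying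 probability space is rich enough to support a random variable which is uniformly distributed on $[0,1)$ and independent of $(Z_t)_{t\in\mathbb{Z}}$, the solution given by $( *** )$ is the unique strictly stationary solution of $( * )$ if and only if $\det P(z)\neq0$ for all $z$ on the unit circle.
   Context: $\mathbb{N}=\{1,2,\ldots\}$, $\mathbb{N}_0=\mathbb{N}\cup\{0\}$; $\log^+(x)=\log\max\{1,x\}$; $\|\cdot\|$ is a fixed vector norm on $\mathbb{C}^r$ (for each $r$). Vectors are column vectors; $A^*=\overline{A}^T$; $\mathrm{Id}_r$ is the $r\times r$ identity matrix, $0_{r,l}$ the zero matrix in $\mathbb{C}^{r\times l}$, $0_r$ the zero vector in $\mathbb{C}^r$. A solution of $( * )$ is any $\mathbb{C}^m$-valued process $(Y_t)_{t\in\mathbb{Z}}$, defined on the same probability space as $(Z_t)_{t\in\mathbb{Z}}$, satisfying $( * )$ almost surely. A process is strictly stationary if all its finite dimensional distributions are shift invariant. Uniqueness is understood up to almost sure equality. Since $\det P$ is a polynomial that is not identically zero, $P(z)$ is invertible except for finitely many $z$, and $P^{-1}$ is a matrix-valued rational function. For a matrix-valued rational function $M(z)=P^{-1}(z)\widetilde Q(z)$ with $\widetilde{Q}$ a matrix polynomial, the singularities of $M$ are the zeroes of $\det P(z)$, and such a singularity $z_0$ is removable if all entries of $M$ have removable singularities at $z_0$. If $M$ has only removable singularities on the unit circle, it has a Laurent expansion $M(z)=\sum_{j=-\infty}^\infty M_jz^j$ convergent in a neighbourhood of the unit circle $\{|z|=1\}$. *)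

(* Defs.v *)
From HB Require Import structures.
From mathcomp Require Import all_boot all_order all_algebra.
From mathcomp Require Import all_classical all_reals all_analysis.
From mathcomp Require Import complex.
Set Implicit Arguments.
Unset Strict Implicit.
Unset Printing Implicit Defensive.
Import Order.TTheory GRing.Theory Num.Theory.
Import numFieldNormedType.Exports.
Local Open Scope classical_set_scope.
Local Open Scope ring_scope.
Local Open Scope sesquilinear_scope.

(* R[i] is a normed module over itself, hence carries the usual topology of
   the complex plane; complex matrices inherit the product topology. *)
HB.instance Definition _ (F : rcfType) :=
  NormedModule.copy (complex F) (complex F)^o.

(* Complex matrices carry the Borel sigma-algebra of that topology. *)
HB.instance Definition _ (F : rcfType) (m n : nat) :=
  @isMeasurable.Build (sigma_display (@open 'M[complex F]_(m, n)))
    'M[complex F]_(m, n) <<s @open 'M[complex F]_(m, n) >>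
    (@sigma_algebra0 _ setT _) (@sigma_algebraC _ _)
    (@sigma_algebra_bigcup _ setT _).

Section linear_algebra.
Context {R : realType}.
Local Notation C := R[i].

(* Nonnegativity of N is a consequence of the three axioms. *)
Definition vector_norm (r : nat) (N : 'cV[C]_r -> R) : Prop :=
  [/\ forall x, N x = 0 -> x = 0,
      forall (a : C) x, ((N (a *: x))%:C)%C = `|a| * ((N x)%:C)%C
    & forall x y, N (x + y) <= N x + N y].

Definition log_plus (x : R) : R := ln (Num.max 1 x).

(* The block column (w ; v) seen in C^d.  For s <= d the dimensions s + (d - s)
   and d agree and conform_mx is the corresponding cast; its default value 0
   is only used when d < s. *)
Definition vstack (d s : nat) (w : 'cV[C]_s) (v : 'cV[C]_(d - s)) : 'cV[C]_d :=
  conform_mx 0 (col_mx w v).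

Definition orthocomp (d : nat) (K : set 'cV[C]_d) : set 'cV[C]_d :=
  [set b | forall a, K a -> a ^t* *m b = 0].

(* Dimension of a set of vectors that is a linear subspace (junk value 0
   otherwise). *)
Definition subspace_dim (d : nat) (A : set 'cV[C]_d) : nat :=
  \dim (xget 0%VS [set V : {vspace 'cV[C]_d} | [set x | x \in V] = A]).

(* Psi k is the coefficient with (1-based) index k + 1. *)
Definition ar_poly (m p : nat) (Psi : 'I_p -> 'M[C]_m) (z : C) : 'M[C]_m :=
  1%:M - \sum_(k < p) z ^+ k.+1 *: Psi k.

Definition ma_poly (m d q : nat) (Theta : 'I_q.+1 -> 'M[C]_(m, d)) (z : C) :
    'M[C]_(m, d) :=
  \sum_(k < q.+1) z ^+ k *: Theta k.

(* pid_mx s is the d x d block matrix with blocks Id_s, 0, 0, 0.  The value is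
   only meaningful where det P(z) <> 0 (invmx is the identity on singular
   matrices). *)
Definition transfer (m d p q : nat) (Psi : 'I_p -> 'M[C]_m)
    (Theta : 'I_q.+1 -> 'M[C]_(m, d)) (U : 'M[C]_d) (s : nat) (z : C) :
    'M[C]_(m, d) :=
  invmx (ar_poly Psi z) *m ma_poly Theta z *m U ^t* *m pid_mx s.

End linear_algebra.

Section laurent.
Context {R : realType}.
Local Notation C := R[i].

(* f extends holomorphically across z0; only the values of f on a punctured
   neighbourhood of z0 matter. *)
Definition removable (f : C -> C) (z0 : C) : Prop :=
  exists2 g : C -> C, \forall z \near z0, derivable g z 1
                    & \forall z \near z0^', f z = g z.

Definition removable_on_circle (m d : nat) (S : set C) (M : C -> 'M[C]_(m, d)) :
    Prop :=
  forall z0 : C, `|z0| = 1 -> S z0 ->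
    forall i j, removable (fun z => M z i j) z0.

Definition zseries_cvg (V : normedModType C) (f : int -> V) : Prop :=
  cvgn (series (fun n : nat => f n%:Z)) /\
  cvgn (series (fun n : nat => f (- n.+1%:Z))).

Definition zseries_sum (V : normedModType C) (f : int -> V) : V :=
  limn (series (fun n : nat => f n%:Z)) +
  limn (series (fun n : nat => f (- n.+1%:Z))).

(* The Laurent series with coefficients c converges in an annulus around the
   unit circle, with sum M off the set S of (removable) singularities of M. *)
Definition laurent_expansion (m d : nat) (S : set C) (M : C -> 'M[C]_(m, d))
    (c : int -> 'M[C]_(m, d)) : Prop :=
  exists2 e : C, 0 < e & forall z : C, `| `|z| - 1| < e ->
    zseries_cvg (fun j => z ^ j *: c j) /\
    (~ S z -> M z = zseries_sum (fun j => z ^ j *: c j)).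

(* The (unique) coefficients of the Laurent expansion, when it exists. *)
Definition laurent_coef (m d : nat) (S : set C) (M : C -> 'M[C]_(m, d)) :
    int -> 'M[C]_(m, d) :=
  xget (fun=> 0) [set c | laurent_expansion S M c].

Definition abs_cvg (V : Type) (N : V -> R) (f : int -> V) : Prop :=
  (\esum_(j in [set: int]) (N (f j))%:E < +oo)%E.

End laurent.

Section processes.
Context {R : realType} {disp : measure_display} {Om : measurableType disp}.
Variable P : probability Om R.
Local Notation C := R[i].

Section general.
Context {dE : measure_display} {E : measurableType dE}.

Definition mutually_independent (X : int -> {RV P >-> E}) : Prop :=
  forall (ts : seq int) (A : int -> set E), uniq ts ->
    (forall t, measurable (A t)) ->
    P (\bigcap_(t in [set` ts]) (X t @^-1` A t)) =
    (\prod_(t <- ts) P (X t @^-1` A t))%E.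

Definition iid (X : int -> {RV P >-> E}) : Prop :=
  mutually_independent X /\
  forall t (A : set E), measurable A -> P (X t @^-1` A) = P (X 0 @^-1` A).

Definition strictly_stationary (X : int -> {RV P >-> E}) : Prop :=
  forall (n : nat) (t : 'I_n -> int) (h : int) (A : set (n.-tuple E)),
    measurable A ->
    P ((fun x => [tuple X (t i + h) x | i < n]) @^-1` A) =
    P ((fun x => [tuple X (t i) x | i < n]) @^-1` A).

Definition dirac_degenerate (X : Om -> E) : Prop :=
  exists c : E, forall A : set E, measurable A -> P (X @^-1` A) = \d_c A.

(* The second clause is independence from the sigma-algebra generated by the
   whole process X. *)
Definition supports_independent_uniform (X : int -> {RV P >-> E}) : Prop :=
  exists V : {RV P >-> measurableTypeR R},
    (forall A, measurable A -> P (V @^-1` A) = uniform_prob (@ltr01 R) A) /\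
    (forall A (B : set Om), measurable A ->
      <<s \bigcup_t preimage_set_system [set: Om] (X t) measurable >> B ->
      P (V @^-1` A `&` B) = (P (V @^-1` A) * P B)%E).

End general.

Definition degenerate_directions (d : nat) (Z0 : {RV P >-> 'cV[C]_d}) :
    set 'cV[C]_d :=
  [set a | dirac_degenerate (fun x => a ^t* *m Z0 x)].

Definition arma_solution (m d p q : nat) (Psi : 'I_p -> 'M[C]_m)
    (Theta : 'I_q.+1 -> 'M[C]_(m, d)) (Z : int -> {RV P >-> 'cV[C]_d})
    (Y : int -> {RV P >-> 'cV[C]_m}) : Prop :=
  forall t, {ae P, forall x,
    Y t x - \sum_(k < p) Psi k *m Y (t - k.+1%:Z) x =
    \sum_(k < q.+1) Theta k *m Z (t - k%:Z) x}.

End processes.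

(* Main.v *)
Require Import Defs.
From HB Require Import structures.
From mathcomp Require Import all_boot all_order all_algebra.
From mathcomp Require Import all_classical all_reals all_analysis.
From mathcomp Require Import complex measurable_realfun perm.
From mathcomp Require Import ring lra zify.

(** Write W_t = U Z_t. A direction a belongs to K exactly when a^* Z_0 is almost
surely constant, so the last d - s coordinates of W_t are constant, equal to u,
while no nonzero combination of the first s is constant. With B the backshift
operator and V = U^* diag (Id_s, 0), the equation becomes P (B) Y = Q (B) V W + kappa
for a constant vector kappa, and M = P^-1 Q V. Multiplication by the adjugate of P
gives the scalar form det P (B) Y = N (B) W + kappa', where N = det P M is a matrix
of polynomials. Of a given stationary solution only tightness is used: every filter
with few terms and coefficients of modulus at most 1 turns Y into a process that
is bounded in probability, however long the filter is.

Necessity. Let H be a polynomial for which H det P is such a filter. Then the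
components of (H N) (B) W are bounded in probability at all times, up to a
constant; taking differences between two distant times symmetrizes them. For sums
of independent symmetric variables, Levy's maximal inequality
([levy_maximal]) and independence imply that the probabilities of a large value of
one block of terms have a bounded sum over disjoint blocks ([sum_block_exceeds]).
Two choices of H are made.
- For condition (i), let c be a zero of det P on the unit circle. The factor
  (X^n - c^n) / (X - c), taken to a suitable power, makes about n consecutive
  coefficients of a row of H N unimodular multiples of a single vector v, which is
  made of the values at c of the entries of N already divided by a power of X - c.
  As n is arbitrary, v W_0 has to be degenerate, and therefore v = 0
  ([unit_multiples_degenerate], [circle_zero_divides]). By induction on the
  multiplicity, the zeros of det P on the circle cancel in M.
- For condition (ii), each zero l of det P is replaced by a factor
  a X^n - b proportional to X^n - l^n. Since the coefficients M_j decay
  geometrically, for large n the product of these factors applied to (M_j) is close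
  to (M_j) itself, up to a sign and a shift ([lag_filter_limit]). Hence the
  probabilities of |M_j W_0| > K are summable over j in Z ([coef_tails_summable]).
  Outside the range of degrees of N, the M_j satisfy a homogeneous recurrence, by
  which M_j is a combination of coefficients further out, with geometrically
  growing weights. So |M_j W_0| has summable tails along a geometric progression,
  which means a finite logarithmic moment ([log_moment_of_recurrence],
  [log_moments_of_tails]). Almost sure absolute convergence of the series implies
  the same summability by independence ([tails_of_abs_cvg]), so it can replace (ii).
- For condition (iii), if a P (1) = 0 then also a Q (1) V = 0, because P M = Q V at
  the point 1. The row a P and the row a Q V are then divisible by X - 1, and the
  equation exhibits a tight process with increments a kappa; so a kappa = 0
  ([no_drift]). By duality P (1) g = kappa is solvable. The identity P M = Q V also shows that changing
  v preserves solvability ([const_response]).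

Sufficiency. The recurrence of order p for the M_j shows that the rows of all but
finitely many coefficients are spanned by those in the two windows of
condition (ii) ([coef_up_sub], [coef_down_sub]). The factor that expresses M_j
through the windows decays geometrically, and by Borel-Cantelli a logarithmic
moment makes the windows applied to W_t grow subexponentially in t
([log_moment_decay]); the terms of the series therefore decay geometrically
([terms_geo]). Convolution then yields the equation
([convolution_recurrence]), and stationarity holds because the sum is a measurable
function of the shifted path of the noise ([stationary_of_law]).

Uniqueness. The difference of two stationary solutions is tight and is annihilated
by det P (B). Without zeros on the circle, the first-order factors make it grow
geometrically in one direction of time unless it vanishes ([homogeneous_zero]).
If det P (z) = 0 with |z| = 1 and P (z) g0 = 0, g0 nonzero, adding xi z^(-t) g0 to a
solution, with xi uniform on the circle and independent of the noise, gives another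
one, which is stationary because rotations preserve the law of xi ([nonunique]). *)

Set Implicit Arguments.
Unset Strict Implicit.
Unset Printing Implicit Defensive.
Import Order.TTheory GRing.Theory Num.Theory.
Import numFieldNormedType.Exports.
Import Normc.
Local Open Scope classical_set_scope.
Local Open Scope ring_scope.

(** * Borel measurability of matrix-valued maps *)

Section measurable_matrix.
Context {R : realType}.
Local Notation C := R[i].
Local Notation Re := (@complex.Re R).
Local Notation Im := (@complex.Im R).

Lemma normcE (z : C) : `|z| = (normc z)%:C%C.
Proof. by []. Qed.

Lemma normc_ge0 (z : C) : 0 <= normc z.
Proof. by case: z => a b; exact: sqrtr_ge0. Qed.

Lemma normcB (x y : C) : normc (x - y) = normc (y - x).
Proof. by rewrite -opprB normcN. Qed.

Lemma Re_le_normc (z : C) : `|Re z| <= normc z.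
Proof. by have := normc_ge_Re z; rewrite normcE lecR. Qed.

Lemma Im_le_normc (z : C) : `|Im z| <= normc z.
Proof.
have := Re_le_normc (z * 'i%C).
by rewrite ReiNIm normrN normcM /= expr0n expr1n add0r sqrtr1 mulr1.
Qed.

Lemma normc_le_ReIm (z : C) : normc z <= `|Re z| + `|Im z|.
Proof.
case: z => a b /=; rewrite -(ger0_norm (addr_ge0 (normr_ge0 a) (normr_ge0 b))).
rewrite -sqrtr_sqr ler_wsqrtr // sqrrD !real_normK ?num_real //.
by rewrite [leRHS]addrAC lerDl mulrn_wge0 // mulr_ge0.
Qed.

Lemma nbhs_mx_normc m n (A : 'M[C]_(m, n)) (e : R) : 0 < e ->
  nbhs A [set B : 'M[C]_(m, n) | forall i j, normc (A i j - B i j) < e].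
Proof.
move=> e0; exists (fun i j => [set z | normc (A i j - z) < e]) => //.
move=> i j; apply/(@nbhs_ballP C); exists (e%:C)%C; first by rewrite /= ltcR.
by move=> z /=; rewrite /ball /= normcE ltcR.
Qed.

Lemma nbhs_normc (z0 : C) (A : set C) : nbhs z0 A ->
  exists2 e : R, 0 < e & forall z, normc (z0 - z) < e -> A z.
Proof.
move/(@nbhs_ballP C) => [e /= e0 sA].
have eR : e = (Re e)%:C%C by rewrite RRe_real // gtr0_real.
exists (Re e); first by rewrite -ltcR -eR.
move=> z hz; apply: sA; rewrite /ball /= normcE.
by rewrite eR ltcR.
Qed.

Lemma nbhs_mx_normcP m n (A : 'M[C]_(m, n)) (V : set 'M[C]_(m, n)) : nbhs A V ->
  exists2 e : R, 0 < e &
    forall B : 'M[C]_(m, n), (forall i j, normc (A i j - B i j) < e) -> V B.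
Proof.
case=> W hW sWV.
have h (ij : 'I_m * 'I_n) : exists e : R, 0 < e /\
    forall z, normc (A ij.1 ij.2 - z) < e -> W ij.1 ij.2 z.
  by have [e e0 he] := nbhs_normc (hW ij.1 ij.2); exists e.
have [f hf] := choice h.
have [e e0 he] : exists2 e : R, 0 < e & forall ij, e <= f ij.
  exists (\big[Num.min/1]_(ij : 'I_m * 'I_n) f ij).
    by apply: lt_bigmin => // ij _; have [] := hf ij.
  by move=> ij; apply: bigmin_le_cond.
exists e => // B hB; apply: sWV => i j; have [_] := hf (i, j); apply => /=.
exact: lt_le_trans (hB i j) (he (i, j)).
Qed.

Context d (T : measurableType d).

Lemma measurable_mx_Re m n (f : T -> 'M[C]_(m, n)) i j :
  measurable_fun setT f -> measurable_fun setT (fun x => Re (f x i j)).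
Proof.
move=> mf; apply: (measurability _ (measurable_realfun.RGenOInfty.measurableE R)).
move=> _ [_ [a ->] <-]; rewrite setTI.
rewrite [X in measurable X](_ : _ = f @^-1` [set M | a < Re (M i j)]); last first.
  by apply/seteqP; split => x /=; rewrite in_itv /= andbT.
rewrite -[X in measurable X]setTI; apply: mf => //; apply: sub_sigma_algebra.
rewrite openE => M /= aM.
have e0 : 0 < Re (M i j) - a by rewrite subr_gt0.
apply: filterS (nbhs_mx_normc M e0) => B /(_ i j) hB /=.
have /ltr_normlW := le_lt_trans (Re_le_normc _) hB.
by rewrite raddfB /=; lra.
Qed.

Lemma measurable_mx_Im m n (f : T -> 'M[C]_(m, n)) i j :
  measurable_fun setT f -> measurable_fun setT (fun x => Im (f x i j)).
Proof.
move=> mf; apply: (measurability _ (measurable_realfun.RGenOInfty.measurableE R)).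
move=> _ [_ [a ->] <-]; rewrite setTI.
rewrite [X in measurable X](_ : _ = f @^-1` [set M | a < Im (M i j)]); last first.
  by apply/seteqP; split => x /=; rewrite in_itv /= andbT.
rewrite -[X in measurable X]setTI; apply: mf => //; apply: sub_sigma_algebra.
rewrite openE => M /= aM.
have e0 : 0 < Im (M i j) - a by rewrite subr_gt0.
apply: filterS (nbhs_mx_normc M e0) => B /(_ i j) hB /=.
have /ltr_normlW := le_lt_trans (Im_le_normc _) hB.
by rewrite raddfB /=; lra.
Qed.

(** The topology of a matrix space has a countable base of rational boxes, so
the Borel sigma-algebra is generated by the real and imaginary parts of the
entries; all measurability questions reduce to real-valued functions. *)
Lemma measurable_mx m n (f : T -> 'M[C]_(m, n)) :
  (forall i j, measurable_fun setT (fun x => Re (f x i j))) ->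
  (forall i j, measurable_fun setT (fun x => Im (f x i j))) ->
  measurable_fun setT f.
Proof.
move=> mRe mIm.
apply: (@measurability _ _ _ _ _ _ (@open 'M[C]_(m, n))) => //.
move=> _ [V oV <-]; rewrite setTI.
pose box (r : {ffun 'I_m * 'I_n -> rat * rat} * nat) :=
  [set M : 'M[C]_(m, n) | forall i j,
     `|ratr (r.1 (i, j)).1 - Re (M i j)| < r.2.+1%:R^-1 /\
     `|ratr (r.1 (i, j)).2 - Im (M i j)| < r.2.+1%:R^-1].
have -> : f @^-1` V =
    \bigcup_r (if `[< box r `<=` V >] then f @^-1` box r else set0).
  apply/seteqP; split=> [x Vfx|x [r _]]; last first.
    by case: asboolP => // h bx; apply: h.
  have nV : nbhs (f x) V by rewrite nbhsE; exists V => //.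
  have [e e0 he] := nbhs_mx_normcP nV.
  have [k hk] : exists k : nat, k.+1%:R^-1 < e / 4.
    by have := @near_infty_natSinv_lt R (PosNum (divr_gt0 e0 (ltr0n _ 4))) => -[k _ hk];
       exists k; apply: (hk k) => /=.
  have k0 : 0 < k.+1%:R^-1 :> R by rewrite invr_gt0.
  have hq (a : R) : exists q : rat, `|ratr q - a| < k.+1%:R^-1.
    move: k0; set t := k.+1%:R^-1 => t0.
    have att : a - t < a + t by lra.
    have [q] := rat_in_itvoo att.
    rewrite in_itv /= => /andP[q1 q2]; exists q; rewrite ltr_norml.
    by apply/andP; split; lra.
  pose g := [ffun ij : 'I_m * 'I_n =>
     (sval (cid (hq (Re (f x ij.1 ij.2)))), sval (cid (hq (Im (f x ij.1 ij.2)))))].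
  have gbox : box (g, k) (f x).
    by move=> i j; rewrite /= ffunE /=; split; exact: (svalP (cid (hq _))).
  exists (g, k) => //; case: asboolP => // h; exfalso; apply: h => M hM.
  apply: he => i j; apply: le_lt_trans (normc_le_ReIm _) _.
  rewrite !raddfB /=.
  have [a1 b1] := gbox i j; have [a2 b2] := hM i j.
  have t1 := ler_distD (ratr (g (i, j)).1) (Re (f x i j)) (Re (M i j)).
  have t2 := ler_distD (ratr (g (i, j)).2) (Im (f x i j)) (Im (M i j)).
  rewrite [X in _ <= X + _]distrC in t1; rewrite [X in _ <= X + _]distrC in t2.
  move: a1 b1 a2 b2 t1 t2 hk; rewrite /=; set t := _^-1; clearbody g t.
  set y1 := `| _ |; set y2 := `| _ |; set y3 := `| _ |; set y4 := `| _ |.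
  set y5 := `| _ |; set y6 := `| _ |.
  by lra.
have mN (g : T -> R) (c t : R) : measurable_fun setT g ->
    measurable (setT `&` (fun x => `|c - g x|) @^-1` `]-oo, t[).
  move=> mg; have : measurable_fun setT (fun x => `|c - g x|).
    by apply: measurableT_comp => //; apply: measurable_funB.
  by apply.
apply: countable_bigcupT_measurable => // r; case: ifP => // _.
rewrite [X in measurable X](_ : _ = \bigcap_(ij in [set: 'I_m * 'I_n])
  ((fun x => `|ratr (r.1 ij).1 - Re (f x ij.1 ij.2)|) @^-1` `]-oo, r.2.+1%:R^-1[ `&`
   (fun x => `|ratr (r.1 ij).2 - Im (f x ij.1 ij.2)|) @^-1` `]-oo, r.2.+1%:R^-1[)); last first.
  apply/seteqP; split=> [x /= h [i j] _ /=|x /= h i j].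
    by have [] := h i j; rewrite !in_itv.
  by have [] := h (i, j) I; rewrite /= !in_itv.
apply: fin_bigcap_measurable => // ij _; apply: measurableI.
- rewrite -[X in measurable X]setTI.
  exact: mN.
- rewrite -[X in measurable X]setTI.
  exact: mN.
Qed.

(** The entrywise l1 norm. Any norm would do, but this one is submultiplicative and
makes sense in all dimensions, so tightness and moments are measured with it. *)
Definition mxnorm m n (A : 'M[C]_(m, n)) : R := \sum_i \sum_j normc (A i j).

Lemma measurable_mxD m n (f g : T -> 'M[C]_(m, n)) :
  measurable_fun setT f -> measurable_fun setT g ->
  measurable_fun setT (fun x => f x + g x).
Proof.
move=> mf mg; apply: measurable_mx => i j.
- under eq_fun do rewrite mxE raddfD /=.
  by apply: measurable_funD; apply: measurable_mx_Re.
- under eq_fun do rewrite mxE raddfD /=.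
  by apply: measurable_funD; apply: measurable_mx_Im.
Qed.

Lemma measurable_mx_sum m n (I : Type) (s : seq I) (Q : pred I)
    (f : I -> T -> 'M[C]_(m, n)) :
  (forall i, Q i -> measurable_fun setT (f i)) ->
  measurable_fun setT (fun x => \sum_(i <- s | Q i) f i x).
Proof.
move=> mf; elim: s => [|a s IHs].
  by under eq_fun do rewrite big_nil; exact: measurable_cst.
under eq_fun do rewrite big_cons; case: (boolP (Q a)) => Qa //.
by apply: measurable_mxD => //; exact: mf.
Qed.

Lemma measurable_mulmx m n l (A : 'M[C]_(m, n)) (f : T -> 'M[C]_(n, l)) :
  measurable_fun setT f -> measurable_fun setT (fun x => A *m f x).
Proof.
have ReM (a b : C) : Re (a * b) = Re a * Re b - Im a * Im b by case: a; case: b.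
have ImM (a b : C) : Im (a * b) = Re a * Im b + Im a * Re b by case: a; case: b.
move=> mf; apply: measurable_mx => i j.
- under eq_fun do rewrite mxE raddf_sum /=.
  apply: measurable_sum => k; under eq_fun do rewrite ReM.
  apply: measurable_funB; apply: measurable_funM => //.
  + exact: measurable_mx_Re.
  + exact: measurable_mx_Im.
- under eq_fun do rewrite mxE raddf_sum /=.
  apply: measurable_sum => k; under eq_fun do rewrite ImM.
  apply: measurable_funD; apply: measurable_funM => //.
  + exact: measurable_mx_Im.
  + exact: measurable_mx_Re.
Qed.

Lemma measurable_mxB m n (f g : T -> 'M[C]_(m, n)) :
  measurable_fun setT f -> measurable_fun setT g ->
  measurable_fun setT (fun x => f x - g x).
Proof.
move=> mf mg; under eq_fun do rewrite -(scaleN1r (g _)) -mul_scalar_mx.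
by apply: measurable_mxD => //; exact: measurable_mulmx.
Qed.

Lemma measurable_normc_mx m n (f : T -> 'M[C]_(m, n)) i j :
  measurable_fun setT f -> measurable_fun setT (fun x => normc (f x i j)).
Proof.
move=> mf.
have -> : (fun x => normc (f x i j)) =
    (fun x => Num.sqrt (Re (f x i j) ^+ 2 + Im (f x i j) ^+ 2)).
  by apply/funext => x; case: (f x i j).
apply: measurableT_comp; first exact: continuous_measurable_fun (@sqrt_continuous R).
by apply: measurable_funD; apply: measurable_funX;
  [exact: measurable_mx_Re | exact: measurable_mx_Im].
Qed.

Lemma measurable_mxnorm m n (f : T -> 'M[C]_(m, n)) :
  measurable_fun setT f -> measurable_fun setT (fun x => mxnorm (f x)).
Proof.
move=> mf; apply: measurable_sum => i; apply: measurable_sum => j.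
exact: measurable_normc_mx.
Qed.

Lemma measurable_gt (f : T -> R) (K : R) :
  measurable_fun setT f -> measurable [set x | K < f x].
Proof.
move=> mf; have := mf measurableT `]K, +oo[%classic (measurable_itv _).
rewrite setTI => h; rewrite [X in measurable X](_ : _ = f @^-1` `]K, +oo[%classic) //.
by apply/seteqP; split => x /=; rewrite in_itv /= andbT.
Qed.

Lemma measurable_le (f : T -> R) (K : R) :
  measurable_fun setT f -> measurable [set x | f x <= K].
Proof.
move=> mf; rewrite [X in measurable X](_ : _ = ~` [set x | K < f x]).
  by apply: measurableC; exact: measurable_gt.
by apply/seteqP; split => x /=; rewrite leNgt => /negP.
Qed.

End measurable_matrix.

(** * Laws of families of random elements *)

Section generated_independence.
Context d (T : measurableType d) {R : realType} (mu : probability T R).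
Local Open Scope ereal_scope.

(** Both sides are finite measures in A that agree on a pi-system containing the whole
space. *)
Lemma independence_left (G : set (set T)) (D : set T) :
  G `<=` measurable -> setI_closed G -> G setT -> measurable D ->
  (forall A, G A -> mu (A `&` D) = mu A * mu D) ->
  forall A, <<s G >> A -> mu (A `&` D) = mu A * mu D.
Proof.
move=> Gm GI GT mD GD A sA.
have fD : mu D = (fine (mu D))%:E by rewrite fineK // fin_num_measure.
pose r : {nonneg R} := NngNum (fine_ge0 (measure_ge0 mu D)).
have rE : (r%:num)%:E = mu D by rewrite [RHS]fD.
suff -> : mu (A `&` D) = mscale r mu A by rewrite /mscale rE muleC.
rewrite -[LHS]/(mrestr mu mD A).
apply: (g_sigma_algebra_measure_unique G _ (fun=> setT)) sA => //.
- by apply/seteqP; split => // x _; exists 0%N.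
- by move=> B GB; rewrite /mscale /= /mrestr GD // muleC -rE.
- move=> _; rewrite /= /mrestr setTI.
  by rewrite (le_lt_trans (probability_le1 mu mD)) // ltry.
Qed.

Lemma independence_generated (G1 G2 : set (set T)) :
  G1 `<=` measurable -> setI_closed G1 -> G1 setT ->
  G2 `<=` measurable -> setI_closed G2 -> G2 setT ->
  (forall A B, G1 A -> G2 B -> mu (A `&` B) = mu A * mu B) ->
  forall A B, <<s G1 >> A -> <<s G2 >> B -> mu (A `&` B) = mu A * mu B.
Proof.
move=> m1 I1 T1 m2 I2 T2 h A B sA sB.
have mA : measurable A.
  by apply: (smallest_sub (@sigma_algebra_measurable _ T) m1).
rewrite setIC muleC; apply: (independence_left m2) => // B' GB'.
rewrite setIC muleC; apply: (independence_left m1) => //; first exact: m2.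
by move=> A' GA'; apply: h.
Qed.

End generated_independence.

Section cylinders.
Context {I : choiceType} {dE : measure_display} {E : measurableType dE}.

Definition cylinder (F : seq I) (A : I -> set E) : set (I -> E) :=
  [set z | forall t, t \in F -> A t (z t)].

Definition cylinders (G : set I) : set (set (I -> E)) :=
  [set B | exists F A, [/\ {in F, forall t, G t}, forall t, measurable (A t)
                         & B = cylinder F A]].

Lemma cylindersI G : setI_closed (cylinders G).
Proof.
move=> _ _ [F1 [A1 [h1 m1 ->]]] [F2 [A2 [h2 m2 ->]]].
exists (F1 ++ F2); exists (fun t => (if t \in F1 then A1 t else setT) `&`
                                    (if t \in F2 then A2 t else setT)); split.
- by move=> t; rewrite mem_cat => /orP[/h1|/h2].
- by move=> t; apply: measurableI; case: ifP.
- apply/seteqP; split => z.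
    by move=> [z1 z2] t _; split; case: ifP => // ?; [exact: z1 | exact: z2].
  move=> h; split=> t tF; have := h t; rewrite mem_cat tF ?orbT => /(_ isT) /=;
  by [case | case=> _].
Qed.

Lemma cylindersT G : cylinders G setT.
Proof.
by exists [::], (fun=> setT); split => //; apply/seteqP; split => // z _ t.
Qed.

Lemma cylinders_sub G G' : G `<=` G' -> cylinders G `<=` cylinders G'.
Proof.
by move=> GG' _ [F [A [h mA ->]]]; exists F, A; split => // t /h /GG'.
Qed.

Lemma sigma_cylinders_sub (G G' : set I) : G `<=` G' ->
  <<s cylinders G >> `<=` <<s cylinders G' >>.
Proof.
move=> GG'; apply: smallest_sub; first exact: smallest_sigma_algebra.
by move=> B hB; apply: sub_sigma_algebra; exact: cylinders_sub hB.
Qed.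

(** A carrier for the sigma-algebra of the coordinates in G: an event that depends
only on these coordinates is a measurable set of this type. *)
Definition seqspace (G : set I) := g_sigma_algebraType (cylinders G).

Lemma measurable_coord (G : set I) t : G t ->
  measurable_fun setT (fun z : seqspace G => z t).
Proof.
move=> Gt _ A mA; rewrite setTI; apply: sub_sigma_algebra.
exists [:: t], (fun=> A); split => //.
  by move=> u; rewrite inE => /eqP ->.
by apply/seteqP; split=> z /= h; [move=> u; rewrite inE => /eqP -> | exact: h (mem_head _ _)].
Qed.

Lemma measurable_seqspace d (T : measurableType d) (G : set I) (X : I -> T -> E) :
  (forall t, measurable_fun setT (X t)) ->
  measurable_fun setT ((fun x => X ^~ x) : T -> seqspace G).
Proof.
move=> mX; pose Y : T -> seqspace G := fun x => X ^~ x.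
apply: (@measurability _ _ _ (seqspace G) setT Y (cylinders G)) => //.
move=> _ [_ [F [A [hF mA ->]]] <-]; rewrite setTI.
rewrite [X in measurable X](_ : _ =
   \bigcap_(t in [set` F]) (X t @^-1` A t)); last first.
  by apply/seteqP; split=> x h t; apply: h.
apply: fin_bigcap_measurable => // t _; rewrite -[X in measurable X]setTI.
exact: mX.
Qed.

End cylinders.

Section laws.
Context {R : realType} {I : choiceType} {dE : measure_display}
  {E : measurableType dE}.
Local Open Scope ereal_scope.

Section one_space.
Context d (T : measurableType d) (P : probability T R).
Variable X : I -> T -> E.
Hypothesis mX : forall t, measurable_fun setT (X t).

Lemma cylinder_preimage F A :
  (fun x => X ^~ x) @^-1` cylinder F A =
  \bigcap_(t in [set` undup F]) (X t @^-1` A t).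
Proof.
apply/seteqP; split=> x h t; first by rewrite /= mem_undup; exact: h.
by move=> tF; apply: h; rewrite /= mem_undup.
Qed.

Definition independent_family : Prop := forall (F : seq I) (A : I -> set E),
  uniq F -> (forall t, measurable (A t)) ->
  P (\bigcap_(t in [set` F]) (X t @^-1` A t)) =
  \prod_(t <- F) P (X t @^-1` A t).

Hypothesis indX : independent_family.

(** Cylinders over disjoint sets of coordinates form two independent pi-systems, so
the sigma-algebras that they generate are independent. *)
Lemma independent_groups2 (G1 G2 : set I) (B1 B2 : set (I -> E)) :
  (forall t, G1 t -> G2 t -> False) ->
  <<s cylinders G1 >> B1 -> <<s cylinders G2 >> B2 ->
  P ((fun x => X ^~ x) @^-1` (B1 `&` B2)) =
  P ((fun x => X ^~ x) @^-1` B1) * P ((fun x => X ^~ x) @^-1` B2).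
Proof.
move=> dG s1 s2.
pose Y : T -> seqspace setT := fun x => X ^~ x.
have mY : measurable_fun setT Y by exact: measurable_seqspace.
pose sub (G : set I) : set (set (seqspace setT)) := @cylinders I dE E G.
have subm G : sub G `<=` measurable.
  by move=> B hB; apply: sub_sigma_algebra; apply: cylinders_sub hB.
pose Qp := distribution P (mfun_Sub (mem_set mY) : {RV P >-> seqspace setT}).
apply: (@independence_generated _ _ _ Qp (sub G1) (sub G2)) => //.
- exact: cylindersI.
- exact: cylindersT.
- exact: cylindersI.
- exact: cylindersT.
move=> _ _ [F1 [A1 [h1 m1 ->]]] [F2 [A2 [h2 m2 ->]]].
rewrite -[LHS]/(P (Y @^-1` (cylinder F1 A1 `&` cylinder F2 A2))).
rewrite -[RHS]/(P (Y @^-1` cylinder F1 A1) * P (Y @^-1` cylinder F2 A2)).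
rewrite preimage_setI !cylinder_preimage.
have dF t : t \in undup F2 -> t \in undup F1 = false.
  rewrite !mem_undup => t2; apply/negP => t1; exact: dG (h1 _ t1) (h2 _ t2).
pose A t := if t \in undup F1 then A1 t else A2 t.
have -> : \bigcap_(t in [set` undup F1]) (X t @^-1` A1 t) `&`
          \bigcap_(t in [set` undup F2]) (X t @^-1` A2 t) =
          \bigcap_(t in [set` undup F1 ++ undup F2]) (X t @^-1` A t).
  apply/seteqP; split=> x.
    move=> [x1 x2] t /=; rewrite mem_cat => /orP[t1|t2]; rewrite /A.
      by rewrite t1; exact: x1.
    by rewrite dF //; exact: x2.
  move=> h; split=> t tF.
    by have := h t; rewrite /= mem_cat tF /A tF => /(_ isT).
  by have := h t; rewrite /= mem_cat tF orbT /A dF // => /(_ isT).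
rewrite !indX ?undup_uniq //; first last.
- by move=> t; rewrite /A; case: ifP.
- rewrite cat_uniq !undup_uniq /= andbT -all_predC; apply/allP => t t2 /=.
  by rewrite dF.
rewrite big_cat /=; congr (_ * _); apply: eq_big_seq => t tF; rewrite /A.
  by rewrite tF.
by rewrite dF.
Qed.

Lemma independent_groups (G : nat -> set I) (B : nat -> set (I -> E)) n :
  (forall i j t, i != j -> G i t -> G j t -> False) ->
  (forall i, <<s cylinders (G i) >> (B i)) ->
  P ((fun x => X ^~ x) @^-1` (\bigcap_(i < n) B i)) =
  \prod_(i < n) P ((fun x => X ^~ x) @^-1` B i).
Proof.
move=> dG sB; elim: n => [|n IHn].
  rewrite big_ord0 [X in P X](_ : _ = setT) ?probability_setT //.
  by apply/seteqP; split => // x _ i.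
rewrite big_ord_recr /= -IHn.
rewrite -(@independent_groups2 (\bigcup_(i < n) G i) (G n)) //.
- congr (P _); apply/seteqP; split=> x h.
    split; last by apply: h => /=.
    by move=> i /= lin; apply: h; exact: ltn_trans lin _.
  move=> i /=; rewrite ltnS leq_eqVlt => /orP[/eqP ->|lin]; first exact: h.2.
  exact: h.1.
- move=> t [i /= lin Git] Gnt; apply: (dG i n t) => //.
  by rewrite neq_ltn lin.
- apply: (@fin_bigcap_measurable _ (seqspace (\bigcup_(i < n) G i))) => //.
  move=> i /= lin; apply: sigma_cylinders_sub (sB i) => t Git; exists i => //.
Qed.

End one_space.

(** The cylinders form a pi-system that generates the sigma-algebra of the path
space. *)
Lemma eq_law d1 (T1 : measurableType d1) (P1 : probability T1 R)
    d2 (T2 : measurableType d2) (P2 : probability T2 R)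
    (X1 : I -> T1 -> E) (X2 : I -> T2 -> E) :
  (forall t, measurable_fun setT (X1 t)) ->
  (forall t, measurable_fun setT (X2 t)) ->
  (forall (F : seq I) (A : I -> set E), uniq F -> (forall t, measurable (A t)) ->
    P1 (\bigcap_(t in [set` F]) (X1 t @^-1` A t)) =
    P2 (\bigcap_(t in [set` F]) (X2 t @^-1` A t))) ->
  forall B, <<s cylinders setT >> B ->
    P1 ((fun x => X1 ^~ x) @^-1` B) = P2 ((fun x => X2 ^~ x) @^-1` B).
Proof.
move=> m1 m2 h B sB.
pose Y1 : T1 -> seqspace setT := fun x => X1 ^~ x.
have mY1 : measurable_fun setT Y1 by exact: measurable_seqspace.
pose Y2 : T2 -> seqspace setT := fun x => X2 ^~ x.
have mY2 : measurable_fun setT Y2 by exact: measurable_seqspace.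
have := @g_sigma_algebra_measure_unique _ R (seqspace setT) (cylinders setT)
  _ (fun=> setT) _ _
  (distribution P1 (mfun_Sub (mem_set mY1) : {RV P1 >-> seqspace setT}))
  (distribution P2 (mfun_Sub (mem_set mY2) : {RV P2 >-> seqspace setT})) _ _ _ B sB.
apply => //.
- by move=> ? ?; exact: sub_sigma_algebra.
- by move=> _; exact: cylindersT.
- by apply/seteqP; split => // x _; exists 0%N.
- exact: cylindersI.
- move=> _ [F [A [_ mA ->]]]; rewrite -[LHS]/(P1 (Y1 @^-1` cylinder F A)) -[RHS]/(P2 (Y2 @^-1` cylinder F A)).
  rewrite (cylinder_preimage X1) (cylinder_preimage X2) h // undup_uniq //.
- by move=> _; rewrite (le_lt_trans (probability_le1 _ measurableT)) // ltry.
Qed.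

End laws.

(** * Tight sums of independent random variables *)

Section real_probability.
Context d (T : measurableType d) {R : realType} (mu : probability T R).

Definition pr (A : set T) : R := fine (mu A).

Lemma prE A : measurable A -> mu A = (pr A)%:E.
Proof. by move=> mA; rewrite fineK // fin_num_measure. Qed.

Lemma pr_ge0 A : 0 <= pr A.
Proof. exact: fine_ge0. Qed.

Lemma pr_le1 A : measurable A -> pr A <= 1.
Proof. by move=> mA; rewrite -lee_fin -prE // probability_le1. Qed.

Lemma pr_mono A B : measurable A -> measurable B -> A `<=` B -> pr A <= pr B.
Proof.
by move=> mA mB AB; rewrite -lee_fin -!prE //; apply: le_measure => //; rewrite inE.
Qed.

Lemma prU_le A B : measurable A -> measurable B -> pr (A `|` B) <= pr A + pr B.
Proof.
move=> mA mB; rewrite -lee_fin EFinD -!prE //; last exact: measurableU.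
exact: measureU2.
Qed.

Lemma prC A : measurable A -> pr (~` A) = 1 - pr A.
Proof.
move=> mA; apply: EFin_inj; rewrite EFinB -!prE //; last exact: measurableC.
by rewrite probability_setC.
Qed.

Lemma pr_bigsetU_le n (A : nat -> set T) : (forall i, measurable (A i)) ->
  pr (\big[setU/set0]_(i < n) A i) <= \sum_(i < n) pr (A i).
Proof.
move=> mA; rewrite -lee_fin -prE; last exact: bigsetU_measurable.
rewrite -sumEFin; rewrite (eq_bigr (fun i : 'I_n => mu (A i))) => [|i _]; last by rewrite prE.
exact: Boole_inequality.
Qed.

Lemma pr_bigsetU_disjoint n (A : nat -> set T) : (forall i, measurable (A i)) ->
  (forall i j x, i != j -> A i x -> A j x -> False) ->
  \sum_(i < n) pr (A i) = pr (\big[setU/set0]_(i < n) A i).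
Proof.
move=> mA dA; apply: EFin_inj; rewrite -prE; last exact: bigsetU_measurable.
rewrite -sumEFin; rewrite (eq_bigr (fun i : 'I_n => mu (A i))) => [|i _]; last by rewrite prE.
rewrite measure_semi_additive_ord //; last exact: bigsetU_measurable.
apply/trivIsetP => i j _ _ ij; apply/seteqP; split => // x [Ai Aj].
exact: dA ij Ai Aj.
Qed.

Lemma pr_tail (f : T -> R) (e : R) : measurable_fun setT f -> 0 < e ->
  exists n : nat, pr [set x | n%:R < f x] <= e.
Proof.
move=> mf e0; pose F n := [set x | n%:R < f x].
have mF n : measurable (F n) by exact: measurable_gt.
have F0 : \bigcap_n F n = set0.
  apply/seteqP; split => // x h; have [n hn] : exists n : nat, f x <= n%:R.
    by exists (Num.truncn (f x)).+1; apply: ltW; exact: truncnS_gt.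
  by have := h n I; rewrite /F /= ltNge hn.
have cv : mu (F n) @[n --> \oo] --> mu (\bigcap_n F n).
  apply: nonincreasing_cvg_mu => //.
  - by rewrite (le_lt_trans (probability_le1 mu (mF 0%N))) // ltry.
  - by rewrite F0.
  - move=> i j ij; apply/subsetPset => x; rewrite /F /=; apply: le_lt_trans.
    by rewrite ler_nat.
rewrite F0 measure0 in cv.
move/fine_cvgP: cv => [_ /cvgrPdist_lt /(_ e e0)] [n _ hn]; exists n.
have := hn n (leqnn n); rewrite /= sub0r normrN => /ltW; apply: le_trans.
exact: ler_norm.
Qed.

Lemma bigsetU_ordP n (A : nat -> set T) x :
  (\big[setU/set0]_(i < n) A i) x <-> exists2 i, (i < n)%N & A i x.
Proof.
rewrite -bigcup_mkord; split.
  by move=> [i ? ?]; exists i.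
by move=> [i ? ?]; exists i.
Qed.

End real_probability.

(** Quantitative form of the second Borel-Cantelli lemma: if the product of the 1 - p_i
is bounded below, the sum of the p_i is bounded above. *)
Lemma prod_sum_le1 (R : realType) n (p : nat -> R) :
  (forall i, 0 <= p i <= 1) ->
  (\prod_(i < n) (1 - p i)) * (1 + \sum_(i < n) p i) <= 1.
Proof.
move=> hp; elim: n => [|n IHn]; first by rewrite !big_ord0; lra.
rewrite !big_ord_recr /=.
have s0 : 0 <= \sum_(i < n) p i by apply: sumr_ge0 => i _; case/andP: (hp i).
have q0 : 0 <= \prod_(i < n) (1 - p i).
  by apply: prodr_ge0 => i _; case/andP: (hp i); lra.
have /andP[p0 p1] := hp n.
apply: le_trans IHn; rewrite -mulrA; apply: ler_wpM2l => //.
by nra.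
Qed.

Section iid_sequence.
Context {R : realType} {disp : measure_display} {Om : measurableType disp}.
Variable P : probability Om R.
Context {dE : measure_display} {E : measurableType dE}.
Variable Z : int -> Om -> E.
Hypothesis mZ : forall t, measurable_fun setT (Z t).
Hypothesis indZ : independent_family P Z.
Hypothesis idZ : forall t A, measurable A -> P (Z t @^-1` A) = P (Z 0 @^-1` A).

Lemma measurable_pathZ :
  measurable_fun setT ((fun x => Z ^~ x) : Om -> seqspace [set: int]).
Proof. exact: measurable_seqspace. Qed.

(** Passing from the probability space to the law of the whole path makes the
permutations of time act on the sample space, as measure-preserving maps. *)
Definition noise_law : probability (seqspace [set: int]) R :=
  distribution P (mfun_Sub (mem_set measurable_pathZ) : {RV P >-> seqspace setT}).

Lemma noise_lawE B : noise_law B = P ((fun x => Z ^~ x) @^-1` B).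
Proof. by []. Qed.

Lemma cylinder_prob_shift (pi : int -> int) (F : seq int) (A : int -> set E) :
  injective pi -> uniq F -> (forall t, measurable (A t)) ->
  P (\bigcap_(t in [set` F]) (Z (pi t) @^-1` A t)) =
  (\prod_(t <- F) P (Z 0%R @^-1` A t))%E.
Proof.
move=> pi_inj uF mA.
pose A' u := A (nth 0 F (index u (map pi F))).
have A'E t : t \in F -> A' (pi t) = A t.
  by move=> tF; rewrite /A' index_map // nth_index.
transitivity (P (\bigcap_(u in [set` map pi F]) (Z u @^-1` A' u))).
  congr (P _); apply/seteqP; split=> x h u /=.
    by move=> /mapP[t tF ->]; rewrite A'E //; exact: h.
  by move=> uF'; rewrite -A'E //; apply: h; exact: map_f.
have uF' : uniq (map pi F) by rewrite map_inj_uniq.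
rewrite indZ //; last by move=> u; exact: mA.
rewrite big_map; apply: eq_big_seq => t tF.
by rewrite A'E // idZ.
Qed.

(** Shifts and the swaps used for symmetrization are special cases. *)
Lemma noise_law_perm (pi : int -> int) (B : set (seqspace [set: int])) :
  injective pi -> measurable B -> noise_law ((fun z : int -> E => z \o pi) @^-1` B) = noise_law B.
Proof.
move=> pi_inj mB; rewrite !noise_lawE.
refine (eq_law (fun t => mZ (pi t)) mZ _ mB) => F A uF mA.
by rewrite cylinder_prob_shift // (@cylinder_prob_shift id).
Qed.

Lemma measurable_perm (pi : int -> int) :
  measurable_fun setT ((fun z : int -> E => z \o pi) : seqspace [set: int] -> seqspace [set: int]).
Proof.
apply: (@measurable_seqspace int _ E _ (seqspace setT) setT (fun t z => z (pi t))).
by move=> t; exact: measurable_coord.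
Qed.

Lemma noise_law_groups (G : nat -> set int) (B : nat -> set (seqspace [set: int])) n :
  (forall i j t, i != j -> G i t -> G j t -> False) ->
  (forall i, <<s cylinders (G i) >> (B i)) ->
  pr noise_law (\bigcap_(i < n) B i) = \prod_(i < n) pr noise_law (B i).
Proof.
move=> dG sB; have mB i : measurable (B i).
  exact: sigma_cylinders_sub (sB i).
apply: EFin_inj; rewrite -prE; last exact: fin_bigcap_measurable.
rewrite noise_lawE (independent_groups mZ indZ n dG sB) -prodEFin.
by apply: eq_bigr => i _; rewrite -prE.
Qed.

End iid_sequence.

(** ** Symmetrization and the maximal inequality *)

Section symmetrization.
Context {R : realType} {d : nat}.
Local Notation C := R[i].
Local Notation S := (@seqspace int _ 'cV[C]_d [set: int]).
Variable mu : probability S R.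
Hypothesis mu_perm : forall (pi : int -> int) (B : set S),
  injective pi -> measurable B -> mu ((fun z : int -> 'cV[C]_d => z \o pi) @^-1` B) = mu B.
Hypothesis mu_groups : forall (G : nat -> set int) (B : nat -> set S) n,
  (forall i j t, i != j -> G i t -> G j t -> False) ->
  (forall i, <<s cylinders (G i) >> (B i)) ->
  pr mu (\bigcap_(i < n) B i) = \prod_(i < n) pr mu (B i).
Implicit Types (z : int -> 'cV[C]_d) (a : nat -> 'rV[C]_d) (blk : nat -> nat).

(** The coordinates -l and L - l with l < L are pairwise distinct, so that this
difference is a symmetrized copy of the noise living on the same space. *)
Definition lagdiff (L l : nat) z : 'cV[C]_d := z (- l%:Z) - z (L%:Z - l%:Z).

Definition block_sum L a blk k z : 'M[C]_1 :=
  \sum_(l < L | blk l == k) a l *m lagdiff L l z.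

Definition nsum L a z : 'M[C]_1 := \sum_(l < L) a l *m lagdiff L l z.

Definition block_coords L blk k : set int :=
  [set u | exists l, [/\ (l < L)%N, blk l = k & u = - l%:Z \/ u = L%:Z - l%:Z]].

Lemma measurable_lagdiff (G : set int) L l :
  G (- l%:Z) -> G (L%:Z - l%:Z) ->
  measurable_fun setT (lagdiff L l : seqspace G -> 'cV[C]_d).
Proof.
move=> G1 G2; apply: measurable_mxB.
  exact: (measurable_coord G1).
exact: (measurable_coord G2).
Qed.

Lemma measurable_block_sum (G : set int) L a blk k :
  block_coords L blk k `<=` G ->
  measurable_fun setT (block_sum L a blk k : seqspace G -> 'M[C]_1).
Proof.
move=> hG; apply: measurable_mx_sum => l /eqP blkl.
apply: measurable_mulmx; apply: measurable_lagdiff; apply: hG; exists l.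
  by split => //; left.
by split => //; right.
Qed.

Lemma measurable_nsum L a : measurable_fun setT (nsum L a : S -> 'M[C]_1).
Proof.
apply: measurable_mx_sum => l _; apply: measurable_mulmx.
exact: measurable_lagdiff.
Qed.

(** The permutation of the time indices that exchanges -l and L - l exactly
for the l < L selected by sw. *)
Definition swap_lag L (sw : nat -> bool) (u : int) : int :=
  if (- L%:Z < u <= 0) && sw `|u|%N then u + L%:Z
  else if (0 < u <= L%:Z) && sw `|u - L%:Z|%N then u - L%:Z else u.

Lemma swap_lagK L sw : involutive (swap_lag L sw).
Proof.
move=> u; rewrite {2}/swap_lag.
case: ifPn => [/andP[h1 h2]|h1].
  rewrite /swap_lag ifN; last by apply/nandP; left; lia.
  rewrite addrK ifT // h2 andbT; lia.
case: ifPn => [/andP[h2 h3]|h2]; last by rewrite /swap_lag (negbTE h1) (negbTE h2).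
by rewrite /swap_lag ifT ?subrK // h3 andbT; lia.
Qed.

Lemma lagdiff_swap L sw l z : (l < L)%N ->
  lagdiff L l (z \o swap_lag L sw) = if sw l then - lagdiff L l z else lagdiff L l z.
Proof.
move=> lL; rewrite /lagdiff /= /swap_lag.
pose u : int := - l%:Z; pose u' : int := L%:Z - l%:Z.
rewrite -/u -/u'.
have -> : - L%:Z < u <= 0 by rewrite /u; lia.
have -> : - L%:Z < u' <= 0 = false by apply/negP; rewrite /u'; lia.
have -> : 0 < u <= L%:Z = false by apply/negP; rewrite /u; lia.
have -> : 0 < u' <= L%:Z by rewrite /u'; lia.
have -> : `|u|%N = l by rewrite /u; lia.
have -> : `|u' - L%:Z|%N = l by rewrite /u'; lia.
have -> : u + L%:Z = u' by rewrite /u /u'; lia.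
have -> : u' - L%:Z = u by rewrite /u /u'; lia.
by case: (sw l) => //=; rewrite opprB.
Qed.

Lemma measurable_perm_preimage (pi : int -> int) (B : set S) : measurable B ->
  measurable ((fun z : int -> 'cV[C]_d => z \o pi) @^-1` B : set S).
Proof.
move=> mB; have mpi := @measurable_perm _ 'cV[C]_d pi.
by have := mpi measurableT B mB; rewrite setTI.
Qed.

Lemma pr_swap L sw (B : set S) : measurable B ->
  pr mu ((fun z : int -> 'cV[C]_d => z \o swap_lag L sw) @^-1` B) = pr mu B.
Proof. by move=> mB; rewrite /pr mu_perm //; exact: can_inj (swap_lagK L sw). Qed.

Lemma block_sum_swap L a blk sw k z (b : bool) :
  (forall l, (l < L)%N -> blk l = k -> sw l = b) ->
  block_sum L a blk k (z \o swap_lag L sw) =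
  if b then - block_sum L a blk k z else block_sum L a blk k z.
Proof.
move=> h; rewrite /block_sum; case: b h => h; rewrite -?sumrN;
  apply: eq_bigr => l /eqP blkl; rewrite lagdiff_swap // h //.
by rewrite mulmxN.
Qed.

Lemma nsum_block L a blk n z : (forall l, (l < L)%N -> (blk l < n)%N) ->
  nsum L a z = \sum_(k < n) block_sum L a blk k z.
Proof.
move=> h; rewrite /nsum /block_sum (exchange_big_dep predT) //=.
apply: eq_bigr => l _; rewrite (big_pred1 (Ordinal (h l (ltn_ord l)))) //.
Qed.

Lemma nsum_swap_others L a blk n k z : (forall l, (l < L)%N -> (blk l < n)%N) ->
  (k < n)%N ->
  nsum L a z + nsum L a (z \o swap_lag L (fun l => blk l != k)) =
  block_sum L a blk k z *+ 2.
Proof.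
move=> h kn; rewrite !(nsum_block _ _ h) -big_split /=.
rewrite (bigD1 (Ordinal kn)) //= (@block_sum_swap _ _ _ _ _ _ false); last first.
  by move=> l _ ->; rewrite eqxx.
rewrite big1 ?addr0 // => j jk; rewrite (@block_sum_swap _ _ _ _ _ _ true) ?subrr //.
by move=> l _ ->; rewrite -val_eqE /= in jk.
Qed.

Definition block_exceeds L a blk K k : set S :=
  [set z | K < normc (block_sum L a blk k z 0 0)].

Definition nsum_exceeds L a K : set S := [set z | K < normc (nsum L a z 0 0)].

Lemma measurable_block_exceeds_in (G : set int) L a blk K k :
  block_coords L blk k `<=` G -> <<s cylinders G >> (block_exceeds L a blk K k).
Proof.
move=> hG; apply: (@measurable_gt R _ (seqspace G)).
by apply: measurable_normc_mx; exact: measurable_block_sum.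
Qed.

Lemma measurable_block_exceeds L a blk K k : measurable (block_exceeds L a blk K k).
Proof. exact: (@measurable_block_exceeds_in setT). Qed.

Lemma measurable_nsum_exceeds L a K : measurable (nsum_exceeds L a K).
Proof. by apply: measurable_gt; apply: measurable_normc_mx; exact: measurable_nsum. Qed.

(** Levy's maximal inequality.  On the event that block k is the first one to
exceed K, flipping the signs of all the other blocks preserves that event and
the law, while one of the two resulting total sums exceeds K. *)
Lemma levy_maximal L a blk n K : (forall l, (l < L)%N -> (blk l < n)%N) ->
  pr mu (\big[setU/set0]_(k < n) block_exceeds L a blk K k) <=
  2 * pr mu (nsum_exceeds L a K).
Proof.
move=> hblk.
pose first k : set S := block_exceeds L a blk K k `&`
  \bigcap_(j < k) ~` block_exceeds L a blk K j.
have mfirst k : measurable (first k).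
  apply: measurableI; first exact: measurable_block_exceeds.
  apply: fin_bigcap_measurable => // j _; apply: measurableC.
  exact: measurable_block_exceeds.
have mF k : measurable (first k `&` nsum_exceeds L a K).
  by apply: measurableI => //; exact: measurable_nsum_exceeds.
have dfirst i j z : i != j -> first i z -> first j z -> False.
  move=> + [bi fi] [bj fj]; rewrite neq_ltn => /orP[ij|ji].
    exact: (fj i ij).
  exact: (fi j ji).
have step k : (k < n)%N -> pr mu (first k) <= 2 * pr mu (first k `&` nsum_exceeds L a K).
  move=> kn; pose sw l := blk l != k.
  have swE j z : normc (block_sum L a blk j (z \o swap_lag L sw) 0 0) =
                 normc (block_sum L a blk j z 0 0).
    rewrite (@block_sum_swap _ _ _ _ _ _ (j != k)); last by move=> l _ <-.
    by case: ifP => // _; rewrite mxE normcN.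
  have inv z : first k (z \o swap_lag L sw) <-> first k z.
    rewrite /first /block_exceeds /=; split.
      by move=> [h1 h2]; split; [rewrite -swE | move=> j jk /=; rewrite -swE; exact: h2].
    by move=> [h1 h2]; split; [rewrite /= swE | move=> j jk /=; rewrite swE; exact: h2].
  set B := first k `&` nsum_exceeds L a K.
  have <- : pr mu B + pr mu ((fun z : int -> 'cV[C]_d => z \o swap_lag L sw) @^-1` B) =
     2 * pr mu B by rewrite (pr_swap _ _ (mF k)) mulr_natl mulr2n.
  have mB' : measurable ((fun z : int -> 'cV[C]_d => z \o swap_lag L sw) @^-1` B : set S).
    exact: measurable_perm_preimage (mF k).
  apply: le_trans (prU_le _ (mF k) mB'); apply: pr_mono => //.
    exact: measurableU.
  move=> z fz; have [Kz|zK] := ltP K (normc (nsum L a z 0 0)); first by left.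
  right; rewrite /B; split; first by apply/inv; exact: fz.
  have Xz := fz.1; rewrite /block_exceeds /= in Xz.
  have := nsum_swap_others a z hblk kn => /matrixP /(_ 0 0); rewrite mulmxnE !mxE => e.
  have := le_normcD (nsum L a z 0 0) (nsum L a (z \o swap_lag L sw) 0 0).
  rewrite e normcMn mulr2n; clear e; move: Xz zK; rewrite /nsum_exceeds /=. lra.
have -> : \big[setU/set0]_(k < n) block_exceeds L a blk K k =
          \big[setU/set0]_(k < n) first k.
  apply/seteqP; split=> z /bigsetU_ordP [k kn kz]; apply/bigsetU_ordP; last first.
    by exists k => //; case: kz.
  have exk : exists j, `[< block_exceeds L a blk K j z >] by exists k; exact/asboolP.
  have [j jz jmin] := ex_minnP exk.
  have jk : (j <= k)%N by apply: jmin; exact/asboolP.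
  exists j; first exact: leq_ltn_trans kn.
  split; first exact/asboolP.
  by move=> i /= ij /asboolP /jmin; rewrite leqNgt ij.
rewrite -pr_bigsetU_disjoint //.
apply: (@le_trans _ _ (\sum_(k < n) 2 * pr mu (first k `&` nsum_exceeds L a K))).
  by apply: ler_sum => k _; exact: step.
rewrite -mulr_sumr; apply: ler_wpM2l => //.
rewrite (@pr_bigsetU_disjoint _ _ _ mu n (fun k => first k `&` nsum_exceeds L a K)) //; last first.
  by move=> i j z ij [fi _] [fj _]; exact: dfirst ij fi fj.
apply: pr_mono; [exact: bigsetU_measurable | exact: measurable_nsum_exceeds |].
by move=> z /(bigsetU_ordP n (fun k => first k `&` nsum_exceeds L a K)) [k _ []].
Qed.

Lemma block_coords_disjoint L blk i j t : i != j ->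
  block_coords L blk i t -> block_coords L blk j t -> False.
Proof.
move=> /eqP ij [l [lL bl tl]] [l' [lL' bl' tl']]; apply: ij.
rewrite -bl -bl'; congr blk; move: lL lL' tl tl' => + + [->|->] [] ; lia.
Qed.

(** If a symmetrized sum of independent blocks stays below K with probability
at least 3/4, then the exceedance probabilities of its blocks sum up to at most
1: no block exceeds K with probability at least 1/2, and this probability is a
product. *)
Lemma sum_block_exceeds L a blk n K : (forall l, (l < L)%N -> (blk l < n)%N) ->
  pr mu (nsum_exceeds L a K) <= 4^-1 ->
  \sum_(k < n) pr mu (block_exceeds L a blk K k) <= 1.
Proof.
move=> hblk small; set p := fun k => pr mu (block_exceeds L a blk K k).
have mB k := measurable_block_exceeds L a blk K k.
have hp k : 0 <= p k <= 1 by rewrite pr_ge0 pr_le1.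
have prodE : \prod_(k < n) (1 - p k) =
    1 - pr mu (\big[setU/set0]_(k < n) block_exceeds L a blk K k).
  rewrite -prC; last exact: bigsetU_measurable.
  rewrite -bigcup_mkord setC_bigcup.
  rewrite (@mu_groups (block_coords L blk) (fun k => ~` block_exceeds L a blk K k)).
  - by apply: eq_bigr => k _; rewrite prC.
  - exact: block_coords_disjoint.
  - by move=> k; apply: (@measurableC _ (seqspace (block_coords L blk k)));
      exact: measurable_block_exceeds_in.
have := levy_maximal a K hblk.
have := prod_sum_le1 n hp; rewrite prodE.
set q := pr mu (\big[setU/set0]_(k < n) _); set t := \sum_(i < n) _ => h1 h2.
have t0 : 0 <= t by apply: sumr_ge0 => i _; exact: pr_ge0.
nra.
Qed.

End symmetrization.

Section symmetrization_consequences.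
Context {R : realType} {d : nat}.
Local Notation C := R[i].
Local Notation S := (@seqspace int _ 'cV[C]_d [set: int]).
Variable mu : probability S R.
Hypothesis mu_perm : forall (pi : int -> int) (B : set S),
  injective pi -> measurable B -> mu ((fun z : int -> 'cV[C]_d => z \o pi) @^-1` B) = mu B.
Hypothesis mu_groups : forall (G : nat -> set int) (B : nat -> set S) n,
  (forall i j t, i != j -> G i t -> G j t -> False) ->
  (forall i, <<s cylinders (G i) >> (B i)) ->
  pr mu (\bigcap_(i < n) B i) = \prod_(i < n) pr mu (B i).
Implicit Types (z : int -> 'cV[C]_d) (a : nat -> 'rV[C]_d) (blk : nat -> nat).

(** All the symmetrized terms v (z_s - z_t) with s and t distinct have this tail,
because the law of the noise is exchangeable. *)
Definition lag_tail (v : 'rV[C]_d) (c : R) : R :=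
  pr mu [set z | c < normc ((v *m (z 0 - z 1)) 0 0)].

Lemma measurable_lag_event (v : 'rV[C]_d) (c : R) s t :
  measurable ([set z | c < normc ((v *m (z s - z t)) 0 0)] : set S).
Proof.
apply: measurable_gt; apply: measurable_normc_mx; apply: measurable_mulmx.
by apply: measurable_mxB; exact: measurable_coord.
Qed.

Lemma pr_lag (v : 'rV[C]_d) c L l : (l < L)%N ->
  pr mu [set z | c < normc ((v *m lagdiff L l z) 0 0)] = lag_tail v c.
Proof.
move=> lL; pose pi (u : int) : int := u * L%:Z - l%:Z.
have pi_inj : injective pi by move=> x y; rewrite /pi; nia.
rewrite /lag_tail /pr; congr fine; rewrite -[RHS](mu_perm pi_inj); last first.
  exact: measurable_lag_event.
have pi0 : pi 0 = - l%:Z by rewrite /pi; lia.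
have pi1 : pi 1 = L%:Z - l%:Z by rewrite /pi; lia.
by congr (mu _); apply/seteqP; split=> z; rewrite /= /lagdiff pi0 pi1.
Qed.

Lemma sum_lag_tail L a K : pr mu (nsum_exceeds L a K) <= 4^-1 ->
  \sum_(l < L) lag_tail (a l) K <= 1.
Proof.
move=> /(sum_block_exceeds mu_perm mu_groups (blk := id) (n := L)) h.
apply: le_trans (h _) => //; apply: ler_sum => l _.
rewrite le_eqVlt; apply/orP; left; apply/eqP; rewrite -(@pr_lag _ _ L l) //.
congr (pr mu _); apply/seteqP; split=> z; rewrite /block_exceeds /= /block_sum;
  by rewrite (big_pred1 l).
Qed.

Lemma normc_parallelogram (x y : C) :
  normc (x + y) ^+ 2 + normc (x - y) ^+ 2 = 2 * normc x ^+ 2 + 2 * normc y ^+ 2.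
Proof.
have sq (w : C) : normc w ^+ 2 = complex.Re w ^+ 2 + complex.Im w ^+ 2.
  by case: w => r s; rewrite /= sqr_sqrtr // addr_ge0 // sqr_ge0.
by rewrite !sq !raddfD !raddfN /=; ring.
Qed.

Definition run_sum (v : 'rV[C]_d) (u : nat -> C) L s b z : C :=
  \sum_(i < b) u (s + i)%N * (v *m lagdiff L (s + i) z) 0 0.

Lemma measurable_run_sum (G : set int) v u L s b :
  (forall i, (i < b)%N -> G (- (s + i)%N%:Z) /\ G (L%:Z - (s + i)%N%:Z)) ->
  measurable_fun setT (fun z : seqspace G => normc (run_sum v u L s b z)).
Proof.
move=> hG; pose f (z : seqspace G) : 'M[C]_1 :=
  \sum_(i < b) (u (s + i)%N *: v) *m lagdiff L (s + i) z.
have mf : measurable_fun setT f.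
  apply: measurable_mx_sum => i _; apply: measurable_mulmx.
  by have [? ?] := hG i (ltn_ord i); exact: measurable_lagdiff.
have -> : (fun z : seqspace G => normc (run_sum v u L s b z)) =
          (fun z => normc (f z 0 0)).
  apply/funext => z; rewrite /f summxE; congr normc; apply: eq_bigr => i _.
  by rewrite -scalemxAl [RHS]mxE.
exact: measurable_normc_mx.
Qed.

(** Among the sign patterns of a sum of b vectors, at least one has squared
length at least the sum of the squared lengths; hence this lower bound for the
probability that a sum of b unit multiples of one symmetric variable is
large. *)
Lemma run_sum_lower v u L s b c : 0 <= c -> (s + b <= L)%N ->
  (forall i, (i < b)%N -> normc (u (s + i)%N) = 1) ->
  (lag_tail v c / 2) ^+ b <=
  pr mu [set z | b%:R * c ^+ 2 <= normc (run_sum v u L s b z) ^+ 2].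
Proof.
move=> c0; elim: b => [|b IHb] sbL hu.
  rewrite expr0 [X in pr mu X](_ : _ = setT) /pr ?probability_setT //.
  by apply/seteqP; split => // z _; rewrite /= mul0r sqr_ge0.
have {}IHb : (lag_tail v c / 2) ^+ b <=
    pr mu [set z | b%:R * c ^+ 2 <= normc (run_sum v u L s b z) ^+ 2].
  by apply: IHb; [lia | move=> i ib; apply: hu; lia].
have sbltL : (s + b < L)%N by lia.
pose blk l := if (l < s)%N then 2%N else if (l < s + b)%N then 0%N else
  if l == (s + b)%N then 1%N else 2%N.
pose mlt k (f : S -> R) := measurable_fun setT f.
have mev (G : set int) n : (forall i, (i < n)%N ->
    G (- (s + i)%N%:Z) /\ G (L%:Z - (s + i)%N%:Z)) ->
  <<s cylinders G >> [set z | n%:R * c ^+ 2 <= normc (run_sum v u L s n z) ^+ 2].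
  move=> hG; rewrite [X in <<s _ >> X](_ : _ =
     ~` [set z | normc (run_sum v u L s n z) ^+ 2 < n%:R * c ^+ 2]); last first.
    by apply/seteqP; split=> z /=; rewrite leNgt => /negP.
  apply: (@measurableC _ (seqspace G)).
  rewrite [X in measurable X](_ : _ =
     ~` [set z | n%:R * c ^+ 2 <= normc (run_sum v u L s n z) ^+ 2]); last first.
    by apply/seteqP; split=> z /=; rewrite ltNge => /negP.
  apply: (@measurableC _ (seqspace G)).
  rewrite [X in measurable X](_ : _ =
     [set z | - normc (run_sum v u L s n z) ^+ 2 <= - (n%:R * c ^+ 2)]); last first.
    by apply/seteqP; split=> z /=; rewrite lerN2.
  apply: (@measurable_le R _ (seqspace G)); apply: measurableT_comp => //.
  by apply: measurable_funX; exact: measurable_run_sum.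
pose A : set S := [set z | b%:R * c ^+ 2 <= normc (run_sum v u L s b z) ^+ 2].
pose B : set S := [set z | c < normc ((v *m lagdiff L (s + b) z) 0 0)].
pose D : set S := [set z | b.+1%:R * c ^+ 2 <= normc (run_sum v u L s b.+1 z) ^+ 2].
have mA : measurable A by exact: mev.
have mB : measurable B.
  apply: measurable_gt; apply: measurable_normc_mx; apply: measurable_mulmx.
  exact: measurable_lagdiff.
have mD : measurable D by exact: mev.
have AB : pr mu (A `&` B) = pr mu A * pr mu B.
  pose BB k : set S := if k == 0%N then A else if k == 1%N then B else setT.
  have := @mu_groups (block_coords L blk) BB 2.
  rewrite big_ord_recr big_ord1 /= => <-.
  - congr (pr mu _); apply/seteqP; split=> z.
      by move=> [Az Bz] [|[|k]].
    by move=> h; split; [exact: (h 0%N isT) | exact: (h 1%N isT)].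
  - exact: block_coords_disjoint.
  - move=> [|[|k]] /=.
    + apply: mev => i ib; split; exists (s + i)%N; rewrite /blk;
        (split; [lia | by rewrite ltnNge leq_addr /= ltn_add2l ib | by [left|right]]).
    + apply: (@measurable_gt R _ (seqspace _)); apply: measurable_normc_mx.
      apply: measurable_mulmx; apply: measurable_lagdiff; exists (s + b)%N; rewrite /blk;
        (split; [lia | by rewrite ltnNge leq_addr /= ltnn eqxx | by [left|right]]).
    + exact: (@measurableT _ (seqspace _)).
pose sw l := l == (s + b)%N.
set D' := (fun z : int -> 'cV[C]_d => z \o swap_lag L sw) @^-1` D.
have mD' : measurable (D' : set S) by exact: measurable_perm_preimage.
have sub : A `&` B `<=` D `|` D'.
  move=> z [Az Bz].
  have e1 : run_sum v u L s b.+1 z = run_sum v u L s b z +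
      u (s + b)%N * (v *m lagdiff L (s + b) z) 0 0.
    by rewrite /run_sum big_ord_recr.
  have e2 : run_sum v u L s b.+1 (z \o swap_lag L sw) = run_sum v u L s b z -
      u (s + b)%N * (v *m lagdiff L (s + b) z) 0 0.
    rewrite /run_sum big_ord_recr /= lagdiff_swap // /sw eqxx mulmxN mxE mulrN.
    congr (_ + _); apply: eq_bigr => i _; rewrite lagdiff_swap; last by case: i => i /=; lia.
    by rewrite eqn_add2l ltn_eqF.
  (* one of |x + y|^2 and |x - y|^2 is at least |x|^2 + |y|^2 *)
  have := normc_parallelogram (run_sum v u L s b z)
    (u (s + b)%N * (v *m lagdiff L (s + b) z) 0 0).
  rewrite -e1 -e2 [normc (u _ * _)]normcM hu // mul1r.
  move: Az Bz; rewrite /A /B /D' /D /=.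
  set x := normc (run_sum v u L s b z); set y := normc (_ 0 0).
  set x1 := normc (run_sum _ _ _ _ _ _); set x2 := normc (run_sum _ _ _ _ _ _).
  move=> Az Bz e.
  have cy : c ^+ 2 <= y ^+ 2 by rewrite ler_pXn2r // ?nnegrE //; [exact: ltW | lra].
  have [|h] := leP (b.+1%:R * c ^+ 2) (x1 ^+ 2); first by left.
  right => /=; move: h; rewrite -natr1 mulrDl mul1r => h; lra.
have pB : pr mu B = lag_tail v c by exact: pr_lag.
have pD : pr mu D' = pr mu D by exact: (pr_swap mu_perm L sw mD).
have h1 : pr mu A * pr mu B <= pr mu D *+ 2.
  rewrite -AB mulr2n -{2}pD; apply: le_trans (prU_le mu mD mD').
  apply: pr_mono sub; [exact: measurableI | exact: measurableU].
rewrite exprS.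
have t0 : 0 <= lag_tail v c by exact: pr_ge0.
have : lag_tail v c * (lag_tail v c / 2) ^+ b <= lag_tail v c * pr mu A.
  by apply: ler_wpM2l.
rewrite -/D; move: h1; rewrite pB mulr2n; clear -t0.
set X := (_ / 2) ^+ b; clear; lra.
Qed.

Lemma block_indexE q0 n b k l : (0 < b)%N -> (k < n)%N ->
  ((if (q0 <= l < q0 + n * b)%N then ((l - q0) %/ b)%N else n) == k) =
  (q0 + k * b <= l < q0 + k * b + b)%N.
Proof.
move=> b0 kn; have kb : (k * b + b <= n * b)%N by rewrite addnC -mulSn leq_mul2r kn orbT.
case: ifP => hl.
  rewrite eqn_leq -ltnS ltn_divLR // leq_divRL // mulSn.
  by case/andP: hl => hl1 hl2; apply/andP/andP; lia.
by rewrite gtn_eqF //; apply/esym/negP; lia.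
Qed.

Lemma block_index_le q0 n b l : (0 < b)%N ->
  ((if (q0 <= l < q0 + n * b)%N then ((l - q0) %/ b)%N else n) < n.+1)%N.
Proof.
move=> b0; case: ifP => // /andP[h1 h2].
by rewrite ltnW // ltnS ltn_divLR //; lia.
Qed.

Lemma block_indexP q0 n b k i : (k < n)%N -> (i < b)%N ->
  (q0 <= q0 + k * b + i < q0 + n * b)%N.
Proof.
move=> kn ib; have kb : (k * b + b <= n * b)%N by rewrite addnC -mulSn leq_mul2r kn orbT.
lia.
Qed.

(** If arbitrarily long sums with unit multiples of one coefficient v remain
uniformly tight, the symmetrized variable v (Z_0 - Z_1) vanishes: otherwise
blocks of a fixed length b would exceed K with a fixed positive probability,
and only boundedly many blocks may do so. *)
Lemma unit_multiples_degenerate (v : 'rV[C]_d) (K c : R) : 0 < c ->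
  (forall n, exists L q0 a u, [/\ (q0 + n <= L)%N,
     forall l, (q0 <= l < q0 + n)%N -> normc (u l) = 1 /\ a l = u l *: v
   & pr mu (nsum_exceeds L a K) <= 4^-1]) ->
  lag_tail v c = 0.
Proof.
move=> c0 h; apply/eqP; rewrite eq_le pr_ge0 andbT leNgt; apply/negP => t0.
(* blocks of length b exceed K, since sqrt b * c > K, with probability eta *)
have [b hb] : exists b : nat, K ^+ 2 < b%:R * c ^+ 2.
  exists (Num.truncn (K ^+ 2 / c ^+ 2)).+1.
  by rewrite -ltr_pdivrMr ?exprn_gt0 //; exact: truncnS_gt.
have b0 : (0 < b)%N.
  by case: b hb => //; rewrite mul0r ltNge sqr_ge0.
set eta := (lag_tail v c / 2) ^+ b.
have eta0 : 0 < eta by rewrite exprn_gt0 // divr_gt0.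
have [n hn] : exists n : nat, 1 < n%:R * eta.
  exists (Num.truncn eta^-1).+1.
  by rewrite -ltr_pdivrMr // mul1r; exact: truncnS_gt.
have [L [q0 [a [u [qL hau small]]]]] := h (n * b)%N.
pose blk l := if (q0 <= l < q0 + n * b)%N then ((l - q0) %/ b)%N else n.
have hblk l : (l < L)%N -> (blk l < n.+1)%N.
  by move=> _; exact: block_index_le.
have := sum_block_exceeds mu_perm mu_groups hblk small.
rewrite big_ord_recr /=; apply/negP; rewrite -ltNge.
apply: (@lt_le_trans _ _ (\sum_(k < n) pr mu (block_exceeds L a blk K k))); last first.
  by rewrite lerDl pr_ge0.
apply: (lt_le_trans hn); rewrite mulr_natl -[X in _ *+ X]card_ord -sumr_const.
apply: ler_sum => k _.
have kb : (k * b + b <= n * b)%N by rewrite addnC -mulSn leq_mul2r ltn_ord orbT.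
have := @run_sum_lower v u L (q0 + k * b) b c (ltW c0).
have rL : (q0 + k * b + b <= L)%N by rewrite (leq_trans _ qL) // -addnA leq_add2l.
move=> /(_ rL) hlow.
have {hlow} : eta <= pr mu [set z | b%:R * c ^+ 2 <=
    normc (run_sum v u L (q0 + k * b) b z) ^+ 2].
  apply: hlow => i ib; have [|//] := hau (q0 + k * b + i)%N.
  exact: block_indexP (ltn_ord k) ib.
move=> hlow; apply: (le_trans hlow); apply: pr_mono.
- rewrite [X in measurable X](_ : _ = ~` [set z |
     - (b%:R * c ^+ 2) < - normc (run_sum v u L (q0 + k * b) b z) ^+ 2]); last first.
    by apply/seteqP; split=> z /=; rewrite ltrN2 leNgt => /negP.
  apply: measurableC; apply: measurable_gt; apply: measurableT_comp => //.
  by apply: measurable_funX; exact: measurable_run_sum.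
- exact: measurable_block_exceeds.
move=> z /=; rewrite /block_exceeds /= => hz.
have -> : block_sum L a blk k z 0 0 = run_sum v u L (q0 + k * b) b z.
  rewrite /block_sum summxE /run_sum.
  rewrite -(big_mkord (fun l => blk l == k) (fun l => (a l *m lagdiff L l z) 0 0)).
  transitivity (\sum_(q0 + k * b <= l < q0 + k * b + b) (a l *m lagdiff L l z) 0 0).
    rewrite [RHS](@big_nat_widen _ _ _ _ _ L) // [RHS](@big_nat_widenl _ _ _ _ 0) //.
    by apply: eq_bigl => l; rewrite /blk block_indexE //= andbC.
  rewrite -{1}(add0n (q0 + k * b)%N) big_addn addKn big_mkord.
  apply: eq_bigr => i _; rewrite addnC.
  have [|_ ->] := hau (q0 + k * b + i)%N; last by rewrite -scalemxAl mxE.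
  exact: block_indexP (ltn_ord k) (ltn_ord i).
rewrite ltNge; apply/negP => hK.
have : normc (run_sum v u L (q0 + k * b) b z) ^+ 2 <= K ^+ 2.
  by rewrite ler_pXn2r // nnegrE ?normc_ge0 // (le_trans _ hK) ?normc_ge0.
move: hz hb; rewrite /= => h1 h2 h3.
by have := lt_le_trans h2 (le_trans h1 h3); rewrite ltxx.
Qed.

End symmetrization_consequences.

(** * Polynomials in the backshift operator *)

Section backshift.
Context {F : fieldType}.
Implicit Types (p q : {poly F}) (y : int -> F).

(** The polynomial p in the backshift operator, applied to a two-sided sequence. *)
Definition pact p y (t : int) : F := \sum_(e < size p) p`_e * y (t - e%:Z).

Lemma pact_widen n p y t : (size p <= n)%N ->
  pact p y t = \sum_(e < n) p`_e * y (t - e%:Z).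
Proof.
move=> pn; rewrite /pact (big_ord_widen n (fun e => p`_e * y (t - e%:Z)) pn).
rewrite big_mkcond; apply: eq_bigr => e _; case: ltnP => // h.
by rewrite nth_default // mul0r.
Qed.

Lemma pactD p q y t : pact (p + q) y t = pact p y t + pact q y t.
Proof.
pose n := maxn (size p) (size q).
rewrite !(@pact_widen n) ?leq_maxl ?leq_maxr ?size_polyD // -big_split.
by apply: eq_bigr => e _; rewrite coefD mulrDl.
Qed.

Lemma pact0 y t : pact 0 y t = 0.
Proof. by rewrite /pact size_poly0 big_ord0. Qed.

Lemma pact_suml (I : Type) (r : seq I) (Q : pred I) (f : I -> {poly F}) y t :
  pact (\sum_(i <- r | Q i) f i) y t = \sum_(i <- r | Q i) pact (f i) y t.
Proof.
by apply: (big_morph (fun p => pact p y t)) => [p q|]; rewrite ?pactD ?pact0.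
Qed.

Lemma pactC c y t : pact c%:P y t = c * y t.
Proof.
rewrite (@pact_widen 1) ?size_polyC_leq1 // big_ord1 coefC eqxx.
by rewrite subr0.
Qed.

Lemma pactMX p y t : pact (p * 'X) y t = pact p y (t - 1).
Proof.
rewrite (@pact_widen (size p).+1); last first.
  by have := size_polyMleq p 'X; rewrite size_polyX addn2.
rewrite big_ord_recl coefMX eqxx mul0r add0r /pact; apply: eq_bigr => e _.
by rewrite coefMX /= /bump /= add1n /=; congr (_ * y _); lia.
Qed.

Lemma pact1 y t : pact 1 y t = y t.
Proof. by rewrite -polyC1 pactC mul1r. Qed.

Lemma pactXsubC c y t : pact ('X - c%:P) y t = y (t - 1) - c * y t.
Proof.
have -> : 'X - c%:P = 1 * 'X + (- c)%:P by rewrite polyCN mul1r.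
by rewrite pactD pactMX pact1 pactC mulNr.
Qed.

Lemma pactDr p y1 y2 t :
  pact p (fun s => y1 s + y2 s) t = pact p y1 t + pact p y2 t.
Proof. by rewrite /pact -big_split; apply: eq_bigr => e _; rewrite mulrDr. Qed.

Lemma pactZr p c y t : pact p (fun s => c * y s) t = c * pact p y t.
Proof. by rewrite /pact mulr_sumr; apply: eq_bigr => e _; rewrite mulrCA. Qed.

Lemma pact_sumr (I : Type) (r : seq I) (Q : pred I) p (f : I -> int -> F) t :
  pact p (fun s => \sum_(i <- r | Q i) f i s) t =
  \sum_(i <- r | Q i) pact p (f i) t.
Proof.
rewrite /pact exchange_big /=; apply: eq_bigr => e _; exact: mulr_sumr.
Qed.

Lemma eq_pact p y1 y2 t : y1 =1 y2 -> pact p y1 t = pact p y2 t.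
Proof. by move=> h; apply: eq_bigr => e _; rewrite h. Qed.

Lemma pactM p q y t : pact (p * q) y t = pact p (pact q y) t.
Proof.
elim/poly_ind: p t => [|p c IHp] t; first by rewrite mul0r !pact0.
rewrite mulrDl !pactD !pactC -mulrA (mulrC 'X) mulrA !pactMX IHp; congr (_ + _).
rewrite mul_polyC (@pact_widen (size q)) ?size_scale_leq // mulr_sumr.
by apply: eq_bigr => e _; rewrite coefZ mulrA.
Qed.

(** The coefficient sequence of a polynomial, extended by 0 to negative indices, so
that pact is the convolution with it. *)
Definition polyseqz p (j : int) : F := if j is Posz n then p`_n else 0.

Lemma pact_polyseqz p q j : pact p (polyseqz q) j = polyseqz (p * q) j.
Proof.
have delta r i : pact r (polyseqz 1) i = polyseqz r i.
  rewrite /pact; case: i => [n|n] /=; last first.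
    by rewrite big1 // => e _; rewrite [X in polyseqz _ X](_ : _ = Negz (n + e)) ?mulr0 //; lia.
  have [nr|rn] := ltnP n (size r).
    rewrite (bigD1 (Ordinal nr)) //= subrr /= coef1 mulr1 big1 ?addr0 // => e.
    rewrite -val_eqE /= => en; have [h|h] := ltnP e n.
      have -> : n%:Z - e%:Z = (n - e)%N%:Z by lia.
      by rewrite /= coef1 subn_eq0 leqNgt h mulr0.
    have -> : n%:Z - e%:Z = Negz (e - n).-1 by lia.
    by rewrite mulr0.
  rewrite nth_default // big1 // => e _.
  have h := ltn_ord e; have h2 : (e <= n)%N by exact: ltnW (leq_trans h rn).
  have -> : n%:Z - e%:Z = (n - e)%N%:Z by move: h2; clear; lia.
  by rewrite /= coef1 subn_eq0 leqNgt (leq_trans h rn) mulr0.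
rewrite -delta pactM; apply: eq_pact => i; exact/esym/delta.
Qed.

Context {m n l : nat}.
Implicit Types (A : 'M[{poly F}]_(m, n)) (x : int -> 'M[F]_(n, l)).

Definition mact {m n l} (A : 'M[{poly F}]_(m, n)) (x : int -> 'M[F]_(n, l)) (t : int) :
  'M[F]_(m, l) := \matrix_(i, j) \sum_k pact (A i k) (fun s => x s k j) t.

Lemma eq_mact A x1 x2 t : x1 =1 x2 -> mact A x1 t = mact A x2 t.
Proof.
move=> h; apply/matrixP => i j; rewrite !mxE; apply: eq_bigr => k _.
by apply: eq_pact => s; rewrite h.
Qed.

Lemma mactDr A x1 x2 t : mact A (fun s => x1 s + x2 s) t = mact A x1 t + mact A x2 t.
Proof.
apply/matrixP => i j; rewrite !mxE -big_split; apply: eq_bigr => k _ /=.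
by rewrite -pactDr; apply: eq_pact => s; rewrite mxE.
Qed.

Lemma mactNr A x t : mact A (fun s => - x s) t = - mact A x t.
Proof.
apply/matrixP => i j; rewrite !mxE -sumrN; apply: eq_bigr => k _.
by rewrite -mulN1r -pactZr; apply: eq_pact => s; rewrite mxE mulN1r.
Qed.

Lemma mactBr A x1 x2 t : mact A (fun s => x1 s - x2 s) t = mact A x1 t - mact A x2 t.
Proof. by rewrite (mactDr A x1 (fun s => - x2 s)) mactNr. Qed.

Lemma mactDl A1 A2 x t : mact (A1 + A2) x t = mact A1 x t + mact A2 x t.
Proof.
apply/matrixP => i j; rewrite !mxE -big_split; apply: eq_bigr => k _.
by rewrite mxE pactD.
Qed.

Lemma mact0l x t : mact 0 x t = 0 :> 'M[F]_(m, l).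
Proof. by apply/matrixP => i j; rewrite !mxE big1 // => k _; rewrite mxE pact0. Qed.

Lemma mact_suml (I : Type) (r : seq I) (Q : pred I) (f : I -> 'M[{poly F}]_(m, n)) x t :
  mact (\sum_(i <- r | Q i) f i) x t = \sum_(i <- r | Q i) mact (f i) x t.
Proof.
by apply: (big_morph (fun A => mact A x t)) => [A B|]; rewrite ?mactDl ?mact0l.
Qed.

Lemma mact_const (A : 'M[F]_(m, n)) x t : mact (map_mx polyC A) x t = A *m x t.
Proof.
apply/matrixP => i j; rewrite !mxE; apply: eq_bigr => k _.
by rewrite mxE pactC.
Qed.

Lemma mactXn e A x t : mact ('X^e *: A) x t = mact A x (t - e%:Z).
Proof.
elim: e t => [|e IHe] t; first by rewrite expr0 scale1r subr0.
have -> : t - e.+1%:Z = t - 1 - e%:Z by lia.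
rewrite -IHe; apply/matrixP => i j; rewrite !mxE; apply: eq_bigr => k _.
by rewrite !mxE exprS -mulrA mulrC pactMX.
Qed.

(** The backshift operator is the identity on constant sequences. *)
Lemma mact_cst A (v : 'M[F]_(n, l)) t :
  mact A (fun=> v) t = map_mx (horner^~ 1) A *m v.
Proof.
apply/matrixP => i j; rewrite !mxE; apply: eq_bigr => k _.
rewrite mxE /pact -mulr_suml horner_coef; congr (_ * _).
by apply: eq_bigr => e _; rewrite expr1n mulr1.
Qed.

End backshift.

Section backshift_mulmx.
Context {F : fieldType}.

Lemma mactM m n k l (A : 'M[{poly F}]_(m, n)) (B : 'M[{poly F}]_(n, k))
    (x : int -> 'M[F]_(k, l)) t :
  mact (A *m B) x t = mact A (mact B x) t.
Proof.
apply/matrixP => i j; rewrite !mxE.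
under eq_bigr do rewrite mxE pact_suml.
rewrite exchange_big; apply: eq_bigr => e _ /=.
have -> : pact (A i e) (fun s => mact B x s e j) t =
   pact (A i e) (fun s => \sum_k0 pact (B e k0) (fun s0 => x s0 k0 j) s) t.
  by apply: eq_pact => s; rewrite mxE.
by rewrite pact_sumr; apply: eq_bigr => c _; rewrite pactM.
Qed.

Lemma mact_scalar m l (p : {poly F}) (x : int -> 'M[F]_(m, l)) t i j :
  mact p%:M x t i j = pact p (fun s => x s i j) t.
Proof.
rewrite mxE (bigD1 i) //= mxE eqxx mulr1n big1 ?addr0 // => k ki.
by rewrite mxE eq_sym (negbTE ki) mulr0n pact0.
Qed.

Lemma mact_scalarE m l (p : {poly F}) (x : int -> 'M[F]_(m, l)) t :
  mact p%:M x t = \sum_(e < size p) p`_e *: x (t - e%:Z).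
Proof.
apply/matrixP => i j; rewrite mact_scalar summxE; apply: eq_bigr => e _.
by rewrite mxE.
Qed.

Definition mxpolyseqz m n (A : 'M[{poly F}]_(m, n)) (j : int) : 'M[F]_(m, n) :=
  \matrix_(i, k) polyseqz (A i k) j.

Lemma mact_mxpolyseqz m n k (A : 'M[{poly F}]_(m, n)) (B : 'M[{poly F}]_(n, k)) j :
  mact A (mxpolyseqz B) j = mxpolyseqz (A *m B) j.
Proof.
apply/matrixP => i e; rewrite !mxE.
have -> : polyseqz (\sum_c A i c * B c e) j = \sum_c polyseqz (A i c * B c e) j.
  by case: j => [a|a] /=; [rewrite coef_sum | rewrite big1].
apply: eq_bigr => c _; rewrite -pact_polyseqz; apply: eq_pact => s.
by rewrite mxE.
Qed.

(** The Leibniz formula is a sum of products of n entries. *)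
Lemma size_det_le n (A : 'M[{poly F}]_n) c : (forall i j, (size (A i j) <= c.+1)%N) ->
  (size (\det A) <= (n * c).+1)%N.
Proof.
move=> hA; rewrite /determinant; apply: (leq_trans (size_sum _ _ _)).
apply/bigmax_leqP => s _.
have hp (r : seq 'I_n) : (size (\prod_(i <- r) A i (s i))%R <= (size r * c).+1)%N.
  elim: r => [|i r IHr]; first by rewrite big_nil size_poly1.
  rewrite big_cons; apply: (leq_trans (size_polyMleq _ _)).
  apply: (@leq_trans (c.+1 + (size r * c).+1).-1).
      by rewrite -!subn1 leq_sub2r // leq_add.
    by rewrite addnS /= mulSn addSn.
have := hp (enum 'I_n); rewrite size_enum_ord big_enum /= => h.
apply: (leq_trans _ h).
by case: (perm.odd_perm s); rewrite ?expr1 ?expr0 ?mul1r ?mulN1r ?size_polyN.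
Qed.

Lemma size_adj_le n (A : 'M[{poly F}]_n) c i j : (forall i j, (size (A i j) <= c.+1)%N) ->
  (size ((\adj A) i j) <= (n.-1 * c).+1)%N.
Proof.
move=> hA; rewrite mxE /cofactor.
have h := @size_det_le _ (row' j (col' i A)) c.
rewrite -signr_odd; case: (odd _); rewrite ?expr1 ?expr0 ?mul1r ?mulN1r ?size_polyN;
  by apply: h => a b; rewrite !mxE.
Qed.

End backshift_mulmx.

(** * Two-sided series of complex numbers *)

Section complex_series.
Context {R : realType}.
Local Notation C := R[i].
Local Notation Re := (@complex.Re R).
Local Notation Im := (@complex.Im R).
Implicit Types (u v : nat -> C) (f g : int -> C) (x y : nat -> R).

(** Convergence in C expressed through the real-valued modulus, which gives
access to the limit theory of the reals. *)
Definition cvgC u (l : C) := (fun n => normc (u n - l)) @ \oo --> (0 : R).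

Lemma cvgC_le u l x : (forall n, normc (u n - l) <= x n) -> x @ \oo --> (0 : R) ->
  cvgC u l.
Proof.
move=> h hx; apply: (@squeeze_cvgr _ _ _ _ (fun=> 0) x) => //; last exact: cvg_cst.
by apply: nearW => n; rewrite normc_ge0 h.
Qed.

Lemma cvgC_cst (l : C) : cvgC (fun=> l) l.
Proof. by rewrite /cvgC subrr normc0; exact: cvg_cst. Qed.

Lemma cvgCD u v l1 l2 : cvgC u l1 -> cvgC v l2 -> cvgC (fun n => u n + v n) (l1 + l2).
Proof.
move=> h1 h2; apply: cvgC_le (fun n => normc (u n - l1) + normc (v n - l2)) _ _.
  by move=> n; rewrite opprD addrACA; exact: le_normcD.
by rewrite -[0]addr0; exact: cvgD.
Qed.

Lemma cvgCZ u l (c : C) : cvgC u l -> cvgC (fun n => c * u n) (c * l).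
Proof.
move=> h; apply: cvgC_le (fun n => normc c * normc (u n - l)) _ _.
  by move=> n; rewrite -mulrBr normcM.
by rewrite -[0](mulr0 (normc c)); exact: cvgMl_tmp.
Qed.

Lemma cvgC_unique u l1 l2 : cvgC u l1 -> cvgC u l2 -> l1 = l2.
Proof.
move=> h1 h2; apply/eqP; rewrite -subr_eq0; apply/eqP/eq0_normc.
have h : (fun=> normc (l1 - l2)) @ \oo --> (0 : R).
  apply: (@squeeze_cvgr _ _ _ _ (fun=> 0) (fun n => normc (u n - l1) + normc (u n - l2))).
  - apply: nearW => n; rewrite normc_ge0 /=.
    have -> : l1 - l2 = (u n - l2) - (u n - l1) by ring.
    by rewrite addrC; apply: le_trans (le_normcD _ _) _; rewrite normcN.
  - exact: cvg_cst.
  - by rewrite -[0]addr0; exact: cvgD.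
by rewrite -(cvg_lim (@Rhausdorff R) h) lim_cst //; exact: Rhausdorff.
Qed.

Lemma cvgC_comp u l (k : nat -> nat) : (forall n, (n <= k n)%N) -> cvgC u l ->
  cvgC (fun n => u (k n)) l.
Proof.
move=> hk h A /h [N _ hN]; exists N => // n Nn.
by apply: hN; exact: leq_trans Nn (hk n).
Qed.

Lemma cvgC_bounded u l (b : R) : cvgC u l -> (forall n, normc (u n) <= b) ->
  normc l <= b.
Proof.
move=> h hb; have h2 : (fun n => normc (u n - l) + b) @ \oo --> (0 + b).
  by apply: cvgD => //; exact: cvg_cst.
rewrite add0r in h2; rewrite -(cvg_lim (@Rhausdorff R) h2).
apply: limr_ge; first exact: cvgP h2.
apply: nearW => n; rewrite [X in normc X <= _](_ : l = u n - (u n - l)); last by ring.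

by apply: le_trans (le_normcD _ _) _; rewrite normcN addrC lerD2l.
Qed.

(** The moduli of the real and imaginary parts are dominated by the modulus. *)
Lemma abs_cvgC u : cvgn (series (fun n => normc (u n))) ->
  exists l, cvgC (fun n => \sum_(i < n) u i) l.
Proof.
move=> h.
have part (p : C -> R) : (forall z, `|p z| <= normc z) ->
    cvgn (series (fun n => p (u n))).
  move=> hp; apply: normed_cvg.
  by apply: series_le_cvg h => n; rewrite ?normc_ge0 ?normr_ge0 ?hp.
have /cvg_ex [a ha] := part Re (@Re_le_normc R).
have /cvg_ex [b hb] := part Im (@Im_le_normc R).
exists (a +i* b)%C.
apply: cvgC_le (fun n => `|series (fun n => Re (u n)) n - a| +
                         `|series (fun n => Im (u n)) n - b|) _ _.
  move=> n; apply: le_trans (normc_le_ReIm _) _; rewrite !raddfB !raddf_sum /=.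
  by rewrite /series /= !big_mkord.
rewrite -[0]addr0; apply: cvgD.
  by rewrite -[0](@normr0 _ R) -(subrr a); apply: cvg_norm; apply: cvgB => //; exact: cvg_cst.
by rewrite -[0](@normr0 _ R) -(subrr b); apply: cvg_norm; apply: cvgB => //; exact: cvg_cst.
Qed.

(** The two halves are required to converge separately, which matches the usual
meaning of convergence of a Laurent series. *)
Definition has_zsum f (l : C) := exists l1 l2, [/\ l = l1 + l2,
  cvgC (fun n => \sum_(i < n) f i%:Z) l1 &
  cvgC (fun n => \sum_(i < n) f (- i.+1%:Z)) l2].

Lemma eq_has_zsum f g l : f =1 g -> has_zsum f l -> has_zsum g l.
Proof. by move=> /funext ->. Qed.

Lemma has_zsum_unique f l l' : has_zsum f l -> has_zsum f l' -> l = l'.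
Proof.
by move=> [a [b [-> ha hb]]] [a' [b' [-> /(cvgC_unique ha) -> /(cvgC_unique hb) ->]]].
Qed.

Lemma has_zsumD f g l l' : has_zsum f l -> has_zsum g l' ->
  has_zsum (fun j => f j + g j) (l + l').
Proof.
move=> [a [b [-> ha hb]]] [a' [b' [-> ha' hb']]].
exists (a + a'), (b + b'); split; first by ring.
  by under eq_fun do rewrite big_split /=; exact: cvgCD.
by under eq_fun do rewrite big_split /=; exact: cvgCD.
Qed.

Lemma has_zsumZ f l (c : C) : has_zsum f l -> has_zsum (fun j => c * f j) (c * l).
Proof.
move=> [a [b [-> ha hb]]]; exists (c * a), (c * b); split; first by ring.
  by under eq_fun do rewrite -mulr_sumr; exact: cvgCZ.
by under eq_fun do rewrite -mulr_sumr; exact: cvgCZ.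
Qed.

Lemma has_zsum0 : has_zsum (fun=> 0) 0.
Proof.
exists 0, 0; split; first by rewrite addr0.
  by under eq_fun do rewrite big1 //; exact: cvgC_cst.
by under eq_fun do rewrite big1 //; exact: cvgC_cst.
Qed.

Lemma has_zsum_sum (I : Type) (r : seq I) (f : I -> int -> C) (l : I -> C) :
  (forall i, has_zsum (f i) (l i)) ->
  has_zsum (fun j => \sum_(i <- r) f i j) (\sum_(i <- r) l i).
Proof.
move=> h; elim: r => [|i r IHr].
  by rewrite big_nil; apply: eq_has_zsum has_zsum0 => j; rewrite big_nil.
rewrite big_cons; apply: eq_has_zsum (has_zsumD (h i) IHr) => j.
by rewrite big_cons.
Qed.

Lemma cvgC_shiftS u l : cvgC u l -> cvgC (fun n => u n.+1) l.
Proof. by apply: cvgC_comp => n. Qed.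

Lemma cvgC_unshiftS u l : cvgC (fun n => u n.+1) l -> cvgC u l.
Proof. by move=> h A /h [N _ hN]; exists N.+1 => // -[|n] //= Nn; exact: hN. Qed.

Lemma has_zsum_shift1 f l : has_zsum f l -> has_zsum (fun j => f (j - 1)) l.
Proof.
move=> [a [b [-> ha hb]]]; exists (f (-1) + a), (- f (-1) + b); split; first by ring.
  apply: cvgC_unshiftS.
  have -> : (fun n => \sum_(i < n.+1) f (i%:Z - 1)) =
            (fun n => f (-1) + \sum_(i < n) f i%:Z).
    apply/funext => n; rewrite big_ord_recl sub0r; congr (_ + _).
    by apply: eq_bigr => i _; congr f; rewrite /= /bump /=; lia.
  by apply: cvgCD => //; exact: cvgC_cst.
have -> : (fun n => \sum_(i < n) f (- i.+1%:Z - 1)) =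
          (fun n => - f (-1) + \sum_(i < n.+1) f (- i.+1%:Z)).
  apply/funext => n; rewrite big_ord_recl addKr.
  by apply: eq_bigr => i _; congr f; rewrite /= /bump /=; lia.
apply: cvgCD; first exact: cvgC_cst.
exact: (cvgC_shiftS (u := fun n => \sum_(i < n) f (- i.+1%:Z))).
Qed.

Lemma has_zsum_unshift1 f l : has_zsum (fun j => f (j - 1)) l -> has_zsum f l.
Proof.
move=> [a [b [-> ha hb]]]; exists (- f (-1) + a), (f (-1) + b); split; first by ring.
  have -> : (fun n => \sum_(i < n) f i%:Z) =
            (fun n => - f (-1) + \sum_(i < n.+1) f (i%:Z - 1)).
    apply/funext => n; rewrite big_ord_recl sub0r addKr.
    by apply: eq_bigr => i _; congr f; rewrite /= /bump /=; lia.
  apply: cvgCD; first exact: cvgC_cst.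
  exact: (cvgC_shiftS (u := fun n => \sum_(i < n) f (i%:Z - 1))).
apply: cvgC_unshiftS.
have -> : (fun n => \sum_(i < n.+1) f (- i.+1%:Z)) =
          (fun n => f (-1) + \sum_(i < n) f (- i.+1%:Z - 1)).
  apply/funext => n; rewrite big_ord_recl; congr (_ + _).
  by apply: eq_bigr => i _; congr f; rewrite /= /bump /=; lia.
by apply: cvgCD => //; exact: cvgC_cst.
Qed.

Lemma has_zsum_shift f l (h : int) : has_zsum f l -> has_zsum (fun j => f (j + h)) l.
Proof.
case: h => n.
  elim: n f => [|n IHn] f hf.
    by apply: eq_has_zsum hf => j; rewrite addr0.
  have := IHn _ hf => h1; apply: has_zsum_unshift1.
  by apply: eq_has_zsum h1 => j; congr f; lia.
elim: n f => [|n IHn] f hf.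
  by apply: eq_has_zsum (has_zsum_shift1 hf) => j.
by apply: eq_has_zsum (has_zsum_shift1 (IHn _ hf)) => j; congr f; lia.
Qed.

End complex_series.

(** * Geometrically decaying Laurent coefficients *)

Section geometric_decay.
Context {R : realType}.
Local Notation C := R[i].
Implicit Types (a b : int -> C) (x y : nat -> R) (p q : {poly C}).

Definition ngeo x := exists K rho, [/\ 0 <= K, 0 < rho < 1 & forall n, x n <= K * rho ^+ n].

(** Geometric decay in both directions is what the coefficients of a function that is
holomorphic near the unit circle have; unlike summability it is stable under
division by polynomials without zeros on the circle, and it survives
multiplication by subexponentially growing factors. *)
Definition geo a := ngeo (fun n => normc (a n%:Z)) /\ ngeo (fun n => normc (a (- n%:Z))).

Lemma ngeo_le x y : (forall n, x n <= y n) -> ngeo y -> ngeo x.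
Proof.
by move=> h [K [rho [K0 r hy]]]; exists K, rho; split => // n; exact: le_trans (hy n).
Qed.

Lemma ngeo_common K1 K2 r1 r2 : 0 <= K1 -> 0 <= K2 -> 0 < r1 < 1 -> 0 < r2 < 1 ->
  exists2 rho : R, 0 < rho < 1 &
    forall n, K1 * r1 ^+ n + K2 * r2 ^+ n <= (K1 + K2) * rho ^+ n.
Proof.
move=> k1 k2 /andP[r10 r11] /andP[r20 r21]; exists (Num.max r1 r2).
  by rewrite lt_max r10 /= gt_max r11.
move=> n; rewrite mulrDl lerD // ler_wpM2l // lerXn2r ?nnegrE ?le_max ?lexx ?orbT //;
  by rewrite ?ltW // lt_max r10.
Qed.

Lemma ngeoD x y : ngeo x -> ngeo y -> ngeo (fun n => x n + y n).
Proof.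
move=> [K1 [r1 [k1 h1 hx]]] [K2 [r2 [k2 h2 hy]]].
have [rho r hr] := ngeo_common k1 k2 h1 h2.
exists (K1 + K2), rho; split => //; first exact: addr_ge0.
by move=> n; apply: le_trans (hr n); rewrite lerD.
Qed.

Lemma ngeoZ c x : 0 <= c -> ngeo x -> ngeo (fun n => c * x n).
Proof.
move=> c0 [K [rho [K0 r hx]]]; exists (c * K), rho; split => //; first exact: mulr_ge0.
by move=> n; rewrite -mulrA ler_wpM2l.
Qed.

Lemma ngeo_shift1 x : ngeo x -> ngeo (fun n => x n.+1).
Proof.
move=> [K [rho [K0 r hx]]]; exists K, rho; split => // n.
apply: le_trans (hx n.+1) _; case/andP: r => r0 r1.
by rewrite exprS mulrCA ler_piMl ?mulr_ge0 ?exprn_ge0 // ltW.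
Qed.

Lemma ngeo_unshift1 x : ngeo (fun n => x n.+1) -> ngeo x.
Proof.
move=> [K [rho [K0 r hx]]]; case/andP: (r) => r0 r1.
exists (`|x 0%N| + K / rho), rho; split => //.
  by rewrite addr_ge0 // divr_ge0 // ltW.
case=> [|n].
  by rewrite expr0 mulr1 -[leLHS]addr0 lerD ?ler_norm // divr_ge0 // ltW.
apply: le_trans (hx n) _; rewrite mulrDl.
have -> : K / rho * rho ^+ n.+1 = K * rho ^+ n by rewrite exprS mulrA divfK ?gt_eqF.
by rewrite lerDr mulr_ge0 // exprn_ge0 // ltW.
Qed.

Lemma geoP a : geo a <-> exists K rho, [/\ 0 <= K, 0 < rho < 1 &
  forall j, normc (a j) <= K * rho ^+ `|j|%N].
Proof.
split=> [[[K1 [r1 [k1 h1 hx]]] [K2 [r2 [k2 h2 hy]]]]|[K [rho [K0 r h]]]].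
  have [rho r hr] := ngeo_common k1 k2 h1 h2.
  exists (K1 + K2), rho; split => //; first exact: addr_ge0.
  have [/andP[p1 _] /andP[p2 _]] := (h1, h2).
  move=> [n|n]; rewrite /=.
    apply: le_trans (hx n) (le_trans _ (hr n)).
    by rewrite lerDl mulr_ge0 // exprn_ge0 // ltW.
  rewrite NegzE; apply: le_trans (hy n.+1) (le_trans _ (hr n.+1)).
  by rewrite lerDr mulr_ge0 // exprn_ge0 // ltW.
split; first by exists K, rho; split => // n; exact: (h n%:Z).
exists K, rho; split => // n.
by have := h (- n%:Z); rewrite abszN.
Qed.

Lemma geo_shift1 a : geo a -> geo (fun j => a (j + 1)).
Proof.
move=> [h1 h2]; split.
  have -> : (fun n => normc (a (n%:Z + 1))) = (fun n => normc (a n.+1%:Z)).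
    by apply/funext => n; congr (normc (a _)); lia.
  exact: (ngeo_shift1 h1).
apply: ngeo_unshift1; move: h2; rewrite (_ : (fun n => normc (a (- n.+1%:Z + 1))) =
  (fun n => normc (a (- n%:Z)))) //.
by apply/funext => n; congr (normc (a _)); lia.
Qed.

Lemma geo_opp a : geo a -> geo (fun j => a (- j)).
Proof.
move=> [h1 h2]; split => //; move: h1.
by rewrite (_ : (fun n => normc (a (- - n%:Z))) = (fun n => normc (a n%:Z))) //;
  apply/funext => n; rewrite opprK.
Qed.

Lemma geo_shift a (h : int) : geo a -> geo (fun j => a (j + h)).
Proof.
have pos b n : geo b -> geo (fun j => b (j + n%:Z)).
  elim: n b => [|n IHn] b hb.
    by rewrite (_ : (fun j => _) = b) //; apply/funext => j; rewrite addr0.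
  rewrite (_ : (fun j => _) = (fun j => b (j + 1 + n%:Z))).
    exact: (geo_shift1 (IHn b hb)).
  by apply/funext => j; congr b; lia.
case: h => n ha; first exact: pos.
have h1 := geo_opp (pos _ n.+1 (geo_opp ha)).
by rewrite (_ : (fun j => _) = (fun j => a (- (- j + n.+1%:Z)))) //;
  apply/funext => j; congr a; lia.
Qed.

Lemma geoD a b : geo a -> geo b -> geo (fun j => a j + b j).
Proof.
move=> [a1 a2] [b1 b2]; split.
  by apply: ngeo_le (ngeoD a1 b1) => n; exact: le_normcD.
by apply: ngeo_le (ngeoD a2 b2) => n; exact: le_normcD.
Qed.

Lemma geoZ c a : geo a -> geo (fun j => c * a j).
Proof.
move=> [a1 a2]; split.
  by apply: ngeo_le (ngeoZ (normc_ge0 c) a1) => n; rewrite normcM.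
by apply: ngeo_le (ngeoZ (normc_ge0 c) a2) => n; rewrite normcM.
Qed.

Lemma geo0 : geo (fun=> 0).
Proof.
apply/geoP; exists 0, (2^-1); split => //; first by lra.
by move=> j; rewrite normc0 mul0r.
Qed.

Lemma geo_sum (I : Type) (r : seq I) (f : I -> int -> C) :
  (forall i, geo (f i)) -> geo (fun j => \sum_(i <- r) f i j).
Proof.
move=> h; elim: r => [|i r IHr].
  by rewrite (_ : (fun j => _) = (fun=> 0)) //; [exact: geo0|apply/funext => j; rewrite big_nil].
rewrite (_ : (fun j => _) = (fun j => f i j + \sum_(i <- r) f i j)); first exact: geoD.
by apply/funext => j; rewrite big_cons.
Qed.

Lemma geo_pact p a : geo a -> geo (pact p a).
Proof.
move=> ha; apply: geo_sum => e; apply: geoZ; exact: (geo_shift (- e%:Z) ha).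
Qed.

Lemma geo_polyseqz p : geo (polyseqz p).
Proof.
have -> : polyseqz p = pact p (polyseqz 1).
  by apply/funext => j; rewrite pact_polyseqz mulr1.
apply: geo_pact; apply/geoP; exists 1, (2^-1); split => //; first by lra.
have h0 n : 0 <= 1 * 2^-1 ^+ n :> R by rewrite mulr_ge0 // exprn_ge0 // invr_ge0 ler0n.
case=> [[|n]|n].
- have -> : polyseqz (1 : {poly C}) 0%N = 1 by rewrite /polyseqz coef1.
  by rewrite normc1 expr0 mulr1.
- have -> : polyseqz (1 : {poly C}) n.+1 = 0 by rewrite /polyseqz coef1.
  by rewrite normc0.
- have -> : polyseqz (1 : {poly C}) (Negz n) = 0 by [].
  by rewrite normc0.
Qed.

Lemma ngeo_series x : (forall n, 0 <= x n) -> ngeo x -> cvgn (series x).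
Proof.
move=> x0 [K [rho [K0 /andP[r0 r1] h]]].
apply: (@series_le_cvg _ x (geometric K rho)) => // [n|].
  by rewrite /= mulr_ge0 // exprn_ge0 // ltW.
by apply: is_cvg_geometric_series; rewrite ger0_norm // ltW.
Qed.

Lemma geo_zsum a : geo a -> exists l, has_zsum a l.
Proof.
move=> [h1 h2].
have [l1 hl1] := abs_cvgC (ngeo_series (fun n => normc_ge0 _) h1).
have [l2 hl2] := abs_cvgC (ngeo_series (fun n => normc_ge0 _) (ngeo_shift1 h2)).
by exists (l1 + l2), l1, l2.
Qed.

Lemma normcX (z : C) n : normc (z ^+ n) = normc z ^+ n.
Proof. by elim: n => [|n IHn]; rewrite ?expr0 ?normc1 // !exprS normcM IHn. Qed.

(** The rate of decay leaves room for a slightly larger or smaller |z|. *)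
Lemma geo_twist a : geo a -> exists2 e : R, 0 < e < 1 &
  forall z : C, `|normc z - 1| < e -> geo (fun j => z ^ j * a j).
Proof.
move=> /geoP[K [rho [K0 /andP[r0 r1] h]]]; exists ((1 - rho) / 2).
  by apply/andP; split; lra.
move=> z; rewrite ltr_norml => /andP[z1 z2].
have nz : 0 < normc z by lra.
split.
  exists K, (normc z * rho); split => //.
    by rewrite mulr_gt0 //=; nra.
  move=> n; rewrite normcM -exprnP normcX exprMn mulrCA.
  by apply: ler_wpM2l; [rewrite exprn_ge0 // ltW | exact: h].
exists K, (rho / normc z); split => //.
  by rewrite divr_gt0 //= ltr_pdivrMr //; lra.
move=> n; rewrite normcM -exprnN normcV normcX expr_div_n mulrA mulrC.
apply: ler_wpM2r; first by rewrite invr_ge0 exprn_ge0 // ltW.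
by have := h (- n%:Z); rewrite abszN.
Qed.

Lemma normc_eq0 (z : C) : (normc z == 0) = (z == 0).
Proof. by apply/eqP/eqP => [/eq0_normc|->] //; exact: normc0. Qed.

(** In terms of generating functions the backshift operator is multiplication by z. *)
Lemma has_zsum_pact (z : C) p a l : z != 0 -> has_zsum (fun j => z ^ j * a j) l ->
  has_zsum (fun j => z ^ j * pact p a j) (p.[z] * l).
Proof.
move=> z0 h; elim/poly_ind: p => [|p c IHp].
  by rewrite horner0 mul0r; apply: eq_has_zsum has_zsum0 => j; rewrite pact0 mulr0.
have -> : (p * 'X + c%:P).[z] * l = z * (p.[z] * l) + c * l 
  by rewrite hornerD hornerMX hornerC mulrDl (mulrC _ z) -mulrA.
apply: eq_has_zsum (has_zsumD (has_zsumZ z (has_zsum_shift1 IHp)) (has_zsumZ c h)).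
move=> j; rewrite pactD pactMX pactC mulrDr; congr (_ + _); last exact: mulrCA.
have -> : (z ^ j = z * z ^ (j - 1))%R.
  by rewrite -{2}[z]expr1z -expfzDr //; congr (_ ^ _)%R; lia.
by rewrite mulrA.
Qed.

Lemma has_zsum_polyseqz (z : C) p : z != 0 ->
  has_zsum (fun j => z ^ j * polyseqz p j) p.[z].
Proof.
move=> z0.
have h1 : has_zsum (fun j => z ^ j * polyseqz 1 j) 1.
  exists 1, 0; split; first by rewrite addr0.
    apply: cvgC_unshiftS; rewrite (_ : (fun n => _) = (fun=> 1)); first exact: cvgC_cst.
    apply/funext => n; rewrite big_ord_recl /= coef1 eqxx mulr1 expr0z big1 ?addr0 //.
    by move=> i _; rewrite coef1 mulr0.
  rewrite (_ : (fun n => _) = (fun=> 0)); first exact: cvgC_cst.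
  by apply/funext => n; rewrite big1 // => i _; rewrite -NegzE /= mulr0.
have := has_zsum_pact p z0 h1; rewrite mulr1; apply: eq_has_zsum => j.
by rewrite pact_polyseqz mulr1.
Qed.

Lemma has_zsum_even (f : int -> C) l : has_zsum (fun j : int => if odd `|j| then 0 else f j) l ->
  has_zsum (fun j => f (2 * j)) l.
Proof.
move=> [l1 [l2 [-> h1 h2]]]; exists l1, l2; split => //.
  rewrite (_ : (fun n => _) = (fun n => \sum_(i < n.*2) (if odd `|i| then 0 else f i%:Z))).
    by apply: (cvgC_comp _ h1) => n; rewrite -addnn leq_addr.
  apply/funext; elim=> [|n IHn]; first by rewrite !big_ord0.
  rewrite doubleS !big_ord_recr /= {}IHn odd_double /= addr0; congr (_ + f _).
  by rewrite -muln2; lia.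
rewrite (_ : (fun n => _) =
    (fun n => \sum_(i < n.*2) (if odd `|(- i.+1%:Z)| then 0 else f (- i.+1%:Z)))).
  by apply: (cvgC_comp _ h2) => n; rewrite -addnn leq_addr.
apply/funext; elim=> [|n IHn]; first by rewrite !big_ord0.
rewrite doubleS !big_ord_recr /= {}IHn odd_double /= addr0; congr (_ + f _).
by rewrite -muln2; lia.
Qed.

(** Uniqueness of Laurent coefficients.  Averaging over z and -z keeps only the
even coefficients; iterating this k times isolates the coefficients whose index
is divisible by 2 ^ k, and in the limit the constant one. *)
Lemma laurent_unique a : geo a ->
  (forall z : C, normc z = 1 -> has_zsum (fun j => z ^ j * a j) 0) ->
  forall j, a j = 0.
Proof.
have step b : (forall z : C, normc z = 1 -> has_zsum (fun j => z ^ j * b j) 0) ->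
    forall z : C, normc z = 1 -> has_zsum (fun j => z ^ j * b (2 * j)) 0.
  move=> h z hz; pose w := sqrtc z; have wz : w ^+ 2 = z by exact: sqr_sqrtc.
  have nw : normc w = 1.
    have : normc w ^+ 2 = 1 by rewrite -normcX wz.
    by move/eqP; rewrite sqrf_eq1 => /orP[/eqP //|/eqP e]; have := normc_ge0 w; rewrite e; lra.
  have nNw : normc (- w) = 1 by rewrite normcN.
  have := has_zsumZ (2^-1) (has_zsumD (h _ nw) (h _ nNw)); rewrite addr0 mulr0 => h2.
  have h3 : has_zsum (fun j : int => if odd `|j| then 0 else w ^ j * b j) 0.
    apply: eq_has_zsum h2 => j.
    have -> : (- w) ^ j = (if odd `|j| then -1 else 1) * w ^ j.
      rewrite -(mulN1r w) expfzMl; congr (_ * _).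
      case: j => n; first by rewrite -exprnP -signr_odd /=; case: (odd n).
      by rewrite NegzE abszN -exprnN -signr_odd /=; case: (odd _); rewrite ?expr1 ?invrN invr1.
    by case: (odd _); [ring | field; lra].
  have := has_zsum_even h3; apply: eq_has_zsum => j.
  by rewrite -exprz_exp -wz.
(* k halvings leave the series of b (2 ^ k j), whose terms with j != 0 tend to 0 *)
have iter_step b k : (forall z : C, normc z = 1 -> has_zsum (fun j => z ^ j * b j) 0) ->
    forall z : C, normc z = 1 -> has_zsum (fun j => z ^ j * b ((2 ^ k)%N%:Z * j)) 0.
  move=> h; elim: k => [|k IHk] z hz.
    by apply: eq_has_zsum (h z hz) => j; rewrite expn0 mul1r.
  apply: eq_has_zsum (step _ IHk z hz) => j.
  by congr (_ * b _); rewrite expnS; lia.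
have main b : geo b -> (forall z : C, normc z = 1 -> has_zsum (fun j => z ^ j * b j) 0) ->
    b 0 = 0.
  move=> /geoP[K [rho [K0 /andP[r0 r1] hb]]] h.
  have bound k : normc (b 0) <= 2 * K / (1 - rho) * rho ^+ k.
    have := iter_step b k h 1 (normc1 _) => -[l1 [l2 [l12 h1 h2]]].
    have k2 : (k < 2 ^ k)%N by exact: ltn_expl.
    have tail (f : nat -> C) l : (forall n, normc (f n) <= K * rho ^+ (k + n)) ->
        cvgC (fun n => \sum_(i < n) f i) l -> normc l <= K / (1 - rho) * rho ^+ k.
      move=> hf hl; apply: (cvgC_bounded hl) => n.
      apply: (@le_trans _ _ (\sum_(i < n) K * rho ^+ (k + i))).
        elim: n => [|n IHn]; first by rewrite !big_ord0 normc0.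
        rewrite !big_ord_recr /=; apply: le_trans (le_normcD _ _) _.
        by rewrite lerD.
      under eq_bigr do rewrite exprD mulrA.
      rewrite -mulr_sumr mulrAC ler_wpM2r ?exprn_ge0 ?(ltW r0) //.
      rewrite ler_wpM2l // -[leRHS]mul1r ler_pdivlMr; last by lra.
      have := subrX1 rho n; rewrite /= => e.
      have rn : 0 <= rho ^+ n by rewrite exprn_ge0 // ltW.
      by rewrite mulrC -opprB mulNr -e; lra.
    have h1' : cvgC (fun n => \sum_(i < n) 1 ^ i.+1%:Z * b ((2 ^ k)%N%:Z * i.+1%:Z)) (l1 - b 0).
      have -> : (fun n => \sum_(i < n) 1 ^ i.+1%:Z * b ((2 ^ k)%N%:Z * i.+1%:Z)) =
        (fun n => \sum_(i < n.+1) 1 ^ i%:Z * b ((2 ^ k)%N%:Z * i%:Z) - b 0).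
        apply/funext => n; rewrite big_ord_recl /= mulr0 exp1rz mul1r addrC addKr.
        by apply: eq_bigr => i _.
      apply: cvgCD; last exact: cvgC_cst.
      exact: (cvgC_shiftS (u := fun n => \sum_(i < n) 1 ^ i%:Z * b ((2 ^ k)%N%:Z * i%:Z))).
    have decay (i : nat) (j : int) : `|j|%N = ((2 ^ k) * i.+1)%N ->
        normc (1 ^ j * b j) <= K * rho ^+ (k + i).
      move=> ej; rewrite exp1rz mul1r; apply: le_trans (hb j) _.
      rewrite ler_wpM2l // ler_wiXn2l ?(ltW r0) ?(ltW r1) // ej; nia.
    have t1 := fun hf => tail (fun i => 1 ^ i.+1%:Z * b ((2 ^ k)%N%:Z * i.+1%:Z)) _ hf h1'.
    have t2 := fun hf => tail (fun i => 1 ^ (- i.+1%:Z) * b ((2 ^ k)%N%:Z * - i.+1%:Z))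
      _ hf h2.
    have -> : b 0 = - ((l1 - b 0) + l2) by rewrite -addrA (addrC _ l2) addrA -l12 sub0r opprK.
    rewrite normcN; apply: le_trans (le_normcD _ _) _.
    rewrite (_ : 2 * K / _ * _ = K / (1 - rho) * rho ^+ k + K / (1 - rho) * rho ^+ k); last by ring.
    apply: lerD.
      by apply: t1 => n; have := decay n ((2 ^ k)%N%:Z * n.+1%:Z); rewrite !exp1rz; apply; lia.
    by apply: t2 => n; have := decay n ((2 ^ k)%N%:Z * - n.+1%:Z); rewrite !exp1rz; apply; lia.
  apply/eq0_normc/eqP; rewrite eq_le normc_ge0 andbT.
  have hl : (fun k => 2 * K / (1 - rho) * rho ^+ k) @ \oo --> (0 : R).
    by apply: (@cvg_geometric R); rewrite ger0_norm // ltW.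
  rewrite -(cvg_lim (@Rhausdorff R) hl); apply: limr_ge; first exact: cvgP hl.
  exact: nearW.
move=> ha h j; rewrite -[j]add0r; apply: (main (fun i => a (i + j))).
  exact: geo_shift.
move=> z hz; have z0 : z != 0 by rewrite -normc_eq0 hz oner_eq0.
have := has_zsumZ (z ^ (- j)) (has_zsum_shift j (h z hz)); rewrite mulr0.
apply: eq_has_zsum => i; rewrite mulrA -expfzDr //; congr (z ^ _ * _); lia.
Qed.

Lemma geo_cvg0 a : geo a -> forall e : R, 0 < e -> exists n : nat,
  normc (a n%:Z) < e /\ normc (a (- n%:Z)) < e.
Proof.
move=> /geoP[K [rho [K0 /andP[r0 r1] h]]] e e0.
have hl : (fun k => K * rho ^+ k) @ \oo --> (0 : R).
  by apply: (@cvg_geometric R); rewrite ger0_norm // ltW.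
move/cvgrPdist_lt: hl => /(_ e e0) [n _ hn]; exists n.
have := hn n (leqnn n); rewrite /= sub0r normrN ger0_norm; last first.
  by rewrite mulr_ge0 // exprn_ge0 // ltW.
move=> hK; split; first exact: le_lt_trans (h n) hK.
by apply: le_lt_trans (h _) _; rewrite abszN.
Qed.

(** A solution of the first-order equation for X - c is a multiple of c ^ (- j), which
cannot tend to 0 in both directions of time; the factors of p are removed one
at a time. *)
Lemma pact_inj a p : geo a -> p != 0 -> (forall j, pact p a j = 0) ->
  forall j, a j = 0.
Proof.
have lin b (c : C) : geo b -> (forall j, pact ('X - c%:P) b j = 0) -> forall j, b j = 0.
  move=> hb h j.
  have rec i : b (i - 1) = c * b i.
    by have := h i; rewrite pactXsubC => /eqP; rewrite subr_eq0 => /eqP.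
  have back n i : b (i - n%:Z) = c ^+ n * b i.
    elim: n i => [|n IHn] i; first by rewrite subr0 expr0 mul1r.
    by rewrite exprS -mulrA -IHn -rec; congr b; lia.
  apply: eq0_normc; apply/eqP; rewrite eq_le normc_ge0 andbT leNgt; apply/negP => e0.
  have [n [h1 h2]] := geo_cvg0 (geo_shift j hb) e0.
  have := back n j; rewrite addrC => /(congr1 (@normc R)); rewrite normcM normcX => e1.
  have := back n (n%:Z + j); rewrite [n%:Z + j - _]addrAC subrr add0r => /(congr1 (@normc R)).
  rewrite normcM normcX => e2.
  have [c1|c1] := leP 1 (normc c).
    have : 1 <= normc c ^+ n by exact: exprn_ege1.
    by move: e1 h2; rewrite addrC => -> h2 h3; nra.
  have : normc c ^+ n <= 1 by rewrite exprn_ile1 ?normc_ge0 // ltW.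
  have := normc_ge0 (b (n%:Z + j)); nra.
move=> ha p0; have [rs ->] := closed_field_poly_normal p.
rewrite -mul_polyC => h.
have {}h j : pact (\prod_(z <- rs) ('X - z%:P)) a j = 0.
  have := h j; rewrite pactM pactC => /eqP; rewrite mulf_eq0 lead_coef_eq0 (negbTE p0).
  by move/eqP.
elim: rs h => [|c rs IHrs] h.
  by move=> j; have := h j; rewrite big_nil pact1.
apply: IHrs; apply: (lin _ c); first exact: geo_pact.
by move=> j; rewrite -pactM; have := h j; rewrite big_cons.
Qed.

End geometric_decay.

(** * Laurent expansion of rational functions *)

Section rational_laurent.
Context {R : realType}.
Local Notation C := R[i].
Implicit Types (a b : int -> C) (x y : nat -> R) (p q : {poly C}).

(** The sequence x is dominated by the convolution of a geometric sequence with y, and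
decays at every rate slower than both of theirs. *)
Lemma ngeo_rec x y (tau : R) : 0 <= tau < 1 -> ngeo y ->
  (forall n, x n.+1 <= tau * x n + y n) -> ngeo x.
Proof.
move=> /andP[t0 t1] [K [rho [K0 /andP[r0 r1] hy]]] h.
pose r := (1 + Num.max tau rho) / 2.
have [tr rr] : tau < r /\ rho < r.
  have : Num.max tau rho < 1 by rewrite gt_max t1.
  have : tau <= Num.max tau rho by rewrite le_max lexx.
  have : rho <= Num.max tau rho by rewrite le_max lexx orbT.
  by rewrite /r; set M := Num.max _ _ => h1 h2 h3; split; lra.
have r1' : r < 1.
  have : Num.max tau rho < 1 by rewrite gt_max t1.
  by rewrite /r; set M := Num.max _ _ => h3; lra.
have rt : 0 < r - tau by lra.
pose K' := `|x 0%N| + K / (r - tau).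
have K'K : K <= (r - tau) * K'.
  by rewrite /K' mulrDr mulrCA mulfV ?gt_eqF // mulr1 lerDr mulr_ge0 // ltW.
have K'0 : 0 <= K' by rewrite addr_ge0 // divr_ge0 // ltW.
exists K', r; split => //; first by apply/andP; split; lra.
elim=> [|n IHn].
  by rewrite expr0 mulr1 /K' -[leLHS]addr0 lerD ?ler_norm // divr_ge0 // ltW.
apply: le_trans (h n) _.
apply: (@le_trans _ _ (tau * (K' * r ^+ n) + K * r ^+ n)).
  apply: lerD; first exact: ler_wpM2l.
  apply: le_trans (hy n) _; rewrite ler_wpM2l // lerXn2r ?nnegrE ?ltW //.
  lra.
rewrite mulrA -mulrDl exprS mulrA; apply: ler_wpM2r.
  by rewrite exprn_ge0 //; lra.
lra.
Qed.

Definition forward (a : nat -> C) (j : int) : C := if j is Posz n then a n else 0.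

Lemma geo_forward (u : nat -> C) : ngeo (fun n => normc (u n)) -> geo (forward u).
Proof.
move=> hu; split => //; apply: ngeo_unshift1.
rewrite (_ : (fun n => _) = (fun n => normc (0 : C))).
  by have [_] := @geo0 R.
by apply/funext => n; rewrite -NegzE.
Qed.

(** Dividing by X - c forward in time when |c| > 1, backward in time when
|c| < 1, preserves geometric decay. *)
Lemma divide_outer b (c : C) : 1 < normc c -> geo b -> (forall n, b (Negz n) = 0) ->
  exists a, [/\ geo a, forall n, a (Negz n) = 0
              & forall j, pact ('X - c%:P) a j = b j].
Proof.
move=> c1 hb b0; have c0 : c != 0 by rewrite -normc_eq0 gt_eqF // (lt_trans _ c1).
pose u := fix u n : C := if n is n'.+1 then c^-1 * (u n' - b n'.+1%:Z) else - (c^-1 * b 0).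
exists (forward u); split => //.
  apply: geo_forward; pose tau := (normc c)^-1.
  have t : 0 <= tau < 1 by rewrite /tau invr_ge0 normc_ge0 invf_lt1 // (lt_trans _ c1).
  apply: (@ngeo_rec _ (fun n => tau * normc (b n.+1%:Z)) tau) => //.
    by case: hb => /ngeo_shift1 hb _; apply: ngeoZ => //; case/andP: t.
  move=> n; rewrite /= normcM normcV -mulrDr ler_wpM2l ?invr_ge0 ?normc_ge0 //.
  by apply: le_trans (le_normcD _ _) _; rewrite normcN.
case=> [[|n]|n]; rewrite pactXsubC.
- by rewrite /= mulrN mulVKf // sub0r opprK.
- have -> : n.+1%:Z - 1 = n%:Z by lia.
  by rewrite /= mulVKf // opprB addrC subrK.
- by rewrite (_ : Negz n - 1 = Negz n.+1) ?b0 /= ?mulr0 ?subr0 //; lia.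
Qed.

Lemma divide_inner b (c : C) (J : int) : normc c < 1 -> geo b ->
  (forall j, J < j -> b j = 0) ->
  exists a, [/\ geo a, forall j, J < j -> a j = 0
              & forall j, pact ('X - c%:P) a j = b j].
Proof.
move=> c1 hb bJ.
pose u := fix u n : C := if n is n'.+1 then b (J - n'%:Z) + c * u n' else 0.
exists (fun j => forward u (J - j)).
have gu : geo (forward u).
  apply: geo_forward; apply: (@ngeo_rec _ (fun n => normc (b (J - n%:Z))) (normc c)).
  - by rewrite normc_ge0.
  - have [h3 _] := geo_opp (geo_shift J hb).
    move: h3; rewrite (_ : (fun n => normc (b (- n%:Z + J))) = (fun n => normc (b (J - n%:Z)))) //.
    by apply/funext => n; rewrite addrC.
  - by move=> n /=; rewrite -normcM addrC; exact: le_normcD.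
split.
- have := geo_opp (geo_shift J gu).
  rewrite (_ : (fun j => _) = (fun j => forward u (J - j))) //.
  by apply/funext => j; rewrite addrC.
- move=> j Jj; have -> : J - j = Negz (absz (j - J)%R).-1 by lia.
  by [].
move=> j; rewrite pactXsubC; have [jJ|Jj] := leP j J.
  have -> : J - (j - 1) = (absz (J - j)%R).+1%:Z by lia.
  have -> : J - j = (absz (J - j)%R)%:Z by lia.
  by rewrite /= addrK; congr b; lia.
rewrite bJ //; have [->|ne] := eqVneq j (J + 1).
  have -> : J - (J + 1 - 1) = 0 by lia.
  have -> : J - (J + 1) = Negz 0 by lia.
  by rewrite /= mulr0 subr0.
have -> : J - (j - 1) = Negz (absz (j - 1 - J)%R).-1 by lia.
have -> : J - j = Negz (absz (j - J)%R).-1 by lia.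
by rewrite /= mulr0 subr0.
Qed.

Lemma divide_outers b (rs : seq C) : all (fun c => 1 < normc c) rs -> geo b ->
  (forall n, b (Negz n) = 0) ->
  exists a, [/\ geo a, forall n, a (Negz n) = 0
              & forall j, pact (\prod_(c <- rs) ('X - c%:P)) a j = b j].
Proof.
elim: rs b => [|c rs IHrs] b.
  by move=> _ hb b0; exists b; split => // j; rewrite big_nil pact1.
move=> /andP[c1 hrs] hb b0; have [a [ga a0 ha]] := divide_outer c1 hb b0.
have [a' [ga' a0' ha']] := IHrs a hrs ga a0; exists a'; split => // j.
by rewrite big_cons pactM -ha; apply: eq_pact => i.
Qed.

Lemma divide_inners b (rs : seq C) (J : int) : all (fun c => normc c < 1) rs -> geo b ->
  (forall j, J < j -> b j = 0) ->
  exists a, geo a /\ forall j, pact (\prod_(c <- rs) ('X - c%:P)) a j = b j.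
Proof.
elim: rs b => [|c rs IHrs] b.
  by move=> _ hb b0; exists b; split => // j; rewrite big_nil pact1.
move=> /andP[c1 hrs] hb b0; have [a [ga a0 ha]] := divide_inner c1 hb b0.
have [a' [ga' ha']] := IHrs a hrs ga a0; exists a'; split => // j.
by rewrite big_cons pactM -ha; apply: eq_pact => i.
Qed.

(** Laurent expansion of q / p on the unit circle: by Bezout, q / p splits into
a part with poles outside the unit disc, expanded in powers of z, and a part
with poles inside, expanded in powers of 1 / z. *)
Lemma rational_laurent p q : p != 0 -> (forall z : C, normc z = 1 -> ~~ root p z) ->
  exists a, geo a /\ forall j, pact p a j = polyseqz q j.
Proof.
move=> p0 hp; have [rs prs] := closed_field_poly_normal p.
have lp0 : lead_coef p != 0 by rewrite lead_coef_eq0.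
pose ro := [seq c <- rs | 1 < normc c]; pose ri := [seq c <- rs | ~~ (1 < normc c)].
pose po := \prod_(c <- ro) ('X - c%:P); pose pi := \prod_(c <- ri) ('X - c%:P).
have hri : all (fun c => normc c < 1) ri.
  apply/allP => c; rewrite mem_filter -leNgt lt_neqAle => /andP[-> crs]; rewrite andbT.
  apply/negP => /eqP /hp; rewrite prs rootE hornerZ horner_prod (big_rem c) //=.
  by rewrite hornerXsubC subrr mul0r mulr0 eqxx.
have pE : p = lead_coef p *: (po * pi).
  rewrite {1}prs; congr (_ *: _); rewrite /po /pi !big_filter.
  by rewrite (bigID (fun c => 1 < normc c)).
have cop : coprimep po pi.
  apply/Pdiv.ClosedField.coprimepP => c.
  rewrite root_prod_XsubC mem_filter => /andP[c1 _].
  rewrite -rootE; apply/negP; rewrite root_prod_XsubC => /(allP hri).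
  by rewrite ltNge (ltW c1).
have [[u v] /= uv] := Bezout_eq1_coprimepP _ _ cop.
pose q' := (lead_coef p)^-1 *: q.
have [a1 [g1 h1]] : exists a, geo a /\ forall j, pact pi a j = polyseqz (q' * u) j.
  apply: (@divide_inners _ _ (size (q' * u))) => //; first exact: geo_polyseqz.
  by move=> [n|n] //; rewrite ltz_nat => h; rewrite /= nth_default // ltnW.
have [a2 [g2 _ h2]] : exists a, [/\ geo a, forall n, a (Negz n) = 0 &
    forall j, pact po a j = polyseqz (q' * v) j].
  by apply: divide_outers => //; [exact: filter_all | exact: geo_polyseqz].
exists (fun j => a1 j + a2 j); split; first exact: geoD.
move=> j; rewrite pE -mul_polyC pactM pactC pactDr.
have -> : pact (po * pi) a1 j = polyseqz (po * (q' * u)) j.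
  by rewrite pactM -pact_polyseqz; apply: eq_pact => i; rewrite h1.
have -> : pact (po * pi) a2 j = polyseqz (pi * (q' * v)) j.
  by rewrite mulrC pactM -pact_polyseqz; apply: eq_pact => i; rewrite h2.
have e : po * (q' * u) + pi * (q' * v) = q'.
  transitivity (q' * (u * po + v * pi)); last by rewrite uv mulr1.
  by ring.
case: j => n /=; last by rewrite addr0 mulr0.
by rewrite -coefD e /q' coefZ mulVKf.
Qed.

End rational_laurent.

(** * Removable singularities and matrix-valued series *)

Section bridge.
Context {R : realType}.
Local Notation C := R[i].

Lemma cvg_mxP m n (u : nat -> 'M[C]_(m, n)) (L : 'M[C]_(m, n)) :
  u @ \oo --> L <-> forall i j, cvgC (fun k => u k i j) (L i j).
Proof.
split=> [h i j|h A /= nA].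
  apply/cvgrPdist_lt => e e0; have [N _ hN] := h _ (nbhs_mx_normc L e0).
  exists N => // k Nk /=; rewrite sub0r normrN ger0_norm ?normc_ge0 // normcB.
  exact: (hN k Nk i j).
have [e e0 he] := nbhs_mx_normcP nA.
have h2 (ij : 'I_m * 'I_n) : \forall k \near \oo, normc (L ij.1 ij.2 - u k ij.1 ij.2) < e.
  move/cvgrPdist_lt : (h ij.1 ij.2) => /(_ e e0); apply: filterS => k /=.
  by rewrite sub0r normrN ger0_norm ?normc_ge0 // normcB.
have [N _ hN] := filter_forall _ h2.
by exists N => // k Nk; apply: he => i j; exact: (hN k Nk (i, j)).
Qed.

Lemma mx_zsumP m n (F : int -> 'M[C]_(m, n)) (L : 'M[C]_(m, n)) :
  (forall i j, has_zsum (fun k => F k i j) (L i j)) ->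
  zseries_cvg F /\ zseries_sum F = L.
Proof.
move=> h.
have h' (ij : 'I_m * 'I_n) : exists l : C * C, [/\ L ij.1 ij.2 = l.1 + l.2,
        cvgC (fun k => \sum_(i < k) F i%:Z ij.1 ij.2) l.1 &
        cvgC (fun k => \sum_(i < k) F (- i.+1%:Z) ij.1 ij.2) l.2].
  by have [l1 [l2 [e h1 h2]]] := h ij.1 ij.2; exists (l1, l2).
have [f hf] := choice h'.
pose L1 : 'M[C]_(m, n) := \matrix_(i, j) (f (i, j)).1.
pose L2 : 'M[C]_(m, n) := \matrix_(i, j) (f (i, j)).2.
have c1 : series (fun k : nat => F k%:Z) @ \oo --> L1.
  apply/cvg_mxP => i j; rewrite mxE; have [_ + _] := hf (i, j).
  by congr (cvgC _ _); apply/funext => k; rewrite /series /= summxE big_mkord.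
have c2 : series (fun k : nat => F (- k.+1%:Z)) @ \oo --> L2.
  apply/cvg_mxP => i j; rewrite mxE; have [_ _] := hf (i, j).
  by congr (cvgC _ _); apply/funext => k; rewrite /series /= summxE big_mkord.
split; first by split; [exact: cvgP c1 | exact: cvgP c2].
rewrite /zseries_sum (cvg_lim (@norm_hausdorff _ _) c1) (cvg_lim (@norm_hausdorff _ _) c2).
by apply/matrixP => i j; rewrite !mxE; have [] := hf (i, j).
Qed.

Lemma zseries_cvg_entry m n (F : int -> 'M[C]_(m, n)) i j : zseries_cvg F ->
  has_zsum (fun k => F k i j) (zseries_sum F i j).
Proof.
move=> [/cvg_ex[L1 c1] /cvg_ex[L2 c2]].
rewrite /zseries_sum (cvg_lim (@norm_hausdorff _ _) c1) (cvg_lim (@norm_hausdorff _ _) c2).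
exists (L1 i j), (L2 i j); split; first by rewrite mxE.
  move/cvg_mxP : c1 => /(_ i j).
  by congr (cvgC _ _); apply/funext => k; rewrite /series /= summxE big_mkord.
move/cvg_mxP : c2 => /(_ i j).
by congr (cvgC _ _); apply/funext => k; rewrite /series /= summxE big_mkord.
Qed.

Lemma cvgC_terms_bounded (u : nat -> C) l : cvgC (fun n => \sum_(i < n) u i) l ->
  exists B, forall n, normc (u n) <= B.
Proof.
move/cvgrPdist_lt => /(_ 1 ltr01) [N _ hN].
exists (2 + \sum_(i < N) normc (u i)) => n.
have [nN|Nn] := ltnP n N.
  rewrite (bigD1 (Ordinal nN)) //= addrCA lerDl addr_ge0 //.
  by apply: sumr_ge0 => i _; exact: normc_ge0.
rewrite -[leLHS]addr0; apply: lerD; last by apply: sumr_ge0 => i _; exact: normc_ge0.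
have h1 := hN n Nn; have h2 := hN n.+1 (leqW Nn).
rewrite /= sub0r normrN ger0_norm ?normc_ge0 // in h1.
rewrite /= sub0r normrN ger0_norm ?normc_ge0 // in h2.
have e : u n = (\sum_(i < n.+1) u i - l) - (\sum_(i < n) u i - l).
  by rewrite big_ord_recr /=; ring.
rewrite e; apply: le_trans (le_normcD _ _) _; rewrite normcN; lra.
Qed.

Lemma poly_lipschitz (p : {poly C}) (z0 : C) : exists2 B : R, 0 <= B &
  forall z, normc (z - z0) <= 1 -> normc (p.[z] - p.[z0]) <= B * normc (z - z0).
Proof.
elim/poly_ind: p => [|p c [B B0 IH]].
  by exists 0 => // z _; rewrite !horner0 subrr normc0 mul0r.
exists (B * (normc z0 + 1) + normc p.[z0]).
  by rewrite addr_ge0 ?mulr_ge0 ?addr_ge0 ?normc_ge0.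
move=> z hz; rewrite !hornerD !hornerMX !hornerC.
have -> : p.[z] * z + c - (p.[z0] * z0 + c) =
    (p.[z] - p.[z0]) * z + p.[z0] * (z - z0) by ring.
apply: le_trans (le_normcD _ _) _; rewrite !normcM mulrDl; apply: lerD => //.
have nz : normc z <= normc z0 + 1.
  rewrite (_ : normc z = normc (z0 + (z - z0))); last by congr normc; ring.
  by apply: le_trans (le_normcD _ _) _; rewrite lerD2l.
apply: le_trans (_ : (B * normc (z - z0)) * (normc z0 + 1) <= _); last by rewrite mulrAC.
by apply: ler_pM => //; rewrite ?normc_ge0 // IH.
Qed.

Lemma removable_bounded (f : C -> C) (z0 : C) : removable f z0 ->
  exists e B : R, 0 < e /\
    forall z, 0 < normc (z - z0) -> normc (z - z0) < e -> normc (f z) <= B.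
Proof.
move=> [g dg fg]; have dgz0 := nbhs_singleton dg.
move: dgz0; rewrite /derivable => /cvg_ex [l hl].
have n1 : nbhs l [set w : C | normc (l - w) < 1].
  apply/(@nbhs_ballP C); exists 1; first by rewrite /= ltr01.
  by move=> w; rewrite /ball /= normcE -[1]/((1 : R)%:C)%C ltcR.
have {}hl := hl _ n1.
have [e1 e10 h1] := nbhs_normc hl.
have [e2 e20 h2] := nbhs_normc fg.
exists (Num.min (Num.min e1 e2) 1), (normc (g z0) + (normc l + 1)); split.
  by rewrite !lt_min e10 e20 ltr01.
move=> z z1; rewrite !lt_min => /andP[/andP[z2 z3] z4].
have zz0 : z != z0 by rewrite -subr_eq0 -normc_eq0 gt_eqF.
rewrite h2 //; last by rewrite normcB.
have := h1 (z - z0); rewrite sub0r normcN => /(_ z2) /=; rewrite subr_eq0 => /(_ zz0).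
rewrite /= -[_ *: 1]/((z - z0) * 1) mulr1 subrK -[_ *: _]/((z - z0)^-1 * _) => h3.
have -> : g z = g z0 + (z - z0) * ((z - z0)^-1 * (g z - g z0)).
  by rewrite mulVKf ?subr_eq0 // addrC subrK.
apply: le_trans (le_normcD _ _) _; rewrite lerD2l normcM.
set w := _ * (g z - g z0) in h3 *.
have hw : normc w <= normc l + 1.
  rewrite (_ : w = l - (l - w)); last by ring.
  by apply: le_trans (le_normcD _ _) _; rewrite normcN lerD2l ltW.
by apply: le_trans (_ : 1 * (normc l + 1) <= _); [apply: ler_pM; rewrite ?normc_ge0 // ltW | rewrite mul1r].
Qed.

(** Near z0 the function f is bounded, so letting z tend to z0 in p f = q gives
q (z0) = 0. *)
Lemma removable_coprime (f : C -> C) (z0 : C) (p q r : {poly C}) : r != 0 ->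
  (forall z, r.[z] != 0 -> p.[z] * f z = q.[z]) ->
  removable f z0 -> root p z0 -> root q z0.
Proof.
move=> r0 hf /removable_bounded [e [B [e0 hB]]] /rootP pz0.
have [A A0 hA] := poly_lipschitz p z0; have [D D0 hD] := poly_lipschitz q z0.
apply/rootP/eq0_normc/eqP; rewrite eq_le normc_ge0 andbT leNgt; apply/negP => qz0.
pose L := A * `|B| + D + 1.
have L0 : 0 < L by rewrite /L ltr_wpDl // addr_ge0 // mulr_ge0.
pose eta := Num.min (Num.min e 1) (normc q.[z0] / L).
have eta0 : 0 < eta by rewrite !lt_min e0 ltr01 divr_gt0.
have etan : eta != 0 by rewrite gt_eqF.
have [t [t0 teta rt]] : exists t : R, [/\ 0 < t, t < eta & r.[z0 + t%:C%C] != 0].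
  pose ts := [seq eta / (i.+2)%:R | i <- iota 0 (size r)].
  have uts : uniq [seq z0 + (t%:C)%C | t <- ts].
    rewrite map_inj_uniq; last by move=> a b /addrI /complexI.
    rewrite map_inj_uniq ?iota_uniq // => a b /(mulfI etan) /invr_inj.
    by move/eqP; rewrite eqr_nat => /eqP [].
  have : ~~ all (root r) [seq z0 + (t%:C)%C | t <- ts].
    apply/negP => h; have := max_poly_roots r0 h uts.
    by rewrite !size_map size_iota ltnn.
  move=> /allPn [w /mapP[t /mapP[i _ ->] ->] nr]; exists (eta / i.+2%:R); split.
  - by rewrite divr_gt0.
  - by rewrite ltr_pdivrMr // ltr_pMr // ltr1n.
  - by [].
set z := z0 + (t%:C)%C in rt.
have nz : normc (z - z0) = t.
  have -> : z - z0 = (t%:C)%C by rewrite /z addrC addKr.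
  by rewrite /= expr0n /= addr0 sqrtr_sqr ger0_norm // ltW.
move: teta; rewrite !lt_min => /andP[/andP[te t1] tq].
have h1 := hf z rt; have h2 := hB z; rewrite nz in h2; have {}h2 := h2 t0 te.
have h3 := hA z; rewrite nz pz0 subr0 in h3; have {}h3 := h3 (ltW t1).
have h4 := hD z; rewrite nz in h4; have {}h4 := h4 (ltW t1).
have h5 : normc q.[z] <= A * t * `|B|.
  rewrite -h1 normcM; apply: ler_pM; rewrite ?normc_ge0 //.
  exact: le_trans h2 (ler_norm _).
have h6 : normc q.[z0] <= normc q.[z] + normc (q.[z] - q.[z0]).
  rewrite (_ : normc q.[z0] = normc (q.[z] - (q.[z] - q.[z0]))); last by congr normc; ring.
  by apply: le_trans (le_normcD _ _) _; rewrite normcN.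
have h7 : t * L < normc q.[z0] by rewrite -ltr_pdivlMr.
have : normc q.[z0] <= t * L by rewrite /L; nra.
by rewrite leNgt h7.
Qed.

Lemma derivable_hornerC (r : {poly C}) (z : C) : derivable (horner r : C -> C) z 1.
Proof.
elim/poly_ind: r => [|r c IHr].
  rewrite (_ : horner 0 = cst 0 :> (C -> C)); first exact: derivable_cst.
  by apply/funext => y; rewrite horner0.
rewrite (_ : horner _ = (horner r : C -> C) * id + cst c :> (C -> C)).
  apply: derivableD; last exact: derivable_cst.
  apply: derivableM; first exact: IHr.
  exact: derivable_id.
by apply/funext => y; rewrite hornerD hornerMX hornerC.
Qed.

Lemma removable_ratio (f : C -> C) (z0 : C) (p q : {poly C}) : p.[z0] != 0 ->
  (exists2 e : R, 0 < e &
     forall z, 0 < normc (z - z0) < e -> f z = q.[z] / p.[z]) -> removable f z0.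
Proof.
move=> pz0 [e e0 hf]; have [B B0 hB] := poly_lipschitz p z0.
exists (fun z => q.[z] / p.[z]).
  pose eta := Num.min 1 (normc p.[z0] / (B + 1)).
  have np : 0 < normc p.[z0] by rewrite lt_neqAle normc_ge0 eq_sym normc_eq0 pz0.
  have eta0 : 0 < eta by rewrite lt_min ltr01 divr_gt0 // ltr_wpDl.
  apply/(@nbhs_ballP C); exists (eta%:C)%C; first by rewrite /= ltcR.
  move=> z; rewrite /ball /= normcE ltcR lt_min normcB => /andP[z1 z2].
  have pz : p.[z] != 0.
    apply/negP => /eqP pz; have := hB z (ltW z1); rewrite pz sub0r normcN.
    move: z2; rewrite ltr_pdivlMr; last by rewrite ltr_wpDl.
    have := normc_ge0 (z - z0); nra.
  apply: derivableM; first exact: derivable_hornerC.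
  by apply: derivableV => //; exact: derivable_hornerC.
apply/(@nbhs_ballP C); exists (e%:C)%C; first by rewrite /= ltcR.
move=> z; rewrite /ball /= normcE ltcR normcB => z1 zz0; apply: hf; rewrite z1 andbT.
by rewrite lt_neqAle normc_ge0 andbT eq_sym normc_eq0 subr_eq0.
Qed.

End bridge.

(** * The transfer function and its Laurent coefficients *)

Section transfer_function.
Context {R : realType}.
Local Notation C := R[i].
Variables (m d p q : nat) (Psi : 'I_p -> 'M[C]_m) (Theta : 'I_q.+1 -> 'M[C]_(m, d)).
Variable V : 'M[C]_d.

Definition arX : 'M[{poly C}]_m :=
  1%:M - \sum_(k < p) 'X^(k.+1) *: map_mx polyC (Psi k).

Definition maX : 'M[{poly C}]_(m, d) := \sum_(k < q.+1) 'X^k *: map_mx polyC (Theta k).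

Definition detX : {poly C} := \det arX.

(** Numerators of the entries of P^-1 Q V over the common denominator det P. *)
Definition numX : 'M[{poly C}]_(m, d) := \adj arX *m (maX *m map_mx polyC V).

Definition singularities : set C := [set z | \det (ar_poly Psi z) = 0].

Definition transferV (z : C) : 'M[C]_(m, d) :=
  invmx (ar_poly Psi z) *m ma_poly Theta z *m V.

Lemma arX_eval z : map_mx (horner^~ z) arX = ar_poly Psi z.
Proof.
apply/matrixP => i j; rewrite /arX /ar_poly !mxE !summxE hornerD hornerN horner_sum.
congr (_ - _); first by case: (i == j); rewrite ?hornerC // mulr0n horner0.
by apply: eq_bigr => k _; rewrite !mxE hornerM hornerXn hornerC.
Qed.

Lemma maX_eval z : map_mx (horner^~ z) maX = ma_poly Theta z.
Proof.
apply/matrixP => i j; rewrite /maX /ma_poly !mxE !summxE horner_sum.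
by apply: eq_bigr => k _; rewrite !mxE hornerM hornerXn hornerC.
Qed.

Lemma detX_eval z : detX.[z] = \det (ar_poly Psi z).
Proof. by rewrite -arX_eval -[RHS]/(\det (map_mx (horner_eval z) arX)) det_map_mx. Qed.

Lemma detX0 : detX.[0] = 1.
Proof.
rewrite detX_eval (_ : ar_poly Psi 0 = 1%:M) ?det1 //.
rewrite /ar_poly big1 ?subr0 // => k _.
by rewrite expr0n scale0r.
Qed.

Lemma detX_neq0 : detX != 0.
Proof. by apply: contra_eq_neq detX0 => ->; rewrite horner0 eq_sym oner_eq0. Qed.

Lemma mact_arX l (y : int -> 'M[C]_(m, l)) t :
  mact arX y t = y t - \sum_(k < p) Psi k *m y (t - k.+1%:Z).
Proof.
rewrite /arX mactDl; congr (_ + _).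
  have -> : 1%:M = map_mx polyC (1%:M : 'M[C]_m).
    by apply/matrixP => i j; rewrite !mxE; case: (i == j).
  by rewrite mact_const mul1mx.
rewrite -sumrN mact_suml -sumrN; apply: eq_bigr => k _.
rewrite -scalerN -map_mxN mactXn mact_const mulNmx.
by congr (- (_ *m y _)); lia.
Qed.

Lemma mact_maX l (y : int -> 'M[C]_(d, l)) t :
  mact maX y t = \sum_(k < q.+1) Theta k *m y (t - k%:Z).
Proof.
by rewrite /maX mact_suml; apply: eq_bigr => k _; rewrite mactXn mact_const.
Qed.

Lemma arX_transfer z : detX.[z] != 0 ->
  ar_poly Psi z *m transferV z = ma_poly Theta z *m V.
Proof.
rewrite detX_eval => h; rewrite /transferV -mulmxA mulKVmx //.
Qed.

Lemma map_horner_mulmx a b c (A : 'M[{poly C}]_(a, b)) (B : 'M[{poly C}]_(b, c)) z :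
  map_mx (horner^~ z) (A *m B) = map_mx (horner^~ z) A *m map_mx (horner^~ z) B.
Proof. exact: (map_mxM (horner_eval z)). Qed.

Lemma map_horner_polyC a b (A : 'M[C]_(a, b)) z : map_mx (horner^~ z) (map_mx polyC A) = A.
Proof. by apply/matrixP => i j; rewrite !mxE hornerC. Qed.

Lemma transfer_entry z i j : detX.[z] != 0 ->
  detX.[z] * transferV z i j = (numX i j).[z].
Proof.
move=> h; have := arX_transfer h => e.
have -> : (numX i j).[z] = map_mx (horner^~ z) numX i j by rewrite [RHS]mxE.
rewrite /numX !map_horner_mulmx maX_eval map_horner_polyC -e.
rewrite mulmxA -arX_eval -map_horner_mulmx mul_adj_mx.
have -> : map_mx (horner^~ z) (detX%:M : 'M[{poly C}]_m) = detX.[z]%:M.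
  by apply/matrixP => a b; rewrite !mxE; case: (a == b); rewrite ?mulr1n // mulr0n horner0.
by rewrite mul_scalar_mx [RHS]mxE.
Qed.

(** Divisibility with multiplicity at each point of the circle: the form in which the
removability of the singularities is derived from a stationary solution. *)
Definition circle_divides (i : 'I_m) (j : 'I_d) := forall (c : C) (k : nat),
  normc c = 1 -> ('X - c%:P) ^+ k %| detX -> ('X - c%:P) ^+ k %| numX i j.

Lemma circle_divides_removable : (forall i j, circle_divides i j) ->
  removable_on_circle singularities transferV.
Proof.
move=> h z0 nz0 sz0 i j.
have nz : normc z0 = 1 by apply: complexI; rewrite -normcE nz0.
have [k [r rz0 dE]] := multiplicity_XsubC detX z0; rewrite detX_neq0 /= in rz0.
have dk : ('X - z0%:P) ^+ k %| detX by rewrite dE dvdp_mull.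
have /dvdpP [r' nE] := h i j z0 k nz dk.
apply: (@removable_ratio _ _ _ r r'); first exact: rz0.
have [B B0 hB] := poly_lipschitz r z0.
have rn : 0 < normc r.[z0] by rewrite lt_neqAle normc_ge0 eq_sym normc_eq0 andbT.
exists (Num.min 1 (normc r.[z0] / (B + 1))).
  by rewrite lt_min ltr01 divr_gt0 // ltr_wpDl.
move=> z; rewrite lt_min => /andP[z1 /andP[z2 z3]].
have rz : r.[z] != 0.
  apply/negP => /eqP rz; have := hB z (ltW z2); rewrite rz sub0r normcN.
  move: z3; rewrite ltr_pdivlMr; last by rewrite ltr_wpDl.
  have := normc_ge0 (z - z0); nra.
have zz : (z - z0) ^+ k != 0 by rewrite expf_neq0 // -normc_eq0 gt_eqF.
have dz : detX.[z] != 0 by rewrite dE hornerM horner_exp hornerXsubC mulf_neq0.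
have := transfer_entry i j dz.
rewrite nE dE !hornerM !horner_exp !hornerXsubC => e.
have e2 : r.[z] * transferV z i j = r'.[z] by apply: (mulIf zz); rewrite -e mulrAC.
by rewrite -e2 mulrC mulKf.
Qed.

(** In lowest terms the entry is a quotient of coprime polynomials, which has poles at
all zeros of its denominator. *)
Lemma removable_no_circle_pole : removable_on_circle singularities transferV ->
  forall i j, let g := gcdp detX (numX i j) in
  forall z : C, normc z = 1 -> ~~ root (detX %/ g) z.
Proof.
move=> h i j g z nz; apply/negP => rz.
have g0 : g != 0 by rewrite gcdp_eq0 negb_and detX_neq0.
have dE : detX = detX %/ g * g by rewrite divpK // dvdp_gcdl.
have nE : numX i j = numX i j %/ g * g by rewrite divpK // dvdp_gcdr.
have cop : coprimep (detX %/ g) (numX i j %/ g).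
  by rewrite coprimep_div_gcd // detX_neq0.
have sz : singularities z.
  rewrite /singularities /= -detX_eval dE hornerM.
  by move/rootP : rz => ->; rewrite mul0r.
have rem := h z _ sz i j; rewrite normcE nz in rem; have {}rem := rem erefl.
have := @removable_coprime R (fun z => transferV z i j) z (detX %/ g) (numX i j %/ g) detX
  detX_neq0 _ rem rz.
have hz w : detX.[w] != 0 -> (detX %/ g).[w] * transferV w i j = (numX i j %/ g).[w].
  move=> hw.
  have e : (detX %/ g).[w] * g.[w] * transferV w i j = (numX i j %/ g).[w] * g.[w].
    by rewrite -!hornerM -dE -nE; exact: transfer_entry.
  have gw : g.[w] != 0 by move: hw; rewrite dE hornerM mulf_eq0 negb_or => /andP[].
  by apply: (mulIf gw); rewrite -e mulrAC.
move=> /(_ hz); apply/negP.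
by have /Pdiv.ClosedField.coprimepP := cop; apply.
Qed.

Lemma laurent_expansion_exists : removable_on_circle singularities transferV ->
  exists c, laurent_expansion singularities transferV c.
Proof.
move=> h.
have he (ij : 'I_m * 'I_d) : exists a : int -> C, geo a /\
    forall k, pact (detX %/ gcdp detX (numX ij.1 ij.2)) a k =
      polyseqz (numX ij.1 ij.2 %/ gcdp detX (numX ij.1 ij.2)) k.
  apply: rational_laurent; last exact: removable_no_circle_pole.
  apply/negP => /eqP e; have /negP := detX_neq0; apply.
  by rewrite -(divpK (dvdp_gcdl detX (numX ij.1 ij.2))) e mul0r.
have [a ha] := choice he.
have ht (ij : 'I_m * 'I_d) : exists e : R, (0 < e < 1) /\
    forall z : C, `|normc z - 1| < e -> geo (fun j => z ^ j * a ij j).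
  by have [e e0 hz] := geo_twist (ha ij).1; exists e.
have [f hf] := choice ht.
pose e := \big[Num.min/1]_(ij : 'I_m * 'I_d) f ij.
have e0 : 0 < e by apply: lt_bigmin => // ij _; have [/andP[]] := hf ij.
have ef ij : e <= f ij by exact: bigmin_le_cond.
have e1 : e <= 1 by exact: bigmin_le_id.
exists (fun k => \matrix_(i, j) a (i, j) k).
exists (e%:C)%C; first by rewrite ltcR.
move=> z hz; have {}hz : `|normc z - 1| < e.
  move: hz; rewrite [`|z|]normcE -[1]/((1 : R)%:C)%C -rmorphB /= normcE ltcR /=.
  by rewrite expr0n /= addr0 sqrtr_sqr.
have z0 : z != 0.
  apply/negP => /eqP z0; move: hz; rewrite z0 normc0 sub0r normrN normr1.
  by rewrite ltNge e1.
have sums i j : exists l, has_zsum (fun k => (z ^ k *: \matrix_(i, j) a (i, j) k) i j) l.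
  have [_ hg] := hf (i, j); have [l hl] := geo_zsum (hg z (lt_le_trans hz (ef _))).
  by exists l; apply: eq_has_zsum hl => k; rewrite !mxE.
pose L : 'M[C]_(m, d) := \matrix_(i, j) xget 0 [set l | has_zsum
  (fun k => (z ^ k *: \matrix_(i, j) a (i, j) k) i j) l].
have hL i j : has_zsum (fun k => (z ^ k *: \matrix_(i, j) a (i, j) k) i j) (L i j).
  by rewrite [L i j]mxE; case: xgetP => [l -> //|hn]; have [l /hn] := sums i j.
have [cvgz sumz] := mx_zsumP hL; split => // sz; rewrite sumz.
have dz : detX.[z] != 0 by apply/eqP => dz; apply: sz; rewrite /singularities /= -detX_eval.
apply/matrixP => i j; set g := gcdp detX (numX i j).
have dE : detX = detX %/ g * g by rewrite divpK // dvdp_gcdl.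
have nE : numX i j = numX i j %/ g * g by rewrite divpK // dvdp_gcdr.
have [ga pa] := ha (i, j).
have h1 : has_zsum (fun k => z ^ k * a (i, j) k) (L i j).
  by apply: eq_has_zsum (hL i j) => k; rewrite !mxE.
have := has_zsum_pact (detX %/ g) z0 h1.
have := has_zsum_polyseqz (numX i j %/ g) z0.
have -> : (fun k => z ^ k * polyseqz (numX i j %/ g) k) =
    (fun k => z ^ k * pact (detX %/ g) (a (i, j)) k).
  by apply/funext => k; rewrite pa.
move=> /has_zsum_unique h2 /h2 h3.
have e2 : detX.[z] * transferV z i j = (numX i j).[z] by exact: transfer_entry.
by apply: (mulfI dz); rewrite e2 [in LHS]nE [in RHS]dE !hornerM h3 mulrAC.
Qed.

(** Convergence at one point outside the unit circle bounds the coefficients of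
positive index geometrically, and one point inside does so for the others. *)
Lemma laurent_expansion_geo S (M : C -> 'M[C]_(m, d)) c : laurent_expansion S M c ->
  forall i j, geo (fun k => c k i j).
Proof.
move=> [e e0 h] i j.
have eR : e = (complex.Re e)%:C%C by rewrite RRe_real // gtr0_real.
have {}e0 : 0 < complex.Re e by rewrite -ltcR -eR.
pose e1 := Num.min (complex.Re e) 1 / 2.
have e10 : 0 < e1 by rewrite divr_gt0 // lt_min e0 ltr01.
have [e1e e11] : e1 < complex.Re e /\ e1 < 1.
  have : Num.min (complex.Re e) 1 <= complex.Re e by rewrite ge_min lexx.
  have : Num.min (complex.Re e) 1 <= 1 by rewrite ge_min lexx orbT.
  by rewrite /e1; set M0 := Num.min _ _ => h1 h2; split; lra.
have nR (r : R) : 0 <= r -> normc (r%:C)%C = r.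
  by move=> r0; rewrite /= expr0n /= addr0 sqrtr_sqr ger0_norm.
have zs (r : R) : 0 < r -> `|r - 1| < complex.Re e ->
    exists l, has_zsum (fun k => ((r%:C)%C : C) ^ k * c k i j) l.
  move=> r0 hr; have hr' : `| `|((r%:C)%C : C)| - 1| < e.
    rewrite normcE nR ?ltW // -[1]/((1 : R)%:C)%C -rmorphB /= normcE eR ltcR.
    by rewrite /= expr0n /= addr0 sqrtr_sqr.
  have [hz _] := h _ hr'; have h1 := zseries_cvg_entry i j hz.
  eexists; apply: eq_has_zsum h1 => k.
  by rewrite mxE.
split.
  have [|l [l1 [l2 [_ hl1 _]]]] := zs (1 + e1) ltac:(lra).
    by rewrite addrAC subrr add0r ger0_norm // ltW.
  have [B hB] := @cvgC_terms_bounded R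
    (fun k => ((1 + e1)%:C%C : C) ^ k%:Z * c k%:Z i j) _ hl1; exists `|B|, (1 + e1)^-1; split => //.
    by apply/andP; split; [rewrite invr_gt0; lra | rewrite invf_lt1; lra].
  move=> n; rewrite exprVn ler_pdivlMr; last by rewrite exprn_gt0 //; lra.
  have := hB n; rewrite normcM -exprnP normcX nR; last by lra.
  by rewrite mulrC => /le_trans; apply; exact: ler_norm.
have [|l [l1 [l2 [_ _ hl2]]]] := zs (1 - e1) ltac:(lra).
  by rewrite addrAC subrr add0r normrN ger0_norm // ltW.
have [B hB] := @cvgC_terms_bounded R
  (fun k => ((1 - e1)%:C%C : C) ^ (- k.+1%:Z) * c (- k.+1%:Z) i j) _ hl2; apply: ngeo_unshift1.
exists `|B|, (1 - e1); split => //; first by apply/andP; split; lra.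
move=> n; have := hB n; rewrite normcM -exprnN normcV normcX nR; last by lra.
have p0 : 0 < (1 - e1) ^+ n by rewrite exprn_gt0 //; lra.
have p1 : 0 < (1 - e1) ^+ n.+1 by rewrite exprn_gt0 //; lra.
rewrite mulrC ler_pdivrMr // => /le_trans; apply.
apply: (@le_trans _ _ (`|B| * (1 - e1) ^+ n.+1)); first by rewrite ler_wpM2r ?ler_norm // ltW.
by rewrite ler_wpM2l // exprS ler_piMl ?(ltW p0) //; lra.
Qed.

(** Coefficient comparison in P M = Q V. On the circle this identity is only known away
from the singularities, so it is first multiplied by det P, which vanishes there. *)
Lemma laurent_coef_recurrence c : laurent_expansion singularities transferV c ->
  forall k, mact arX c k = mxpolyseqz (maX *m map_mx polyC V) k.
Proof.
move=> hc; have geoc := laurent_expansion_geo hc.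
pose b k := mact arX c k - mxpolyseqz (maX *m map_mx polyC V) k.
have bE i j k : b k i j = \sum_e pact (arX i e) (fun s => c s e j) k +
    -1 * polyseqz ((maX *m map_mx polyC V) i j) k.
  by rewrite /b 3!mxE mulN1r [X in _ - X]mxE.
have geob i j : geo (fun k => b k i j).
  rewrite (_ : (fun k => _) = (fun k => \sum_e pact (arX i e) (fun s => c s e j) k +
    -1 * polyseqz ((maX *m map_mx polyC V) i j) k)); last by apply/funext => k.
  apply: geoD; last by apply: geoZ; exact: geo_polyseqz.
  by apply: geo_sum => e; apply: geo_pact; exact: geoc.
suff b0 k : b k = 0 by move=> k; apply/eqP; rewrite -subr_eq0 -/(b k) b0.
apply/matrixP => i j; rewrite [RHS]mxE.
apply: (pact_inj (geob i j) detX_neq0).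
apply: laurent_unique; first exact: geo_pact.
move=> z nz; have z0 : z != 0 by rewrite -normc_eq0 nz oner_eq0.
have [e e0 he] := hc; have [hz1 hz2] := he z ltac:(by rewrite normcE nz subrr normr0).
have hcz a j' : has_zsum (fun k => z ^ k * c k a j')
    (zseries_sum (fun k => z ^ k *: c k) a j').
  by apply: eq_has_zsum (zseries_cvg_entry a j' hz1) => t; rewrite mxE.
have hb : has_zsum (fun k => z ^ k * b k i j)
   (\sum_e (arX i e).[z] * zseries_sum (fun k => z ^ k *: c k) e j +
    -1 * ((maX *m map_mx polyC V) i j).[z]).
  have := has_zsumD (has_zsum_sum (index_enum _) (fun e => has_zsum_pact (arX i e) z0 (hcz e j)))
    (has_zsumZ (-1) (has_zsum_polyseqz ((maX *m map_mx polyC V) i j) z0)).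
  apply: eq_has_zsum => t; rewrite bE mulrDr mulr_sumr; congr (_ + _).
  by rewrite mulrCA.
have := has_zsum_pact detX z0 hb.
have [d0|d0] := eqVneq detX.[z] 0; first by rewrite d0 mul0r.
have sz : ~ singularities z by rewrite /singularities /= -detX_eval; apply/eqP.
rewrite -(hz2 sz).
have -> : \sum_e (arX i e).[z] * transferV z e j = (ar_poly Psi z *m transferV z) i j.
  rewrite [RHS]mxE; apply: eq_bigr => e1 _; congr (_ * _).
  by rewrite -arX_eval [RHS]mxE.
rewrite arX_transfer //.
have -> : ((maX *m map_mx polyC V) i j).[z] = (ma_poly Theta z *m V) i j.
  by rewrite -maX_eval -[V in RHS](map_horner_polyC V z) -map_horner_mulmx [RHS]mxE.
by rewrite mulN1r subrr mulr0.
Qed.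

Lemma laurent_det_recurrence c : (forall k, mact arX c k =
    mxpolyseqz (maX *m map_mx polyC V) k) ->
  forall k, mact (detX%:M : 'M[{poly C}]_m) c k = mxpolyseqz numX k.
Proof.
move=> h k; rewrite -mul_adj_mx mactM -mact_mxpolyseqz; exact: eq_mact.
Qed.

Lemma size_arX i j : (size (arX i j) <= p.+1)%N.
Proof.
rewrite /arX mxE; apply: (leq_trans (size_polyD _ _)); rewrite geq_max; apply/andP; split.
  rewrite mxE; have h (b : bool) : (size (b%:R : {poly C}) <= p.+1)%N.
    by case: b; [rewrite mulr1n size_poly1 | rewrite mulr0n size_poly0].
  exact: h.
rewrite mxE size_polyN summxE; apply: (leq_trans (size_sum _ _ _)).
apply/bigmax_leqP => k _; rewrite mxE mxE mulrC mul_polyC.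
apply: (leq_trans (size_scale_leq _ _)); rewrite size_polyXn ltnS.
exact: ltn_ord.
Qed.

Lemma size_maX_mul i j : (size ((maX *m map_mx polyC V) i j) <= q.+1)%N.
Proof.
rewrite mxE; apply: (leq_trans (size_sum _ _ _)); apply/bigmax_leqP => l _.
rewrite [X in _ * X]mxE mulrC mul_polyC; apply: (leq_trans (size_scale_leq _ _)).
rewrite /maX summxE; apply: (leq_trans (size_sum _ _ _)); apply/bigmax_leqP => e _.
rewrite mxE mxE mulrC mul_polyC; apply: (leq_trans (size_scale_leq _ _)).
by rewrite size_polyXn; exact: ltn_ord.
Qed.

(** An entry of the adjugate involves m - 1 entries of P, of degree at most p: this is
where the position of the upper window of indices in the moment condition comes
from. *)
Lemma size_numX i j : (size (numX i j) <= (m.-1 * p + q).+1)%N.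
Proof.
rewrite /numX mxE; apply: (leq_trans (size_sum _ _ _)); apply/bigmax_leqP => k _.
apply: (leq_trans (size_polyMleq _ _)).
have h1 := @size_adj_le _ _ arX p i k size_arX.
have h2 := size_maX_mul k j.
apply: (@leq_trans ((m.-1 * p).+1 + q.+1).-1); last by rewrite addnS /= addSn.
rewrite -(subn1 (size _ + size _)) -(subn1 ((m.-1 * p).+1 + q.+1)).
by apply: leq_sub2r; exact: leq_add h1 h2.
Qed.

End transfer_function.

(** * Norms and logarithmic moments *)

Section matrix_norms.
Context {R : realType}.
Local Notation C := R[i].

Lemma mxnorm_ge0 m n (A : 'M[C]_(m, n)) : 0 <= mxnorm A.
Proof. by apply: sumr_ge0 => i _; apply: sumr_ge0 => j _; exact: normc_ge0. Qed.

Lemma mxnorm0 m n : mxnorm (0 : 'M[C]_(m, n)) = 0.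
Proof. by rewrite /mxnorm big1 // => i _; rewrite big1 // => j _; rewrite mxE normc0. Qed.

Lemma mxnormN m n (A : 'M[C]_(m, n)) : mxnorm (- A) = mxnorm A.
Proof. by apply: eq_bigr => i _; apply: eq_bigr => j _; rewrite mxE normcN. Qed.

Lemma mxnormD m n (A B : 'M[C]_(m, n)) : mxnorm (A + B) <= mxnorm A + mxnorm B.
Proof.
rewrite /mxnorm -big_split; apply: ler_sum => i _; rewrite -big_split.
by apply: ler_sum => j _; rewrite mxE; exact: le_normcD.
Qed.

Lemma mxnorm_sum m n (I : Type) (r : seq I) (Q : pred I) (f : I -> 'M[C]_(m, n)) :
  mxnorm (\sum_(i <- r | Q i) f i) <= \sum_(i <- r | Q i) mxnorm (f i).
Proof.
elim/big_rec2: _ => [|i y A _ h]; first by rewrite mxnorm0.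
by apply: le_trans (mxnormD _ _) _; rewrite lerD2l.
Qed.

Lemma mxnormZ m n (c : C) (A : 'M[C]_(m, n)) : mxnorm (c *: A) = normc c * mxnorm A.
Proof.
rewrite /mxnorm mulr_sumr; apply: eq_bigr => i _; rewrite mulr_sumr.
by apply: eq_bigr => j _; rewrite mxE normcM.
Qed.

Lemma normc_le_mxnorm m n (A : 'M[C]_(m, n)) i j : normc (A i j) <= mxnorm A.
Proof.
rewrite /mxnorm (bigD1 i) //= (bigD1 j) //= -addrA lerDl addr_ge0 //.
  by apply: sumr_ge0 => k _; exact: normc_ge0.
by apply: sumr_ge0 => k _; apply: sumr_ge0 => l _; exact: normc_ge0.
Qed.

Lemma mxnormM m n l (A : 'M[C]_(m, n)) (B : 'M[C]_(n, l)) :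
  mxnorm (A *m B) <= mxnorm A * mxnorm B.
Proof.
apply: (@le_trans _ _ (\sum_i \sum_j \sum_k normc (A i k) * normc (B k j))).
  apply: ler_sum => i _; apply: ler_sum => j _; rewrite mxE.
  elim/big_rec2: _ => [|k y a _ h]; first by rewrite normc0.
  by apply: le_trans (le_normcD _ _) _; rewrite normcM lerD2l.
rewrite /mxnorm mulr_suml; apply: ler_sum => i _.
rewrite exchange_big mulr_suml; apply: ler_sum => k _.
rewrite -mulr_sumr; apply: ler_wpM2l; first exact: normc_ge0.
rewrite (bigD1 k (F := fun k0 => \sum_j normc (B k0 j))) //= lerDl.
by apply: sumr_ge0 => e _; apply: sumr_ge0 => j _; exact: normc_ge0.
Qed.

Lemma mxnorm_eq0 m n (A : 'M[C]_(m, n)) : mxnorm A = 0 -> A = 0.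
Proof.
move=> h; apply/matrixP => i j; rewrite mxE; apply: eq0_normc; apply/eqP.
by rewrite eq_le normc_ge0 andbT -h normc_le_mxnorm.
Qed.

Section norm_equivalence.
Variables (r : nat) (N : 'cV[C]_r -> R).
Hypothesis NP : vector_norm N.

Lemma vnormD x y : N (x + y) <= N x + N y.
Proof. by case: NP. Qed.

Lemma vnormZ (a : C) x : N (a *: x) = normc a * N x.
Proof.
by case: NP => _ h _; apply: complexI; rewrite h normcE rmorphM.
Qed.

Lemma vnorm0 : N 0 = 0.
Proof. by rewrite -(scale0r 0) vnormZ normc0 mul0r. Qed.

Lemma vnormN x : N (- x) = N x.
Proof. by rewrite -scaleN1r vnormZ normcN normc1 mul1r. Qed.

Lemma vnorm_ge0 x : 0 <= N x.
Proof.
have := vnormD x (- x); rewrite subrr vnorm0 vnormN; lra.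
Qed.

Lemma vnorm_sum (I : Type) (s : seq I) (Q : pred I) (f : I -> 'cV[C]_r) :
  N (\sum_(i <- s | Q i) f i) <= \sum_(i <- s | Q i) N (f i).
Proof.
elim/big_rec2: _ => [|i y A _ h]; first by rewrite vnorm0.
by apply: le_trans (vnormD _ _) _; rewrite lerD2l.
Qed.

Lemma vnorm_le_mxnorm : exists2 B : R, 0 < B & forall x, N x <= B * mxnorm x.
Proof.
exists (1 + \sum_(i < r) N (delta_mx i 0)).
  by rewrite ltr_pwDl //; apply: sumr_ge0 => i _; exact: vnorm_ge0.
move=> x; have -> : N x = N (\sum_(i < r) x i 0 *: delta_mx i 0).
  by congr N; rewrite [LHS]matrix_sum_delta; apply: eq_bigr => i _; rewrite big_ord1.
apply: le_trans (vnorm_sum _ _ _) _; rewrite mulrDl mul1r.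
apply: (@le_trans _ _ (\sum_(i < r) mxnorm x * N (delta_mx i 0))).
  by apply: ler_sum => i _; rewrite vnormZ ler_wpM2r ?vnorm_ge0 ?normc_le_mxnorm.
by rewrite -mulr_sumr mulrC lerDr mxnorm_ge0.
Qed.

(** All norms on C^r are equivalent: the norm attains a positive minimum on the
compact unit sphere of the underlying real space. *)
Lemma mxnorm_le_vnorm : exists2 B : R, 0 < B & forall x, mxnorm x <= B * N x.
Proof.
have [B B0 hB] := vnorm_le_mxnorm.
pose phi (v : 'rV[R]_(r + r)) : 'cV[C]_r :=
  \col_i (v ord0 (lshift r i) +i* v ord0 (rshift r i))%C.
have phiD v w : phi (v + w) = phi v + phi w by apply/matrixP => i j; rewrite !mxE.
have phiN v : phi (- v) = - phi v by apply/matrixP => i j; rewrite !mxE.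
have vle (v : 'rV[R]_(r + r)) k : `|v ord0 k| <= `|v|.
  rewrite [leRHS]/Num.norm /= mx_normrE.
  by apply/bigmax_geP; right => /=; exists (ord0, k).
have phi_le v : mxnorm (phi v) <= (r%:R * 2) * `|v|.
  apply: (@le_trans _ _ (\sum_(i < r) 2 * `|v|)); last first.
    by rewrite sumr_const card_ord -[leLHS]mulr_natl mulrA.
  apply: ler_sum => i _; rewrite big_ord1 mxE.
  apply: le_trans (normc_le_ReIm _) _; rewrite /= mulr_natl mulr2n.
  by apply: lerD; exact: vle.
pose f v := N (phi v).
have cf : continuous f.
  move=> v A /nbhs_ballP [e /= e0 hA].
  pose L := B * (r%:R * 2) + 1.
  have L0 : 0 < L by rewrite ltr_wpDl // !mulr_ge0 // ltW.
  apply/(@nbhs_ballP R 'rV[R]_(r + r)); exists (e / L) => /=; first exact: divr_gt0.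
  move=> w; rewrite -ball_normE /= => vw; apply: hA; rewrite -ball_normE /=.
  have hvw a b : f a - f b <= L * `|a - b|.
    rewrite lerBlDr; have -> : f a = N (phi (a - b) + phi b) by rewrite -phiD subrK.
    apply: le_trans (vnormD _ _) _; rewrite lerD2r; apply: le_trans (hB _) _.
    rewrite /L mulrDl mul1r -mulrA; apply: ler_wpDr => //.
    by rewrite ler_wpM2l ?(ltW B0).
  rewrite ltr_pdivlMr // mulrC in vw; apply: le_lt_trans vw.
  rewrite ler_norml; apply/andP; split; last exact: hvw.
  by rewrite lerNl opprB distrC; exact: hvw.
have phiZ (a : R) v : phi (a *: v) = (a%:C)%C *: phi v.
  by apply/matrixP => i j; rewrite !mxE; apply/eqP; rewrite eq_complex /= !mul0r subr0 addr0 !eqxx.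
pose psi (x : 'cV[C]_r) : 'rV[R]_(r + r) :=
  row_mx (\row_i complex.Re (x i 0)) (\row_i complex.Im (x i 0)).
have psiK x : phi (psi x) = x.
  apply/matrixP => i j; rewrite ord1 mxE row_mxEl row_mxEr !mxE.
  by case: (x i 0).
have phi0 v : phi v = 0 -> v = 0.
  move=> pv; apply/rowP => k; rewrite !mxE -(splitK k); case: (fintype.split k) => i /=.
    by have /matrixP /(_ i 0) := pv; rewrite !mxE => /(congr1 (@complex.Re R)).
  by have /matrixP /(_ i 0) := pv; rewrite !mxE => /(congr1 (@complex.Im R)).
have [[x0 x0n]|none] := pselect (exists x : 'cV[C]_r, x != 0); last first.
  exists 1 => // x; have [->|xn] := eqVneq x 0; first by rewrite mxnorm0 vnorm0 mulr0.
  by exfalso; apply: none; exists x.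
pose S := [set v : 'rV[R]_(r + r) | `|v| = 1].
have sphere (v : 'rV[R]_(r + r)) : v != 0 -> S (`|v|^-1 *: v).
  by move=> v0; rewrite /S /= normrZ normrV ?unitfE ?normr_eq0 // normr_id mulVf // normr_eq0.
have psi0 x : x != 0 -> psi x != 0.
  by apply: contra_neq => px; rewrite -(psiK x) px -(scale0r 0) phiZ scale0r.
have cS : compact S.
  apply: bounded_closed_compact.
    by exists 1; split => // M M1 v /= ->; exact: ltW.
  apply: (@closed_comp _ _ (fun v : 'rV[R]_(r + r) => `|v|) [set 1]).
    by move=> v _; exact: norm_continuous.
  exact: closed_eq.
have [c cS' cmin] := compact_EVT_min (ex_intro _ _ (sphere _ (psi0 _ x0n))) cS
  (continuous_subspaceT cf).
have fc0 : 0 < f c.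
  rewrite lt_neqAle vnorm_ge0 andbT eq_sym; apply/eqP => fc.
  have [h0 _ _] := NP; have := phi0 _ (h0 _ fc) => c0.
  by move: cS'; rewrite inE /S /= c0 normr0 => /eqP; rewrite eq_sym oner_eq0.
exists (r%:R * 2 / f c + 1); first by rewrite ltr_wpDl // divr_ge0 ?mulr_ge0 // ltW.
move=> x; have [->|xn] := eqVneq x 0; first by rewrite mxnorm0 vnorm0 mulr0.
have := cmin _ (mem_set (sphere _ (psi0 _ xn))).
have np : 0 < `|psi x| by rewrite normr_gt0 psi0.
rewrite {2}/f phiZ vnormZ psiK /= expr0n /= addr0 sqrtr_sqr normrV ?unitfE ?gt_eqF //.
rewrite normr_id mulrC ler_pdivlMr // => h.
rewrite mulrDl mul1r; apply: ler_wpDr; first exact: vnorm_ge0.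
rewrite -{1}(psiK x); apply: le_trans (phi_le _) _.
rewrite -!mulrA; apply: ler_wpM2l => //; apply: ler_wpM2l => //.
by rewrite mulrC ler_pdivlMr // mulrC.
Qed.

Lemma measurable_vnorm dT (T : measurableType dT) (f : T -> 'cV[C]_r) :
  measurable_fun setT f -> measurable_fun setT (fun x => N (f x)).
Proof.
move=> mf; apply: (measurability _ (measurable_realfun.RGenOInfty.measurableE R)).
move=> _ [_ [a ->] <-]; rewrite setTI.
pose O := [set z | a < N z]; have [B B0 hB] := vnorm_le_mxnorm.
have oO : open O.
  rewrite openE => z hz; have e0 : 0 < (N z - a) / (B * r.+1%:R).
    by rewrite divr_gt0 ?subr_gt0 // mulr_gt0.
  apply: filterS (nbhs_mx_normc z e0) => y hy; rewrite /O /=.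
  have h1 : N z <= N y + N (z - y) by rewrite addrC -{1}(subrK y z); exact: vnormD.
  have h2 : B * mxnorm (z - y) < N z - a.
    apply: (@le_lt_trans _ _ (B * (r%:R * ((N z - a) / (B * r.+1%:R))))).
      rewrite ler_pM2l // mulr_natl -[X in _ *+ X]card_ord -sumr_const /mxnorm.
      by apply: ler_sum => i _; rewrite big_ord1 !mxE ltW.
    have -> : B * (r%:R * ((N z - a) / (B * r.+1%:R))) = (N z - a) * (r%:R / r.+1%:R).
      have r0 : r.+1%:R != 0 :> R by rewrite pnatr_eq0.
      move: (r.+1%:R) r0 => y1 y0; have B1 : B != 0 by rewrite gt_eqF.
      by field; rewrite y0 B1.
    by rewrite -[ltRHS]mulr1 ltr_pM2l ?subr_gt0 // ltr_pdivrMr // mul1r ltr_nat.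
  have := hB (z - y); lra.
have mO : measurable O by apply: sub_sigma_algebra.
have := mf measurableT O mO; rewrite setTI.
by congr measurable; apply/seteqP; split => x /=; rewrite in_itv /= andbT.
Qed.

End norm_equivalence.
End matrix_norms.

(** ** Logarithmic moments *)

Section logarithmic_moments.
Context {R : realType} {disp : measure_display} {T : measurableType disp}.
Variable P : probability T R.
Local Notation pr := (pr P).
Implicit Types (X : T -> R) (k c : R).

Lemma log_plus_ge0 (x : R) : 0 <= log_plus x.
Proof. by rewrite /log_plus ln_ge0 // le_max lexx. Qed.

Lemma log_plus_mono (x y : R) : x <= y -> log_plus x <= log_plus y.
Proof.
move=> xy; rewrite /log_plus ler_ln ?posrE ?lt_max ?ltr01 //.
by rewrite ge_max !le_max lexx xy orbT.
Qed.

Lemma measurable_log_plus X : measurable_fun setT X ->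
  measurable_fun setT (fun x => log_plus (X x)).
Proof.
move=> mX.
apply: (@measurableT_comp _ _ _ _ _ _ (@ln R) _ (fun x => Num.max 1 (X x))).
  exact: measurable_ln.
by apply: measurable_maxr.
Qed.

(** A finite logarithmic moment means that the tails of X are summable along one,
equivalently every, geometric progression: the number of n with
X > c k ^ n is comparable to log+ X / log k. *)
Lemma log_moment_of_tails X k c (B : R) : measurable_fun setT X -> 1 < k -> 0 < c ->
  (forall n, \sum_(i < n) pr [set x | c * k ^+ i < X x] <= B) ->
  ('E_P[fun x => log_plus (X x)] < +oo)%E.
Proof.
move=> mX k1 c0 hB; have lk0 : 0 < ln k by rewrite ln_gt0.
pose E i := [set x | c * k ^+ i < X x].
have mE i : measurable (E i) by exact: measurable_gt.
pose cnt x : \bar R := (\sum_(i <oo) (\1_(E i) x)%:E)%E.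
have cnt0 x : (0 <= cnt x)%E by apply: nneseries_ge0 => i _ _; rewrite lee_fin.
have mcnt : measurable_fun setT cnt.
  apply: ge0_emeasurable_sum => [i x _ _|i _]; first by rewrite lee_fin.
  by apply/measurable_EFinP; exact: measurable_indic.
have key x : ((log_plus (X x))%:E <= (`|ln c|)%:E + (ln k)%:E * cnt x)%E.
  have [n hn] : exists n : nat, X x <= c * k ^+ n.
    have [n hn] : exists n : nat, X x / c < k ^+ n.
      have := @cvg_geometric R 1 k^-1; rewrite ger0_norm ?invr_ge0 ?(ltW (lt_trans ltr01 k1)) //.
      rewrite invf_lt1 ?(lt_trans ltr01 k1) // => /(_ k1) /cvgrPdist_lt.
      have e0 : 0 < (`|X x / c| + 1)^-1 by rewrite invr_gt0 ltr_wpDl.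
      move=> /(_ _ e0) [n _ hn]; exists n.
      move: (hn n (leqnn n)); rewrite /= sub0r normrN mul1r ger0_norm ?exprn_ge0 ?invr_ge0 ?(ltW (lt_trans ltr01 k1)) //.
      rewrite exprVn ltf_pV2 ?posrE ?exprn_gt0 ?(lt_trans ltr01 k1) ?ltr_wpDl // => h.
      by apply: lt_trans h; rewrite ltr_pwDr // ler_norm.
    by exists n; rewrite mulrC -ler_pdivrMr // ltW.
  (* the events E i hold for i < N, so N is at most the count cnt x *)
  have [N hN Nmin] := @ex_minnP (fun n => X x <= c * k ^+ n) (ex_intro _ n hn).
  apply: (@le_trans _ _ (`|ln c| + ln k * N%:R)%:E).
    rewrite lee_fin; apply: (@le_trans _ _ (ln (Num.max 1 (c * k ^+ N)))).
      by apply: log_plus_mono.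
    have kN : 0 < k ^+ N by rewrite exprn_gt0 // (lt_trans ltr01 k1).
    have [h|h] := leP 1 (c * k ^+ N).
      rewrite lnM ?posrE // lnXn ?(lt_trans ltr01 k1) // mulr_natr.
      by rewrite lerD2r ler_norm.
    by rewrite ln1 addr_ge0 // mulr_ge0 // ltW.
  rewrite EFinD EFinM leeD2l //; apply: lee_pmul => //; first by rewrite lee_fin ltW.
  have -> : (N%:R%:E = \sum_(0 <= i < N) (\1_(E i) x)%:E :> \bar R)%E.
    rewrite sumEFin (eq_big_nat _ _ (F2 := fun=> 1)).
      by rewrite sumr_const_nat subn0.
    move=> i /andP[_ iN]; rewrite indicE mem_set // /E /= ltNge; apply/negP => /Nmin.
    by rewrite leqNgt iN.
  by apply: nneseries_lim_ge => i _; rewrite lee_fin.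
have cntB : (\int[P]_x cnt x <= B%:E)%E.
  rewrite integral_nneseries //; last first.
    by move=> i; apply/measurable_EFinP; exact: measurable_indic.
  apply: lime_le; first by apply: is_cvg_nneseries => i _ _; apply: integral_ge0 => x _; rewrite lee_fin.
  apply: nearW => n; rewrite big_mkord.
  rewrite (eq_bigr (fun i : 'I_n => (pr (E i))%:E)); last first.
    by move=> i _; rewrite integral_indic // setIT; exact: prE.
  by rewrite sumEFin lee_fin; exact: hB.
rewrite unlock; apply: (@le_lt_trans _ _ (\int[P]_x ((`|ln c|)%:E + (ln k)%:E * cnt x))%E).
  apply: ge0_le_integral => //.
  - by move=> x _; rewrite lee_fin log_plus_ge0.
  - by apply/measurable_EFinP; exact: measurable_log_plus.
  - by apply: emeasurable_funD => //; exact: measurable_funeM.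
have -> : (\int[P]_x ((`|ln c|)%:E + (ln k)%:E * cnt x) =
    \int[P]_x (`|ln c|)%:E + \int[P]_x ((ln k)%:E * cnt x))%E.
  apply: ge0_integralD => //; first [exact: measurable_funeM
    | by move=> x _; rewrite mule_ge0 // lee_fin ltW].
have -> : (\int[P]_x (`|ln c|)%:E = (`|ln c|)%:E)%E.
  transitivity ((`|ln c|)%:E * P setT)%E; first exact: integral_cst.
  by rewrite probability_setT mule1.
rewrite ge0_integralZl_EFin // ?(ltW lk0) //.
rewrite lte_add_pinfty ?ltry // (le_lt_trans (lee_wpmul2l _ cntB)) ?lee_fin ?(ltW lk0) //.
by rewrite -EFinM ltry.
Qed.

Lemma tails_of_log_moment X k : measurable_fun setT X -> 1 < k ->
  ('E_P[fun x => log_plus (X x)] < +oo)%E ->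
  exists B : R, forall n, \sum_(i < n) pr [set x | k ^+ i.+1 < X x] <= B.
Proof.
move=> mX k1 hE; have lk0 : 0 < ln k by rewrite ln_gt0.
have k0 : 0 < k by exact: lt_trans k1.
pose E i := [set x | k ^+ i.+1 < X x].
have mE i : measurable (E i) by exact: measurable_gt.
move: hE; rewrite unlock => hE.
have I0 : (0 <= \int[P]_x (log_plus (X x))%:E)%E.
  by apply: integral_ge0 => x _; rewrite lee_fin log_plus_ge0.
have If : (\int[P]_x (log_plus (X x))%:E)%E \is a fin_num by rewrite ge0_fin_numE.
exists (fine (\int[P]_x (log_plus (X x))%:E)%E / ln k) => n.
rewrite ler_pdivlMr // mulrC -lee_fin fineK //.
have -> : ((ln k * \sum_(i < n) pr (E i))%:E = \int[P]_x (ln k * \sum_(i < n) \1_(E i) x)%:E)%E.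
  under [RHS]eq_integral do rewrite EFinM -sumEFin.
  rewrite ge0_integralZl_EFin //; last 3 first.
  - by move=> x _; apply: sume_ge0 => i _; rewrite lee_fin.
  - by apply: emeasurable_sum => i; apply/measurable_EFinP; exact: measurable_indic.
  - exact: ltW.
  rewrite ge0_integral_sum //; last by move=> i; apply/measurable_EFinP; exact: measurable_indic.
  rewrite EFinM -sumEFin; congr (_ * _)%E; apply: eq_bigr => i _.
  by rewrite integral_indic // setIT; apply/esym; exact: prE.
apply: ge0_le_integral => //.
- move=> x _; rewrite lee_fin mulr_ge0 ?(ltW lk0) //; apply: sumr_ge0 => i _; exact: ler0n.
- by apply/measurable_EFinP; apply: measurable_funM => //; apply: measurable_sum => i;
    exact: measurable_indic.
- by apply/measurable_EFinP; exact: measurable_log_plus.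
move=> x _; rewrite lee_fin; elim: n => [|n IHn].
  by rewrite big_ord0 mulr0 log_plus_ge0.
rewrite big_ord_recr /= indicE; case: (boolP (x \in E n)) => [|_]; last first.
  by rewrite addr0.
rewrite inE /E /= => hx; apply: (@le_trans _ _ (ln (k ^+ n.+1))).
  rewrite (_ : ln (k ^+ n.+1) = ln k * n.+1%:R); last by rewrite lnXn // mulr_natr.
  apply: ler_wpM2l; first exact: ltW.
  have -> : n.+1%:R = n%:R + 1 :> R by rewrite natr1.
  rewrite lerD2r; apply: (@le_trans _ _ (\sum_(i < n) 1)).
    by apply: ler_sum => i _; rewrite indicE lern1; case: (_ \in _).
  by rewrite sumr_const card_ord.
by rewrite /log_plus ler_ln ?posrE ?lt_max ?ltr01 ?exprn_gt0 // le_max (ltW hx) orbT.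
Qed.

Lemma ngeo_unshift (N : nat) (x : nat -> R) : ngeo (fun n => x (n + N)%N) -> ngeo x.
Proof.
elim: N x => [|N IHN] x h; first by move: h; under eq_fun do rewrite addn0.
apply: ngeo_unshift1; apply: IHN; move: h; congr ngeo.
by apply/funext => n; rewrite addnS.
Qed.

(** Borel-Cantelli: identically distributed variables with a finite logarithmic
moment grow subexponentially. *)
Lemma log_moment_decay (X : nat -> T -> R) (rho : R) :
  (forall n, measurable_fun setT (X n)) -> (forall n x, 0 <= X n x) ->
  (forall n c, pr [set x | c < X n x] = pr [set x | c < X 0%N x]) ->
  0 < rho < 1 -> ('E_P[fun x => log_plus (X 0%N x)] < +oo)%E ->
  {ae P, forall x, ngeo (fun n => rho ^+ n * X n x)}.
Proof.
move=> mX X0 idX /andP[r0 r1] hE.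
pose sr := Num.sqrt rho; have sr0 : 0 < sr by rewrite sqrtr_gt0.
have srE : sr ^+ 2 = rho by rewrite sqr_sqrtr // ltW.
have sr1 : sr < 1 by rewrite -sqrtr1 ltr_sqrt.
have k1 : 1 < sr^-1 by rewrite invf_gt1.
have [B hB] := tails_of_log_moment (mX 0%N) k1 hE.
pose E n := [set x | sr^-1 ^+ n.+1 < X n x].
have mE n : measurable (E n) by exact: measurable_gt.
have sumE : (\sum_(n <oo) P (E n) < +oo)%E.
  apply: (@le_lt_trans _ _ B%:E); last exact: ltry.
  apply: lime_le; first by apply: is_cvg_nneseries => i _ _.
  apply: nearW => n; rewrite big_mkord.
  rewrite (eq_bigr (fun i : 'I_n => (pr [set x | sr^-1 ^+ i.+1 < X 0%N x])%:E)); last first.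
    by move=> i _; rewrite -(idX i); exact: prE.
  by rewrite sumEFin lee_fin; exact: hB.
have := lim_sup_set_cvg0 mE sumE => ls0.
exists (lim_sup_set E); split => //.
  apply: bigcapT_measurable => n.
  by apply: bigcup_measurable => j _; exact: mE.
move=> x /= nx; apply: contrapT => hx; apply: nx.
have [N hle] : exists N, forall n, (N <= n)%N -> X n x <= sr^-1 ^+ n.+1.
  apply: contrapT => hN; apply: hx => N _; apply: contrapT => hx; apply: hN.
  exists N => n Nn; rewrite leNgt; apply/negP => hn; apply: hx.
  by exists n.
apply: (@ngeo_unshift N); exists (sr^-1 * sr ^+ N), sr; split.
- by rewrite mulr_ge0 ?exprn_ge0 ?invr_ge0 // ltW.
- by rewrite sr0.
move=> n; apply: le_trans (_ : rho ^+ (n + N) * sr^-1 ^+ (n + N).+1 <= _).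
  by rewrite ler_wpM2l ?exprn_ge0 ?(ltW r0) // hle // leq_addl.
rewrite (_ : sr^-1 * sr ^+ N * sr ^+ n = sr^-1 * sr ^+ (n + N)); last by rewrite exprD; ring.
rewrite -srE exprAC exprVn [sr ^+ (n + N).+1]exprS.
have : sr ^+ (n + N) != 0 by rewrite expf_neq0 // gt_eqF.
move: (sr ^+ (n + N)) => y y0.
by rewrite (_ : y ^+ 2 / (sr * y) = sr^-1 * y) //; field; rewrite y0 gt_eqF.
Qed.

End logarithmic_moments.

Section logarithmic_moment_comparison.
Context {R : realType} {disp : measure_display} {T : measurableType disp}.
Variable P : probability T R.
Local Notation pr := (pr P).

Lemma sum_window (f : nat -> R) h N L : (forall n, 0 <= f n) -> (h + N <= L)%N ->
  \sum_(i < N) f (h + i)%N <= \sum_(l < L) f l.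
Proof.
move=> f0 hL; rewrite -(subnKC hL) big_split_ord /= big_split_ord /=.
rewrite -addrA addrCA lerDl addr_ge0 //; apply: sumr_ge0 => i _; exact: f0.
Qed.

Lemma log_moment_le_sum n (X : T -> R) (Y : nat -> T -> R) (B : R) :
  measurable_fun setT X -> (forall i, measurable_fun setT (Y i)) -> 0 < B ->
  (forall x, X x <= B * \sum_(i < n) Y i x) ->
  (forall i, (i < n)%N -> ('E_P[fun x => log_plus (Y i x)] < +oo)%E) ->
  ('E_P[fun x => log_plus (X x)] < +oo)%E.
Proof.
move=> mX mY B0 hX hY; have k1 : 1 < 2 :> R by rewrite ltr1n.
have /choice[b hb] : forall i : 'I_n, exists b : R,
    forall N, \sum_(k < N) pr [set x | 2 ^+ k.+1 < Y i x] <= b.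
  by move=> i; exact: tails_of_log_moment (mY i) k1 (hY i (ltn_ord i)).
have c0 : 0 < B * n.+1%:R * 2 by rewrite !mulr_gt0.
apply: (@log_moment_of_tails _ _ _ P X 2 (B * n.+1%:R * 2) (\sum_i b i)) => // N.
apply: (@le_trans _ _ (\sum_(k < N) \sum_(i < n) pr [set x | 2 ^+ k.+1 < Y i x])); last first.
  by rewrite exchange_big /=; apply: ler_sum => i _; exact: hb.
apply: ler_sum => k _.
pose A i := [set x | 2 ^+ k.+1 < Y i x].
have mA i : measurable (A i) by exact: measurable_gt.
apply: le_trans (pr_bigsetU_le P n mA); apply: pr_mono.
- exact: measurable_gt.
- exact: bigsetU_measurable.
move=> x /= hx; apply/bigsetU_ordP; apply: contrapT => hn.
move: hx; apply/negP; rewrite -leNgt; apply: le_trans (hX x) _.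
rewrite -!mulrA ler_pM2l // -exprS mulrC.
apply: (@le_trans _ _ (\sum_(i < n) 2 ^+ k.+1)).
  by apply: ler_sum => i _; rewrite leNgt; apply/negP => hi; apply: hn; exists i.
by rewrite sumr_const card_ord -(mulr_natr _ n) ler_wpM2l ?exprn_ge0 // ler_nat.
Qed.

(** Followed backwards, a linear recurrence bounds X 0 by A ^ n times the terms
around time n; if these are rarely larger than K, the tails of X 0 are summable
along a geometric progression. *)
Lemma log_moment_of_recurrence (X : nat -> T -> R) D (A K B : R) :
  (forall n, measurable_fun setT (X n)) -> (forall n x, 0 <= X n x) ->
  0 <= A -> 0 < K ->
  (forall n x, X n x <= A * \sum_(e < D) X (n + e.+1)%N x) ->
  (forall N, \sum_(n < N) pr [set x | K < X n x] <= B) ->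
  ('E_P[fun x => log_plus (X 0%N x)] < +oo)%E.
Proof.
move=> mX X0 A0 K0 hrec hB; pose S n x := \sum_(e < D.+1) X (n + e)%N x.
(* sliding a window of length D + 1 by one step costs a factor A + 2 *)
have Sstep n x : S n x <= (A + 2) * S n.+1 x.
  have h1 : S n.+1 x = \sum_(e < D) X (n + e.+1)%N x + X (n.+1 + D)%N x.
    rewrite /S big_ord_recr /=; congr (_ + _); apply: eq_bigr => e _.
    by congr (X _ x); rewrite addnS.
  have h2 : S n x = X n x + \sum_(e < D) X (n + e.+1)%N x.
    by rewrite /S big_ord_recl addn0; congr (_ + _); apply: eq_bigr => e _; rewrite /= /bump.
  have s0 : 0 <= \sum_(e < D) X (n + e.+1)%N x by exact: sumr_ge0.
  have := hrec n x; have := X0 (n.+1 + D)%N x; rewrite h1 h2; nra.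
have k1 : 1 < A + 2 by lra.
have k0 : 0 < A + 2 by lra.
have Sn n x : X 0%N x <= (A + 2) ^+ n * S n x.
  elim: n => [|n IHn].
    by rewrite mul1r /S big_ord_recl /= addn0 lerDl; exact: sumr_ge0.
  by apply: le_trans IHn _; rewrite exprSr -mulrA ler_pM2l ?exprn_gt0.
apply: (@log_moment_of_tails _ _ _ P _ (A + 2) (D.+1%:R * K) (D.+1%:R * B)) => //.
  by rewrite mulr_gt0.
move=> N; apply: (@le_trans _ _
  (\sum_(n < N) \sum_(e < D.+1) pr [set x | K < X (n + e)%N x])).
  apply: ler_sum => n _; pose F e := [set x | K < X (n + e)%N x].
  have mF e : measurable (F e) by exact: measurable_gt.
  apply: le_trans (pr_bigsetU_le P D.+1 mF); apply: pr_mono.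
  - exact: measurable_gt.
  - exact: bigsetU_measurable.
  move=> x /= hx; apply/bigsetU_ordP; apply: contrapT => hn.
  move: hx; apply/negP; rewrite -leNgt; apply: le_trans (Sn n x) _.
  rewrite mulrC ler_pM2r ?exprn_gt0 //; apply: (@le_trans _ _ (\sum_(e < D.+1) K)).
    by apply: ler_sum => e _; rewrite leNgt; apply/negP => he; apply: hn; exists e.
  by rewrite sumr_const card_ord mulr_natl.
rewrite exchange_big /= mulr_natl -[X in _ *+ X]card_ord -sumr_const.
apply: ler_sum => e _; apply: le_trans (hB (e + N)%N).
under eq_bigr do rewrite addnC.
by apply: (@sum_window (fun n => pr [set x | K < X n x])) => // n; exact: pr_ge0.
Qed.

End logarithmic_moment_comparison.

(** ** Almost sure events *)

Section almost_sure.
Context {R : realType} {disp : measure_display} {T : measurableType disp}.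
Variable P : probability T R.
Local Notation pr := (pr P).

Lemma ae_of_pr0 (A : set T) : measurable A -> pr A = 0 -> {ae P, forall x, ~ A x}.
Proof.
move=> mA A0; exists A; split => //; first by transitivity (pr A)%:E; [exact: prE|rewrite A0].
by move=> x /= /contrapT.
Qed.

Lemma pr_ae_le (A B : set T) : measurable A -> measurable B ->
  {ae P, forall x, A x -> B x} -> pr A <= pr B.
Proof.
move=> mA mB [N [mN N0 hN]].
have pN : pr N = 0 by rewrite /pr N0.
apply: (@le_trans _ _ (pr (B `|` N))).
  apply: pr_mono => //; first exact: measurableU.
  by move=> x Ax; have [Nx|Nx] := pselect (N x); [right|left; apply: contrapT => Bx;
    apply: Nx; apply: hN => /= /(_ Ax)].
by apply: le_trans (prU_le P mB mN) _; rewrite pN addr0.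
Qed.

Lemma pr_ae1 (A : set T) : measurable A -> {ae P, forall x, A x} -> pr A = 1.
Proof.
move=> mA hA; apply/eqP; rewrite eq_le pr_le1 //=.
have <- : pr setT = 1 by rewrite /pr probability_setT.
by apply: pr_ae_le => //; apply: filterS hA.
Qed.

Lemma ae_int (Q : int -> T -> Prop) : (forall t, {ae P, forall x, Q t x}) ->
  {ae P, forall x, forall t, Q t x}.
Proof.
move=> h; have h1 : {ae P, forall x, forall n : nat, Q n%:Z x} by apply: ae_foralln => n; exact: h.
have h2 : {ae P, forall x, forall n : nat, Q (Negz n) x} by apply: ae_foralln => n; exact: h.
by apply: filterS2 h1 h2 => x a b [n|n].
Qed.

Lemma pr_decreasing (F : nat -> set T) (e : R) : (forall n, measurable (F n)) ->
  (forall i j, (i <= j)%N -> F j `<=` F i) -> {ae P, forall x, exists n, ~ F n x} ->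
  0 < e -> exists n, pr (F n) <= e.
Proof.
move=> mF decF F0 e0; have mI : measurable (\bigcap_n F n) by exact: bigcapT_measurable.
have cv : P (F n) @[n --> \oo] --> P (\bigcap_n F n).
  apply: nonincreasing_cvg_mu => //.
  - by rewrite (le_lt_trans (probability_le1 P (mF 0%N))) // ltry.
  - by move=> i j ij; apply/subsetPset; exact: decF.
have P0 : P (\bigcap_n F n) = 0%E.
  apply: measure_negligible => //; apply: negligibleS F0 => x h /= [n]; apply.
  exact: h.
rewrite P0 in cv.
move/fine_cvgP: cv => [_ /cvgrPdist_lt /(_ e e0)] [n _ hn]; exists n.
have := hn n (leqnn n); rewrite /= sub0r normrN => /ltW; apply: le_trans.
exact: ler_norm.
Qed.

(** A real random variable whose tail events have probability 0 or 1 sits at the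
level where its distribution function jumps. *)
Lemma zero_one_const (f : T -> R) : measurable_fun setT f ->
  (forall r, pr [set x | r < f x] = 0 \/ pr [set x | r < f x] = 1) ->
  exists c, {ae P, forall x, f x = c}.
Proof.
move=> mf h01; pose A := [set r | pr [set x | r < f x] = 0].
have mg r : measurable [set x | r < f x] by exact: measurable_gt.
have half0 : 0 < 2^-1 :> R by rewrite invr_gt0.
have A0 : A !=set0.
  have [n hn] := pr_tail P mf half0; exists n%:R; rewrite /A /=.
  by case: (h01 n%:R) => // h; move: hn; rewrite h; lra.
have mNf : measurable_fun setT (fun x => - f x) by exact: measurable_funN.
have [n hn] := pr_tail P mNf half0.
have Alb : lbound A (- n%:R - 1).
  move=> r Ar; rewrite leNgt; apply/negP => hr.
  have : pr (~` [set x | r < f x]) <= pr [set x | n%:R < - f x].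
    apply: pr_mono; [exact: measurableC|exact: measurable_gt|].
    by move=> x /= /negP; rewrite -leNgt; lra.
  by rewrite prC // Ar; lra.
have Ainf : has_inf A by split => //; exists (- n%:R - 1).
exists (inf A).
have up k : {ae P, forall x, f x <= inf A + k.+1%:R^-1}.
  have [r Ar hr] : exists2 r, A r & r < inf A + k.+1%:R^-1.
    by apply: inf_adherent => //; rewrite invr_gt0.
  have := ae_of_pr0 (mg r) Ar; apply: filterS => x /= /negP; rewrite -leNgt => h.
  exact: le_trans h (ltW hr).
have lo k : {ae P, forall x, inf A - k.+1%:R^-1 < f x}.
  have k0 : 0 < k.+1%:R^-1 :> R by rewrite invr_gt0.
  have [h|h] := h01 (inf A - k.+1%:R^-1).
    by have := ge_inf (proj2 Ainf) h; rewrite lerBrDr gerDl leNgt k0.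
  have : pr (~` [set x | inf A - k.+1%:R^-1 < f x]) = 0 by rewrite prC // h subrr.
  move/(ae_of_pr0 (measurableC (mg _))); apply: filterS => x /= /contrapT; exact.
apply: filterS2 (ae_foralln up) (ae_foralln lo) => x h1 h2.
apply/eqP; rewrite eq_le; apply/andP; split; apply/ler_addgt0Pr => e e0.
  have [k hk] : exists k : nat, k.+1%:R^-1 < e.
    exists (Num.truncn e^-1); rewrite invf_plt ?posrE //; exact: truncnS_gt.
  by apply: le_trans (h1 k) _; rewrite lerD2l ltW.
have [k hk] : exists k : nat, k.+1%:R^-1 < e.
  exists (Num.truncn e^-1); rewrite invf_plt ?posrE //; exact: truncnS_gt.
by rewrite -lerBlDr; apply: ltW; apply: le_lt_trans (h2 k); rewrite lerD2l lerN2 ltW.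
Qed.

End almost_sure.

(** * Tight processes *)

Section coefficient_expansion.
Context {F : fieldType}.

Lemma mactE N m n l (A : 'M[{poly F}]_(m, n)) (x : int -> 'M[F]_(n, l)) t :
  (forall i j, (size (A i j) <= N)%N) ->
  mact A x t = \sum_(e < N) map_mx (coefp e) A *m x (t - e%:Z).
Proof.
move=> hN; apply/matrixP => i j; rewrite mxE summxE.
under eq_bigr do rewrite (pact_widen _ _ (hN _ _)).
rewrite exchange_big /=; apply: eq_bigr => e _; rewrite mxE.
by apply: eq_bigr => k _; rewrite mxE.
Qed.

Lemma mx_size_bound m n (A : 'M[{poly F}]_(m, n)) :
  exists N, forall i j, (size (A i j) <= N)%N.
Proof.
exists (\max_(ij : 'I_m * 'I_n) size (A ij.1 ij.2)) => i j.
exact: (leq_bigmax (F := fun ij : 'I_m * 'I_n => size (A ij.1 ij.2)) (i, j)).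
Qed.

End coefficient_expansion.

Section tightness.
Context {R : realType} {disp : measure_display} {Om : measurableType disp}.
Variable P : probability Om R.
Local Notation pr := (pr P).
Local Notation C := R[i].

Definition measurable_process m (X : int -> Om -> 'cV[C]_m) :=
  forall t, measurable_fun setT (X t).

Definition tails_le m (X : int -> Om -> 'cV[C]_m) (K e : R) :=
  forall t, pr [set x | K < mxnorm (X t x)] <= e.

(** Bounded in probability, uniformly in time: all that necessity and uniqueness need
to know about a strictly stationary solution. *)
Definition tight m (X : int -> Om -> 'cV[C]_m) :=
  forall e : R, 0 < e -> exists K, tails_le X K e.

Lemma measurable_norm_gt m (X : Om -> 'cV[C]_m) K : measurable_fun setT X ->
  measurable [set x | K < mxnorm (X x)].
Proof. by move=> mX; apply: measurable_gt; exact: measurable_mxnorm. Qed.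

Lemma tails_leD m (X Y : int -> Om -> 'cV[C]_m) K1 K2 e1 e2 :
  measurable_process X -> measurable_process Y ->
  tails_le X K1 e1 -> tails_le Y K2 e2 ->
  tails_le (fun t x => X t x + Y t x) (K1 + K2) (e1 + e2).
Proof.
move=> mX mY hX hY t; apply: le_trans (lerD (hX t) (hY t)).
have m1 := measurable_norm_gt K1 (mX t); have m2 := measurable_norm_gt K2 (mY t).
apply: le_trans (prU_le P m1 m2); apply: pr_mono.
- exact: measurable_norm_gt (measurable_mxD (mX t) (mY t)).
- exact: measurableU.
move=> x /= hx; apply: contrapT => /not_orP[/= /negP h1 /negP h2].
move: hx; apply/negP; rewrite -leNgt; apply: le_trans (mxnormD _ _) _.
by apply: lerD; rewrite leNgt.
Qed.

Lemma tails_leZ m (X : int -> Om -> 'cV[C]_m) (a : C) (h : int) K e : normc a <= 1 ->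
  measurable_process X -> tails_le X K e -> tails_le (fun t x => a *: X (t + h) x) K e.
Proof.
move=> a1 mX hX t; apply: le_trans (hX (t + h)); apply: pr_mono.
- apply: measurable_norm_gt; under eq_fun do rewrite -mul_scalar_mx.
  exact: measurable_mulmx.
- exact: measurable_norm_gt.
move=> x /= h1; apply: lt_le_trans h1 _; rewrite mxnormZ ler_piMl //; exact: mxnorm_ge0.
Qed.

Lemma measurable_scale m (X : Om -> 'cV[C]_m) (a : C) : measurable_fun setT X ->
  measurable_fun setT (fun x => a *: X x).
Proof.
by move=> mX; under eq_fun do rewrite -mul_scalar_mx; exact: measurable_mulmx.
Qed.

Lemma measurable_mact m n (A : 'M[{poly C}]_(m, n)) X : measurable_process X ->
  measurable_process (fun t x => mact A (X ^~ x) t).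
Proof.
move=> mX t; have [N hN] := mx_size_bound A.
under eq_fun do rewrite (mactE _ _ hN).
by apply: measurable_mx_sum => e _; exact: measurable_mulmx.
Qed.

(** A filter with r factors of the form a B^n - b with small coefficients spreads
a process over at most 2 ^ r summands, whatever the lag n is. *)
Lemma tails_le_filter m (X : int -> Om -> 'cV[C]_m) n (rs : seq (C * C)) K e :
  measurable_process X -> all (fun ab => (normc ab.1 <= 1) && (normc ab.2 <= 1)) rs ->
  tails_le X K e ->
  tails_le (fun t x => mact ((\prod_(ab <- rs) (ab.1 *: 'X^n - ab.2%:P))%:M : 'M[{poly C}]_m) (X ^~ x) t)
    (2 ^+ size rs * K) (2 ^+ size rs * e).
Proof.
move=> mX + hX; elim: rs => [_|[a b] rs IHrs /= /andP[/andP[ha hb] hrs]].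
  rewrite !mul1r big_nil => t.
  rewrite [X in pr X](_ : _ = [set x | K < mxnorm (X t x)]); first exact: hX.
  apply/funext => x /=; congr (K < mxnorm _); apply/matrixP => i j.
  by rewrite mact_scalar pact1.
pose Y t x := mact ((\prod_(ab <- rs) (ab.1 *: 'X^n - ab.2%:P))%:M : 'M[{poly C}]_m) (X ^~ x) t.
have mY : measurable_process Y by exact: measurable_mact.
have := IHrs hrs => {}IHrs.
have h1 := tails_leZ (- n%:Z) ha mY IHrs.
have hb' : normc (- b) <= 1 by rewrite normcN.
have h2 := tails_leZ 0 hb' mY IHrs.
have := tails_leD (fun t => measurable_scale a (mY (t - n%:Z)))
   (fun t => measurable_scale (- b) (mY (t + 0))) h1 h2.
have dbl (z : R) : 2 ^+ (size rs).+1 * z = 2 ^+ size rs * z + 2 ^+ size rs * z.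
  by rewrite exprS; ring.
rewrite !dbl => h t; apply: le_trans (h t).
rewrite le_eqVlt; apply/orP; left; apply/eqP; congr (pr _).
apply/funext => x /=; congr (_ < mxnorm _).
rewrite big_cons scalar_mxM mactM raddfB /= mactDl; congr (_ + _).
  have -> : (a *: 'X^n)%:M = 'X^n *: map_mx polyC (a%:M) :> 'M[{poly C}]_m.
    apply/matrixP => k l; rewrite !mxE; case: (k == l); rewrite ?mulr1n ?mulr0n.
      by rewrite -mul_polyC mulrC.
    by rewrite mulr0.
  by rewrite mactXn mact_const mul_scalar_mx.
rewrite addr0 -raddfN /= -polyCN.
have -> : ((- b)%:P)%:M = map_mx polyC ((- b)%:M) :> 'M[{poly C}]_m.
  by apply/matrixP => k l; rewrite !mxE; case: (k == l); rewrite ?mulr1n ?mulr0n.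
by rewrite mact_const mul_scalar_mx.
Qed.

Lemma tightD m (X Y : int -> Om -> 'cV[C]_m) : measurable_process X ->
  measurable_process Y -> tight X -> tight Y -> tight (fun t x => X t x + Y t x).
Proof.
move=> mX mY hX hY e e0; have e2 : 0 < e / 2 by rewrite divr_gt0.
have [K1 h1] := hX _ e2; have [K2 h2] := hY _ e2.
by exists (K1 + K2); rewrite (splitr e); exact: tails_leD.
Qed.

Lemma tight_mulmx m n (A : 'M[C]_(m, n)) (h : int) X : measurable_process X -> tight X ->
  tight (fun t x => A *m X (t + h) x).
Proof.
move=> mX hX e e0; have [K hK] := hX e e0; exists ((mxnorm A + 1) * K) => t.
apply: le_trans (hK (t + h)); apply: pr_mono.
- by apply: measurable_norm_gt; exact: measurable_mulmx.
- exact: measurable_norm_gt.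
move=> x /= h1; have := lt_le_trans h1 (mxnormM _ _).
have A0 := mxnorm_ge0 A; have X0 := mxnorm_ge0 (X (t + h) x) => h2.
rewrite -(ltr_pM2l (_ : 0 < mxnorm A + 1)); last lra.
by apply: lt_le_trans h2 _; rewrite ler_wpM2r // lerDl.
Qed.

Lemma tight_cst m (c : 'cV[C]_m) : tight (fun _ _ => c).
Proof.
move=> e e0; exists (mxnorm c) => t; rewrite (_ : [set x | _] = set0).
  by rewrite /pr measure0 ltW.
by apply/seteqP; split => // x /=; rewrite ltxx.
Qed.

Lemma tight_mact m n (A : 'M[{poly C}]_(m, n)) X : measurable_process X -> tight X ->
  tight (fun t x => mact A (X ^~ x) t).
Proof.
move=> mX hX; have [N hN] := mx_size_bound A.
have -> : (fun t x => mact A (X ^~ x) t) =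
    (fun t x => \sum_(e < N) map_mx (coefp e) A *m X (t - e%:Z) x).
  by apply/funext => t; apply/funext => x; rewrite (mactE _ _ hN).
elim: N {hN} => [|N IHN].
  under [X in tight X]eq_fun do under eq_fun do rewrite big_ord0.
  exact: tight_cst.
under [X in tight X]eq_fun do under eq_fun do rewrite big_ord_recr.
apply: tightD => //; last exact: tight_mulmx.
- by move=> t; apply: measurable_mx_sum => e _; exact: measurable_mulmx.
- by move=> t; exact: measurable_mulmx.
Qed.

(** A single law is tight. *)
Lemma tight_identically m (X : int -> Om -> 'cV[C]_m) : measurable_process X ->
  (forall t A, measurable A -> P (X t @^-1` A) = P (X 0 @^-1` A)) -> tight X.
Proof.
move=> mX idX e e0; have [n hn] := pr_tail P (measurable_mxnorm (mX 0)) e0.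
exists n%:R => t; apply: le_trans hn; rewrite le_eqVlt; apply/orP; left; apply/eqP.
rewrite /pr; congr fine; apply: (idX t [set z | n%:R < mxnorm z]).
exact: (@measurable_gt R _ _ (fun z : 'cV[C]_m => mxnorm z) _ (measurable_mxnorm (@measurable_id _ _ _))).
Qed.

Lemma tight_stationary m (X : int -> {RV P >-> 'cV[C]_m}) :
  strictly_stationary X -> tight (fun t => X t).
Proof.
move=> sX; apply: tight_identically => [t|t A mA]; first exact: measurable_funPT.
have mB : measurable [set z : 1.-tuple 'cV[C]_m | A (tnth z ord0)].
  have mt : measurable_fun setT (fun z : 1.-tuple 'cV[C]_m => tnth z ord0).
    exact: measurable_tnth.
  by have := mt measurableT _ mA; rewrite setTI.
have := sX 1%N (fun=> 0) t _ mB.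
rewrite [X in P X = _ -> _](_ : _ = X t @^-1` A); last first.
  by apply/funext => x /=; rewrite tnth_mktuple add0r.
by rewrite [X in _ = P X -> _](_ : _ = X 0 @^-1` A) //; apply/funext => x /=; rewrite tnth_mktuple.
Qed.

End tightness.

(** * The degenerate directions of the noise *)

Section block_vectors.
Context {R : realType}.
Local Notation C := R[i].
Variables (d s : nat).
Hypothesis sd : (s <= d)%N.

Definition lower_mx : 'M[C]_(d, d - s) := \matrix_(i, k) (i == s + k :> nat)%N%:R.

Lemma vstackE (w : 'cV[C]_s) (v : 'cV[C]_(d - s)) :
  vstack w v = pid_mx s *m w + lower_mx *m v.
Proof.
have e := subnKC sd; rewrite /vstack.
rewrite -(conform_castmx (e, erefl)) conform_mx_id.
apply/matrixP => i j; rewrite castmxE !mxE (ord1 j).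
case: splitP => k /= hk.
  rewrite (bigD1 k) //= big1 ?addr0 => [|l /eqP lk]; last first.
    by rewrite mxE hk; case: eqP => [h|_]; rewrite ?mul0r //; case: lk; apply/val_inj.
  rewrite big1 => [|l _]; last by rewrite mxE; case: eqP => [h|_]; rewrite ?mul0r //;
    have := ltn_ord k; lia.
  by rewrite mxE hk eqxx ltn_ord mul1r addr0; congr (w _ _); exact/ord1.
rewrite [X in X + _]big1 => [|l _]; last first.
  by rewrite mxE hk; case: eqP => [h|_]; rewrite ?mul0r //; have := ltn_ord l; lia.
rewrite (bigD1 k) //= big1 ?addr0 => [|l /eqP lk]; last first.
  by rewrite mxE; case: eqP => [h|_]; rewrite ?mul0r //; case: lk; apply/val_inj => /=; lia.
by rewrite mxE hk eqxx mul1r add0r; congr (v _ _); exact/ord1.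
Qed.

Lemma pid_lower n : (pid_mx s : 'M[C]_(n, d)) *m lower_mx = 0.
Proof.
apply/matrixP => i j; rewrite !mxE big1 // => k _; rewrite !mxE.
case: eqP => [h|_]; last by rewrite mul0r.
by case: ltnP => hs; rewrite ?mul0r //; case: eqP => [h'|_]; rewrite ?mulr0 //; lia.
Qed.

Lemma vstack_split (x : 'cV[C]_d) (v : 'cV[C]_(d - s)) :
  (forall k : 'I_(d - s), forall i : 'I_d, (i = s + k :> nat)%N -> x i 0 = v k 0) ->
  x = vstack (pid_mx s *m x) v.
Proof.
move=> h; rewrite vstackE mulmxA mul_pid_mx !minnn.
apply/matrixP => i j; rewrite !mxE (ord1 j).
rewrite (bigD1 i) //= big1 ?addr0 => [|l /eqP li]; last first.
  by rewrite mxE; case: eqP => [e|_]; rewrite ?mul0r //; case: li; exact/val_inj.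
rewrite mxE eqxx /=; case: ltnP => hs.
  rewrite mul1r big1 ?addr0 // => l _; rewrite mxE; case: eqP => [e|_]; rewrite ?mul0r //; lia.
have hk : (i - s < d - s)%N by have := ltn_ord i; lia.
rewrite mul0r add0r (bigD1 (Ordinal hk)) //= big1 ?addr0 => [|l /eqP lk]; last first.
  by rewrite mxE; case: eqP => [e|_]; rewrite ?mul0r //; case: lk; apply/val_inj => /=; lia.
rewrite mxE /= subnKC // eqxx mul1r; apply: h; by rewrite /= subnKC.
Qed.

End block_vectors.

Section random_variables.
Context {R : realType} {disp : measure_display} {Om : measurableType disp}.
Variable P : probability Om R.
Local Notation pr := (pr P).
Local Notation C := R[i].

Lemma exists_RV {dE} {E : measurableType dE} (f : Om -> E) : measurable_fun setT f ->
  exists X : {RV P >-> E}, forall x, X x = f x.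
Proof. by move=> mf; exists (mfun_Sub (mem_set mf) : {RV P >-> E}). Qed.

Lemma measurable_mx_set1 m n (c : 'M[C]_(m, n)) : measurable [set c].
Proof.
rewrite [X in measurable X](_ : _ = [set z | mxnorm (z - c) <= 0]); last first.
  apply/seteqP; split => z /=; first by move->; rewrite subrr mxnorm0.
  move=> h; apply/eqP; rewrite -subr_eq0; apply/eqP/mxnorm_eq0/eqP.
  by rewrite eq_le h mxnorm_ge0.
apply: measurable_le; apply: measurable_mxnorm; apply: measurable_mxB; last exact: measurable_cst.
exact: measurable_id.
Qed.

Lemma dirac_degenerateP m n (X : Om -> 'M[C]_(m, n)) : measurable_fun setT X ->
  dirac_degenerate P X <-> exists c, {ae P, forall x, X x = c}.
Proof.
move=> mX; split=> [[c hc]|[c hc]]; exists c.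
  have mS : measurable (X @^-1` [set c]).
    by have := mX measurableT _ (measurable_mx_set1 c); rewrite setTI.
  have : pr (~` (X @^-1` [set c])) = 0.
    rewrite prC // /pr hc; last exact: measurable_mx_set1.
    by rewrite diracE mem_set //= subrr.
  move/(ae_of_pr0 (measurableC mS)); apply: filterS => x; exact: contrapT.
move=> A mA; rewrite diracE.
have mS : measurable (X @^-1` A) by have := mX measurableT _ mA; rewrite setTI.
have [cA|cA] := pselect (A c).
  rewrite mem_set //=; transitivity (pr (X @^-1` A))%:E; first exact: prE.
  by rewrite (pr_ae1 mS) //; apply: filterS hc => x /= ->.
rewrite memNset //=; apply: measure_negligible => //.
by apply: negligibleS hc => x /= h hx; apply: cA; rewrite -hx.
Qed.

Context {dE : measure_display} {E : measurableType dE}.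

Lemma iid_map dF (F : measurableType dF) (phi : E -> F) (Z : int -> {RV P >-> E})
    (X : int -> {RV P >-> F}) : measurable_fun setT phi ->
  (forall t x, X t x = phi (Z t x)) -> iid Z -> iid X.
Proof.
move=> mphi hX [ind id].
have pre t A : X t @^-1` A = Z t @^-1` (phi @^-1` A).
  by apply/funext => x /=; rewrite hX.
have mpre A : measurable A -> measurable (phi @^-1` A).
  by move=> mA; have := mphi measurableT _ mA; rewrite setTI.
split=> [ts A uts mA|t A mA]; last by rewrite !pre; exact/id/mpre.
under eq_bigr do rewrite pre.
rewrite -ind // => [|t]; last exact: mpre.
by congr (P _); apply/seteqP; split => x h t /h; rewrite /= hX.
Qed.

End random_variables.

Section innovations.
Context {R : realType} {disp : measure_display} {Om : measurableType disp}.
Variable P : probability Om R.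
Local Notation pr := (pr P).
Local Notation C := R[i].
Variables (d : nat) (W : int -> {RV P >-> 'cV[C]_d}).
Hypothesis iidW : iid W.

Let mW t : measurable_fun setT (W t). Proof. exact: measurable_funPT. Qed.

(** Two independent copies that agree almost surely have a law with values 0
and 1 only: p = P(X in B, X' in B) = p ^ 2. *)
Lemma lag0_const (rho : 'rV[C]_d) :
  (forall c : R, 0 < c -> pr [set x | c < normc ((rho *m (W 0 x - W 1 x)) 0 0)] = 0) ->
  exists c, {ae P, forall x, rho *m W 0 x = c}.
Proof.
move=> h0; have mR t : measurable_fun setT (fun x => rho *m W t x) by exact: measurable_mulmx.
have eqW : {ae P, forall x, (rho *m W 0 x) 0 0 = (rho *m W 1 x) 0 0}.
  have hn n : {ae P, forall x, normc ((rho *m (W 0 x - W 1 x)) 0 0) <= n.+1%:R^-1}.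
    have mE : measurable [set x | n.+1%:R^-1 < normc ((rho *m (W 0 x - W 1 x)) 0 0)].
      apply: measurable_gt; apply: measurable_normc_mx; apply: measurable_mulmx.
      exact: measurable_mxB.
    have := ae_of_pr0 mE (h0 _ (_ : 0 < n.+1%:R^-1)); rewrite invr_gt0 ltr0n => /(_ isT).
    by apply: filterS => x /= /negP; rewrite -leNgt.
  apply: filterS (ae_foralln hn) => x hx; apply/eqP; rewrite -subr_eq0 -normc_eq0.
  rewrite eq_le normc_ge0 andbT; apply/ler_addgt0Pr => e e0; rewrite add0r.
  have [k hk] : exists k : nat, k.+1%:R^-1 < e.
    exists (Num.truncn e^-1); rewrite invf_plt ?posrE //; exact: truncnS_gt.
  apply: le_trans (ltW hk); have := hx k; rewrite mulmxBr.
  by rewrite [X in normc X <= _ -> _]mxE [X in normc (_ + X) <= _ -> _]mxE.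
have real_const (g : C -> R) :
    (forall f : 'cV[C]_d -> 'M[C]_1, measurable_fun setT f -> measurable_fun setT (fun x => g (f x 0 0))) ->
    exists c, {ae P, forall x, g ((rho *m W 0 x) 0 0) = c}.
  move=> mg; pose phi (z : 'cV[C]_d) := g ((rho *m z) 0 0).
  have mphi : measurable_fun setT phi by apply: mg; exact: measurable_mulmx.
  have mf t : measurable_fun setT (fun x => phi (W t x)) by exact: measurableT_comp mphi (mW t).
  apply: (zero_one_const (mf 0)) => r.
  pose B := [set z | r < phi z]; have mB : measurable B by exact: measurable_gt.
  pose p := pr [set x | r < phi (W 0 x)].
  have mE t : measurable [set x | r < phi (W t x)] by exact: measurable_gt (mf t).
  have : p = p * p.
    transitivity (pr ([set x | r < phi (W 0 x)] `&` [set x | r < phi (W 1 x)])).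
      apply/eqP; rewrite eq_le; apply/andP; split; apply: pr_ae_le => //; try exact: measurableI.
        by apply: filterS eqW => x hx /= h; split => //; move: h; rewrite /phi /= hx.
      by apply: aeW => x [].
    have := iidW.1 [:: 0; 1] (fun=> B) isT (fun=> mB).
    rewrite !big_cons big_nil mule1 (iidW.2 1 B mB) => h.
    apply: EFin_inj; rewrite EFinM; transitivity (P (\bigcap_(t in [set` [:: 0; 1]]) (W t @^-1` B))).
      rewrite -prE; last exact: measurableI.
      congr (P _); apply/seteqP; split=> x.
        by move=> [h1 h2] t /=; rewrite !inE => /orP[] /eqP ->.
      by move=> hx; split; apply: hx; rewrite /= !inE.
    by rewrite h; congr (_ * _)%E; exact: (prE P (mE 0)).
  move=> pp; have /eqP : p * (1 - p) = 0 by rewrite mulrBr mulr1 -pp subrr.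
  by rewrite mulf_eq0 => /orP[/eqP|]; [left|rewrite subr_eq0 => /eqP; right].
have [a ha] := real_const (@complex.Re R) (fun f mf => measurable_mx_Re 0 0 mf).
have [b hb] := real_const (@complex.Im R) (fun f mf => measurable_mx_Im 0 0 mf).
exists (const_mx (a +i* b)%C); apply: filterS2 ha hb => x h1 h2.
apply/matrixP => i j; rewrite (ord1 i) (ord1 j) [RHS]mxE -h1 -h2.
by case: ((rho *m W 0 x) 0 0).
Qed.

End innovations.

Section degenerate_part.
Local Open Scope sesquilinear_scope.
Context {R : realType} {disp : measure_display} {Om : measurableType disp}.
Variable P : probability Om R.
Local Notation pr := (pr P).
Local Notation C := R[i].
Variables (d : nat) (Z : int -> {RV P >-> 'cV[C]_d}).
Hypothesis iidZ : iid Z.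
Variables (K : set 'cV[C]_d) (s : nat) (U : 'M[C]_d).
Hypothesis KE : K = degenerate_directions (Z 0).
Hypothesis sd : (s <= d)%N.
Hypothesis UU : U^t* *m U = 1%:M.
Hypothesis UK : [set U *m x | x in K] =
  [set vstack (0 : 'cV[C]_s) v | v in [set: 'cV[C]_(d - s)]].

Let mZ t : measurable_fun setT (Z t). Proof. exact: measurable_funPT. Qed.
Let UU' : U *m U^t* = 1%:M. Proof. exact: mulmx1C. Qed.

(** For a in K the variable a^* Z_0 is constant, and U a runs through the unit vectors
of the last d - s coordinates; by identity of laws the constant is the same at
all times. *)
Lemma degenerate_tail_const :
  exists u : 'cV[C]_(d - s), forall t, {ae P, forall x,
    U *m Z t x = vstack (pid_mx s *m (U *m Z t x)) u}.
Proof.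
have hk (k : 'I_(d - s)) : exists c : C, forall t (i : 'I_d), (i = s + k :> nat)%N ->
    {ae P, forall x, (U *m Z t x) i 0 = c}.
  have : [set U *m x | x in K] (vstack 0 (delta_mx k 0)) by rewrite UK; exists (delta_mx k 0).
  move=> [a Ka Ua]; move: Ka; rewrite KE => /dirac_degenerateP.
  have mA t : measurable_fun setT (fun x => a ^t* *m Z t x) by exact: measurable_mulmx.
  move=> /(_ (mA 0)) [c hc]; exists (c 0 0) => t i hi.
  have key x : (U *m Z t x) i 0 = (a^t* *m Z t x) 0 0.
    have -> : a^t* *m Z t x = (U *m a)^t* *m (U *m Z t x).
      by rewrite trmx_mul map_mxM mulmxA -(mulmxA _ _ U) UU mulmx1.
    have lowE l : ((lower_mx d s *m delta_mx k 0 : 'cV[C]_d)^t*) 0 l = (l == s + k :> nat)%N%:R.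
      by rewrite -colE !mxE; case: eqP => _; rewrite ?rmorph1 ?rmorph0.
    rewrite Ua vstackE // mulmx0 add0r [RHS]mxE (bigD1 i) //= big1 ?addr0.
      by rewrite lowE hi eqxx mul1r.
    move=> l /eqP li; rewrite lowE; case: eqP => [h|_]; last by rewrite mul0r.
    by exfalso; apply: li; apply/val_inj; rewrite /= h hi.
  pose B := [set z : 'cV[C]_d | (a^t* *m z) = c].
  have mB : measurable (~` B).
    apply: measurableC; have mt : measurable_fun setT (fun z : 'cV[C]_d => a^t* *m z).
      by apply: measurable_mulmx; exact: measurable_id.
    by have := mt measurableT _ (measurable_mx_set1 c); rewrite setTI.
  have : P (Z t @^-1` (~` B)) = 0%E.
    rewrite iidZ.2 //; apply: measure_negligible; last by [].
    by have := mZ 0 measurableT mB; rewrite setTI; exact.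
  move=> h0; exists (Z t @^-1` (~` B)); split => //.
    by have := mZ t measurableT mB; rewrite setTI; exact.
  by move=> x /= hx hB; apply: hx; rewrite key hB.
have /choice[c hc] := hk; exists (\col_k c k) => t.
have : {ae P, forall x, forall n, forall (k : 'I_(d - s)) (i : 'I_d), k = n :> nat ->
    (i = s + k :> nat)%N -> (U *m Z t x) i 0 = c k}.
  apply: ae_foralln => n; case: (ltnP n (d - s)) => [nd|dn]; last first.
    by apply: aeW => x k i kn; have := ltn_ord k; lia.
  have snd : (s + n < d)%N by lia.
  have := hc (Ordinal nd) t (Ordinal snd) erefl; apply: filterS => x hx k i kn hi.
  have -> : k = Ordinal nd by exact/val_inj.
  by have -> : i = Ordinal snd by apply/val_inj; rewrite /= hi kn.
apply: filterS => x hx; apply: vstack_split => // k i hi.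
by rewrite mxE; exact: hx.
Qed.

(** If rho U Z_0 is constant then (rho U)^* lies in K, so that rho^*, its image under U,
is supported on the last d - s coordinates. *)
Lemma const_upper0 (rho : 'rV[C]_d) (c : 'M[C]_1) :
  {ae P, forall x, rho *m (U *m Z 0 x) = c} -> rho *m (pid_mx s : 'M[C]_d) = 0.
Proof.
move=> hc; pose a : 'cV[C]_d := (rho *m U)^t*.
have aE : a^t* = rho *m U by apply/matrixP => i j; rewrite /a; move: (rho *m U) => B; rewrite !mxE conjCK.
have Ka : K a.
  rewrite KE; apply/dirac_degenerateP; first exact: measurable_mulmx.
  by exists c; apply: filterS hc => x; rewrite mulmxA -aE.
have : [set U *m x | x in K] (U *m a) by exists a.
rewrite UK => -[v _ hv].
have e1 : rho^t* = vstack 0 v.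
  by rewrite hv /a trmx_mul map_mxM mulmxA UU' mul1mx.
have e2 : (pid_mx s : 'M[C]_d) *m rho^t* = 0.
  by rewrite e1 vstackE // mulmx0 add0r mulmxA pid_lower // mul0mx.
have := congr1 (fun A : 'cV[C]_d => A^t*) e2; rewrite trmx_mul map_mxM.
rewrite tr_pid_mx map_pid_mx trmx0 map_mx0.
by have -> : rho^t*^t* = rho by apply/matrixP => i j; rewrite !mxE conjCK.
Qed.

End degenerate_part.

(** * Poles on the unit circle *)

Section unit_circle_roots.
Context {F : fieldType}.
Implicit Types (c : F) (r : {poly F}).

(** The quotient of X^n - c^n by X - c. *)
Definition geom_poly n c : {poly F} := \poly_(i < n) c ^+ (n.-1 - i).

Lemma geom_polyE n c : ('X - c%:P) * geom_poly n c = 'X^n - (c ^+ n)%:P.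
Proof.
apply: oppr_inj; rewrite opprB polyC_exp subrXX -mulNr opprB; congr (_ * _).
rewrite /geom_poly poly_def; apply: eq_bigr => i _.
by rewrite -mul_polyC polyC_exp.
Qed.

Lemma coef_lag_factor n k a r l : (l < n)%N ->
  (('X^n - a%:P) ^+ k * r)`_l = (- a) ^+ k * r`_l.
Proof.
move=> ln; elim: k r => [|k IHk] r; first by rewrite !mul1r.
rewrite exprSr -mulrA IHk mulrBl coefB coefXnM ln mul_polyC coefZ sub0r.
by rewrite exprSr -mulrA mulNr.
Qed.

(** Away from both ends of the filter the coefficients of G R are those of the
geometric series with ratio c: multiples of R.[c] by powers of c. *)
Lemma coef_geom_mul n c r l : (size r <= l < n)%N ->
  (geom_poly n c * r)`_l = c ^+ (n.-1 - l) * r.[c].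
Proof.
move=> /andP[rl ln]; rewrite coefMr (horner_coef_wide c (leqW rl)) mulr_sumr.
apply: eq_bigr => e _; rewrite coef_poly (leq_ltn_trans (leq_subr _ _) ln).
have el := ltn_ord e.
have -> : (n.-1 - (l - e) = n.-1 - l + e)%N by lia.
by rewrite exprD -mulrA; congr (_ * _); rewrite mulrC.
Qed.

End unit_circle_roots.

Section necessity.
Context {R : realType} {disp : measure_display} {Om : measurableType disp}.
Variable P : probability Om R.
Local Notation C := R[i].
Variables (d m s : nat) (W : int -> {RV P >-> 'cV[C]_d}).
Hypothesis iidW : iid W.

Let mW t : measurable_fun setT (W t). Proof. exact: measurable_funPT. Qed.
Let mu := noise_law P mW.
Let mu_perm := noise_law_perm mW iidW.1 iidW.2.
Let mu_groups := noise_law_groups mW iidW.1.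

Hypothesis nondeg : forall rho : 'rV[C]_d,
  (forall c : R, 0 < c -> pr P [set x | c < normc ((rho *m (W 0 x - W 1 x)) 0 0)] = 0) ->
  rho *m (pid_mx s : 'M[C]_d) = 0.

Variables (Y : int -> Om -> 'cV[C]_m) (delta : {poly C}) (N : 'M[{poly C}]_(m, d)).
Variable kappa : 'cV[C]_m.
Hypothesis mY : measurable_process Y.
Hypothesis tightY : tight P Y.
Hypothesis N0 : forall i (j : 'I_d), (s <= j)%N -> N i j = 0.
Hypothesis eqY : {ae P, forall x, forall t,
  mact (delta%:M : 'M[{poly C}]_m) (Y ^~ x) t = mact N (fun u => W u x) t + kappa}.

(** The difference of the filtered equation at two distant times is a sum of
independent symmetric variables, controlled by the filtered solution. *)
Lemma filtered_noise (H : {poly C}) (i : 'I_m) (L : nat) (K e : R) :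
  tails_le P (fun t x => mact ((H * delta)%:M : 'M[{poly C}]_m) (Y ^~ x) t) K e ->
  (forall k, (size (H * N i k)%R <= L)%N) ->
  pr mu (nsum_exceeds L (fun l => \row_k (H * N i k)%R`_l) (K + K)) <= e + e.
Proof.
move=> hF hL; set a := fun l : nat => _; pose G t x := mact ((H * delta)%:M : 'M[{poly C}]_m) (Y ^~ x) t.
have mG : measurable_process G by exact: measurable_mact.
have mE t := measurable_norm_gt K (mG t).
apply: le_trans (lerD (hF 0) (hF L%:Z)); apply: le_trans (prU_le P (mE 0) (mE L%:Z)).
rewrite {1}/pr noise_lawE -/(pr P _).
have mP : measurable ((fun x => W ^~ x) @^-1` (nsum_exceeds L a (K + K))).
  have := measurable_pathZ mW measurableT (@measurable_nsum_exceeds R d L a (K + K)).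
  by rewrite setTI.
apply: pr_ae_le => //; first exact: measurableU.
apply: filterS eqY => x hx; rewrite /nsum_exceeds /= => h.
have Gt t : G t x i 0 = \sum_(l < L) (a l *m W (t - l%:Z) x) 0 0
     + (map_mx (horner^~ 1) (H%:M : 'M[{poly C}]_m) *m kappa) i 0.
  rewrite /G scalar_mxM mactM (eq_mact _ _ hx) mactDr -mactM mact_cst mxE; congr (_ + _).
  rewrite mxE; under eq_bigr => k _.
    rewrite (pact_widen _ _ (_ : size ((H%:M *m N) i k) <= L)%N); last by rewrite mul_scalar_mx mxE.
    over.
  rewrite exchange_big /=; apply: eq_bigr => l _; rewrite mxE; apply: eq_bigr => k _.
  by rewrite mul_scalar_mx !mxE.
have e1 : nsum L a (W ^~ x) 0 0 = (G 0 x - G L%:Z x) i 0.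
  rewrite [RHS]mxE [X in _ + X]mxE !Gt opprD addrACA subrr addr0 /nsum summxE -sumrB.
  apply: eq_bigr => l _; rewrite /lagdiff mulmxBr [LHS]mxE [X in _ + X]mxE.
  by rewrite sub0r.
apply: contrapT => /not_orP[/negP h1 /negP h2]; rewrite -!leNgt in h1 h2.
move: h; apply/negP; rewrite -leNgt e1; apply: le_trans (normc_le_mxnorm _ _ _) _.
by apply: le_trans (mxnormD _ _) _; rewrite mxnormN lerD.
Qed.

(** Multiplying by G ^ (k + 1), with (X - c) G = X ^ n - c ^ n, turns k + 1 of the
factors X - c of delta into differences over n time steps, at bounded cost, while
about n of the noise coefficients become unimodular multiples of one vector v. *)
Lemma circle_zero_divides (i : 'I_m) (c : C) k : normc c = 1 ->
  ('X - c%:P) ^+ k %| delta -> forall j, ('X - c%:P) ^+ k %| N i j.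
Proof.
move=> c1; elim: k => [|k IHk] hd j; first by rewrite expr0 dvd1p.
have dk : ('X - c%:P) ^+ k %| delta by apply: dvdp_trans hd; rewrite exprS dvdp_mull.
have {}IHk := IHk dk.
pose r j := N i j %/ ('X - c%:P) ^+ k.
have rE l : N i l = r l * ('X - c%:P) ^+ k by rewrite divpK.
pose d'' := delta %/ ('X - c%:P) ^+ k.+1.
have dE : delta = d'' * ('X - c%:P) ^+ k.+1 by rewrite divpK.
pose v : 'rV[C]_d := \row_l (r l).[c].
(* by induction (X - c)^k divides the row i of N; the quotients vanish at c iff v = 0 *)
suff v0 : v = 0.
  have rj : root (r j) c by rewrite rootE; have := congr1 (fun w : 'rV_d => w 0 j) v0; rewrite !mxE => ->.
  by rewrite rE exprS dvdp_mul2r ?expf_neq0 ?polyXsubC_eq0 // dvdp_XsubCl.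
have vpid : v *m (pid_mx s : 'M[C]_d) = v.
  apply/matrixP => a b; rewrite mxE (bigD1 b) //= big1 ?addr0 => [|l lb]; last first.
    by rewrite [pid_mx _ _ _]mxE (negbTE (lb : l != b :> nat)) mulr0.
  rewrite [pid_mx _ _ _]mxE eqxx /=; case: ltnP => hb; first by rewrite mulr1.
  by rewrite mulr0 mxE /r N0 // div0p horner0.
rewrite -vpid; apply: nondeg => c0 c0_gt0.
transitivity (lag_tail mu v c0); first by rewrite /lag_tail /pr noise_lawE.
pose X t x := mact (d''%:M : 'M[{poly C}]_m) (Y ^~ x) t.
have mX : measurable_process X by exact: measurable_mact.
have tX : tight P X by exact: tight_mact.
have e0 : 0 < (8 * 2 ^+ k.+1)^-1 :> R by rewrite invr_gt0 mulr_gt0 ?exprn_gt0.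
have [K1 hK1] := tX _ e0.
pose K := 2 ^+ k.+1 * K1.
apply: (@unit_multiples_degenerate R d mu mu_perm mu_groups v (K + K) c0) => // n.
(* beyond the degrees of the r l, products with the geometric polynomial are explicit *)
pose q0 := \max_l size (r l).
pose n' := (q0 + n)%N.
pose H := geom_poly n' c ^+ k.+1.
pose L := maxn n' (\max_l size (H * N i l)%R).
exists L, q0, (fun l => \row_k (H * N i k)%R`_l),
  (fun l => (- (c ^+ n')) ^+ k * c ^+ (n'.-1 - l)); split.
- by rewrite /L leq_max leqnn.
- move=> l hl; split; first by rewrite normcM !normcX normcN normcX c1 !expr1n mulr1.
  apply/rowP => b; rewrite !mxE rE.
  have -> : H * (r b * ('X - c%:P) ^+ k) = ('X^n' - (c ^+ n')%:P) ^+ k * (geom_poly n' c * r b).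
    by rewrite -geom_polyE exprMn /H exprS; ring.
  rewrite coef_lag_factor; last by case/andP: hl.
  rewrite coef_geom_mul ?mulrA //; case/andP: hl => h1 h2; rewrite h2 andbT.
  by apply: leq_trans h1; exact: (leq_bigmax (F := fun l => size (r l))).
have -> : 4^-1 = 2 ^+ k.+1 * (8 * 2 ^+ k.+1)^-1 + 2 ^+ k.+1 * (8 * 2 ^+ k.+1)^-1 :> R.
  have : 2 ^+ k.+1 != 0 :> R by rewrite expf_neq0.
  by move: (2 ^+ k.+1) => y y0; field.
apply: filtered_noise => [|l]; last first.
  by rewrite /L leq_max; apply/orP; right; exact: (leq_bigmax (F := fun l => size (H * N i l)%R)).
(* H delta = (X^n' - c^n')^(k + 1) d'' acts on Y with at most 2^(k + 1) terms of size 1 *)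
pose rs : seq (C * C) := nseq k.+1 (1, c ^+ n').
have HE : H * delta = (\prod_(ab <- rs) (ab.1 *: 'X^n' - ab.2%:P)) * d''.
  rewrite big_nseq iter_mulr_1 /= scale1r -geom_polyE exprMn /H dE; ring.
have := @tails_le_filter _ _ _ P _ X n' rs _ _ mX _ hK1.
rewrite size_nseq => h t; rewrite HE scalar_mxM.
under eq_fun do rewrite mactM.
apply: h; apply/allP => ab /nseqP[-> _].
by apply/andP; split; rewrite [X in normc X]/= ?normc1 // normcX c1 expr1n.
Qed.

End necessity.

(** * Summable tails of the Laurent coefficients *)

Section hyperbolic_filter.
Context {R : realType}.
Local Notation C := R[i].
Implicit Types (a : int -> C) (rs : seq C).

(** Coefficients (alpha, beta) of the factor alpha B^n - beta attached to a root:
the normalization keeps both of modulus at most 1. *)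
Definition lag_factor n (l : C) : C * C :=
  if normc l < 1 then (1, l ^+ n) else ((l ^+ n)^-1, 1).

Definition lag_filter n rs : {poly C} :=
  \prod_(l <- rs) ((lag_factor n l).1 *: 'X^n - (lag_factor n l).2%:P).

Lemma lag_factor_le1 n l : (normc (lag_factor n l).1 <= 1) && (normc (lag_factor n l).2 <= 1).
Proof.
rewrite /lag_factor; case: ltP => h; apply/andP; split; rewrite [X in normc X]/= ?normc1 //.
  by rewrite normcX exprn_ile1 ?normc_ge0 // ltW.
by rewrite normcV normcX invf_le1 ?exprn_ege1 // exprn_gt0 // (lt_le_trans _ h).
Qed.

Lemma lag_filter_dvd n rs : exists H, H * \prod_(l <- rs) ('X - l%:P) = lag_filter n rs.
Proof.
elim: rs => [|l rs [H hH]]; first by exists 1; rewrite /lag_filter !big_nil mulr1.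
exists (H * ((lag_factor n l).1 *: geom_poly n l)).
rewrite /lag_filter !big_cons -/(lag_filter n rs) -hH.
have -> : (lag_factor n l).1 *: 'X^n - (lag_factor n l).2%:P =
    ('X - l%:P) * ((lag_factor n l).1 *: geom_poly n l).
  rewrite -scalerAr geom_polyE scalerBr; congr (_ - _); rewrite -mul_polyC -polyCM.
  rewrite /lag_factor; case: ltP => h /=; rewrite ?mul1r // mulVf // expf_neq0 //.
  by rewrite -normc_eq0 gt_eqF // (lt_le_trans _ h).
by ring.
Qed.

Lemma lag_filter_cons n l rs a k : pact (lag_filter n (l :: rs)) a k =
  (lag_factor n l).1 * pact (lag_filter n rs) a (k - n%:Z) -
  (lag_factor n l).2 * pact (lag_filter n rs) a k.
Proof.
rewrite /lag_filter big_cons -!/(lag_filter n rs) pactM pactD.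
rewrite -polyCN (pactC (- _)) mulNr; congr (_ + _).
have h e t y : pact ('X^e) y t = y (t - e%:Z) :> C.
  elim: e y t => [|e IHe] y t; first by rewrite pact1 subr0.
  by rewrite exprSr pactMX IHe; congr y; lia.
by rewrite -mul_polyC pactM pactC h.
Qed.

Lemma eq_cvgC (u v : nat -> C) (l : C) : u =1 v -> cvgC u l -> cvgC v l.
Proof. by move/funext ->. Qed.

Lemma cvgC_small (u : nat -> C) (v : nat -> C) : (forall n, normc (u n) <= normc (v n)) ->
  cvgC v 0 -> cvgC u 0.
Proof.
move=> uv hv; apply: (cvgC_le (x := fun n => normc (v n))) => [n|]; first by rewrite subr0.
by move: hv; rewrite /cvgC; under eq_fun do rewrite subr0.
Qed.

Lemma cvgC_geo (u : nat -> C) (K rho : R) : 0 <= rho < 1 ->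
  (forall n, normc (u n) <= K * rho ^+ n) -> cvgC u 0.
Proof.
move=> /andP[r0 r1] hu; apply: (cvgC_le (x := fun n => K * rho ^+ n)) => [n|].
  by rewrite subr0.
by apply: cvg_geometric; rewrite ger0_norm.
Qed.

(** Each root inside the unit disc moves the dominant lag of the filter by n. *)
Definition lag_shift rs : nat := count (fun l => normc l < 1) rs.

Definition lag_sign rs : C := \prod_(l <- rs) (if normc l < 1 then 1 else -1).

Lemma normc_lag_sign rs : normc (lag_sign rs) = 1.
Proof.
rewrite /lag_sign; elim: rs => [|l rs IHrs]; first by rewrite big_nil normc1.
by rewrite big_cons normcM IHrs mulr1; case: ifP => _; rewrite ?normcN normc1.
Qed.

(** Expanding the product, the terms of lag n E see the coefficient a (j + n (D - E)),
with D the number of roots inside the unit disc. It dies out as n grows unless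
E = D, and among the subsets of D factors only that of the roots inside the disc
keeps its weight. So the filter is concentrated at the single lag n D. *)
Lemma lag_filter_limit rs a : geo a -> [/\
  exists B : R, forall n k, normc (pact (lag_filter n rs) a k) <= B,
  forall j, cvgC (fun n => pact (lag_filter n rs) a (j + n%:Z * (lag_shift rs)%:Z)) (lag_sign rs * a j) &
  forall j (e : nat), cvgC (fun n =>
    pact (lag_filter n rs) a (j + n%:Z * (lag_shift rs)%:Z - n%:Z * e.+1%:Z)) 0].
Proof.
move=> ga; elim: rs => [|l rs [[B hB] h2 h3]].
  have e0 n k : pact (lag_filter n [::]) a k = a k.
    by rewrite /lag_filter big_nil pact1.
  split.
  - have [K [rho [K0 /andP[r0 r1] hK]]] := (geoP a).1 ga; exists K => n k; rewrite e0.
    by apply: le_trans (hK k) _; rewrite ler_piMr // exprn_ile1 // ltW.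
  - move=> j; under eq_fun do rewrite e0 mulr0 addr0.
    by rewrite /lag_sign big_nil mul1r; exact: cvgC_cst.
  - move=> j e; have [K [rho [K0 /andP[r0 r1] hK]]] := (geoP _).1 (geo_shift j ga).
    apply: (@cvgC_geo _ K rho) => [|n]; first by rewrite (ltW r0).
    rewrite e0 mulr0 addr0 addrC; apply: le_trans (hK _) _; rewrite ler_wpM2l //.
    by apply: ler_wiXn2l; [exact: ltW|exact: ltW|lia].
have B0 : 0 <= B by apply: le_trans (hB 0%N 0); exact: normc_ge0.
have bnd : exists B : R, forall n k, normc (pact (lag_filter n (l :: rs)) a k) <= B.
  exists (B + B) => n k.
  rewrite lag_filter_cons; have /andP[f1 f2] := lag_factor_le1 n l.
  apply: le_trans (le_normcD _ _) _; rewrite normcN !normcM; apply: lerD.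
    by apply: le_trans (ler_pM _ _ f1 (hB _ _)) _; rewrite ?normc_ge0 ?mul1r.
  by apply: le_trans (ler_pM _ _ f2 (hB _ _)) _; rewrite ?normc_ge0 ?mul1r.
rewrite /lag_sign big_cons -/(lag_sign rs) /lag_shift /= -/(lag_shift rs).
have [l1|l1] := ltP (normc l) 1.
- have small (k : nat -> int) : cvgC (fun n => - l ^+ n * pact (lag_filter n rs) a (k n)) 0.
    apply: (@cvgC_geo _ B (normc l)) => [|n]; first by rewrite normc_ge0.
    by rewrite normcM normcN normcX mulrC ler_wpM2r ?exprn_ge0 ?normc_ge0.
  split => // j.
    rewrite mul1r -[lag_sign rs * a j]addr0; apply: eq_cvgC (cvgCD (h2 j)
      (small (fun n => j + n%:Z * (1 + lag_shift rs)%N%:Z))) => n.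
    rewrite lag_filter_cons /lag_factor l1 /= mul1r mulNr; congr (pact _ _ _ - _); lia.
  move=> e; rewrite -[X in cvgC _ X]addr0; apply: eq_cvgC (cvgCD (h3 j e)
      (small (fun n => j + n%:Z * (1 + lag_shift rs)%N%:Z - n%:Z * e.+1%:Z))) => n.
  rewrite lag_filter_cons /lag_factor l1 /= mul1r (mulNr (l ^+ n)); congr (pact _ _ _ - _); lia.
have far j e : cvgC (fun n => (l ^+ n)^-1 *
     pact (lag_filter n rs) a (j + n%:Z * (lag_shift rs)%:Z - n%:Z * e.+1%:Z)) 0.
  apply: (cvgC_small _ (h3 j e)) => n; rewrite normcM ler_piMl ?normc_ge0 //.
  have := lag_factor_le1 n l; rewrite /lag_factor ltNge l1 /= => /andP[h _]; exact: h.
rewrite add0n; split => // j.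
  rewrite mulN1r -[X in cvgC _ X]add0r mulNr -mulN1r.
  apply: eq_cvgC (cvgCD (far j 0%N) (cvgCZ (-1) (h2 j))) => n.
  rewrite lag_filter_cons /lag_factor ltNge l1 /= mul1r mulN1r; congr (_ * pact _ _ _ - _); lia.
move=> e; rewrite -[X in cvgC _ X]addr0 -[X in cvgC _ (_ + X)](mulr0 (-1)).
apply: eq_cvgC (cvgCD (far j e.+1) (cvgCZ (-1) (h3 j e))) => n.
rewrite lag_filter_cons /lag_factor ltNge l1 /= mul1r mulN1r; congr (_ * pact _ _ _ - _); lia.
Qed.

End hyperbolic_filter.

Section summable_tails.
Context {R : realType} {disp : measure_display} {Om : measurableType disp}.
Variable P : probability Om R.
Local Notation C := R[i].
Variables (d m : nat) (W : int -> {RV P >-> 'cV[C]_d}).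
Hypothesis iidW : iid W.

Let mW t : measurable_fun setT (W t). Proof. exact: measurable_funPT. Qed.
Let mu := noise_law P mW.
Let mu_perm := noise_law_perm mW iidW.1 iidW.2.
Let mu_groups := noise_law_groups mW iidW.1.

Lemma lag_tailE (rho : 'rV[C]_d) c :
  lag_tail mu rho c = pr P [set x | c < normc ((rho *m (W 0 x - W 1 x)) 0 0)].
Proof. by rewrite /lag_tail /pr noise_lawE. Qed.

Lemma lag_tailZ (a : C) rho c : normc a = 1 -> lag_tail mu (a *: rho) c = lag_tail mu rho c.
Proof.
move=> a1; rewrite !lag_tailE; congr (pr P _); apply/funext => x /=; congr (_ < _).
by rewrite -scalemxAl mxE normcM a1 mul1r.
Qed.

Let mL (rho : 'rV[C]_d) c : measurable [set x | c < normc ((rho *m (W 0 x - W 1 x)) 0 0)].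
Proof.
apply: measurable_gt; apply: measurable_normc_mx; apply: measurable_mulmx.
exact: measurable_mxB.
Qed.

Lemma lag_tail_mono rho c1 c2 : c1 <= c2 -> lag_tail mu rho c2 <= lag_tail mu rho c1.
Proof. by move=> h; rewrite !lag_tailE; apply: pr_mono => // x /=; exact: le_lt_trans. Qed.

Lemma lag_tail_small (e : R) : 0 < e -> exists2 eta : R, 0 < eta &
  forall rho, mxnorm rho <= eta -> lag_tail mu rho 1 <= e.
Proof.
move=> e0; have mD : measurable_fun setT (fun x => mxnorm (W 0 x - W 1 x)).
  by apply: measurable_mxnorm; exact: measurable_mxB.
have [n hn] := pr_tail P mD e0; exists (n.+1%:R^-1); first by rewrite invr_gt0.
move=> rho hr; rewrite lag_tailE; apply: le_trans hn; apply: pr_mono => //.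
  exact: measurable_gt.
move=> x /= h; have := le_trans (normc_le_mxnorm _ 0 0) (mxnormM rho (W 0 x - W 1 x)).
move=> /(lt_le_trans h) {}h; rewrite ltNge; apply/negP => hx.
move: h; apply/negP; rewrite -leNgt.
apply: le_trans (ler_pM (mxnorm_ge0 _) (mxnorm_ge0 _) hr hx) _.
by rewrite mulrC ler_pdivrMr // mul1r ler_nat.
Qed.

(** Rows that are close have close tails; this absorbs the error of the limit in
lag_filter_limit. *)
Lemma lag_tail_add (r1 r2 : 'rV[C]_d) K : lag_tail mu r1 (K + 1) <= lag_tail mu r2 K + lag_tail mu (r1 - r2) 1.
Proof.
rewrite !lag_tailE; apply: le_trans (prU_le P (mL _ _) (mL _ _)); apply: pr_mono => //.
  exact: measurableU.
move=> x /= h; apply: contrapT => /not_orP[/= /negP h1 /negP h2].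
rewrite -leNgt in h1; rewrite -leNgt in h2; move: h; apply/negP; rewrite -leNgt.
have e : r1 = r2 + (r1 - r2) by rewrite addrC subrK.
rewrite e mulmxDl mxE.
by apply: le_trans (le_normcD _ _) _; rewrite lerD.
Qed.

Section from_solution.
Variables (Y : int -> Om -> 'cV[C]_m) (delta : {poly C}) (N : 'M[{poly C}]_(m, d)).
Variables (kappa : 'cV[C]_m) (M : int -> 'M[C]_(m, d)).
Hypothesis delta0 : delta != 0.
Hypothesis mY : measurable_process Y.
Hypothesis tightY : tight P Y.
Hypothesis eqY : {ae P, forall x, forall t,
  mact (delta%:M : 'M[{poly C}]_m) (Y ^~ x) t = mact N (fun u => W u x) t + kappa}.
Hypothesis geoM : forall i j, geo (fun k => M k i j).
Hypothesis recM : forall k, mact (delta%:M : 'M[{poly C}]_m) M k = mxpolyseqz N k.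

(** The filter that is concentrated at one lag turns a long window of the Laurent
coefficients into coefficients of a finite noise sum that stays bounded in
probability. *)
Lemma lag_tails_summable (i : 'I_m) : exists2 K : R, 0 < K &
  forall b : nat, \sum_(k < b.*2) lag_tail mu (row i (M (k%:Z - b%:Z))) K <= 2.
Proof.
have [rs dE] := closed_field_poly_normal delta.
pose T := size rs.
have e0 : 0 < (8 * 2 ^+ T)^-1 :> R by rewrite invr_gt0 mulr_gt0 ?exprn_gt0.
have [K1 hK1] := tightY e0.
pose K2 := 2 ^+ T * K1; pose K0 := K2 + K2.
have lead0 : lead_coef delta != 0 by rewrite lead_coef_eq0.
have tailsY n : tails_le P (fun t x => mact ((lag_filter n rs)%:M : 'M[{poly C}]_m) (Y ^~ x) t)
    K2 (2 ^+ T * (8 * 2 ^+ T)^-1).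
  have := @tails_le_filter _ _ _ P _ Y n [seq lag_factor n l | l <- rs] _ _ mY _ hK1.
  rewrite size_map /lag_filter big_map; apply.
  by apply/allP => _ /mapP[l _ ->]; exact: lag_factor_le1.
pose D := lag_shift rs; pose sg := lag_sign rs.
exists (`|K0| + 1) => [|b]; first by rewrite ltr_wpDl.
have eps0 : 0 < (b.*2.+1%:R)^-1 :> R by rewrite invr_gt0.
have [eta eta0 heta] := lag_tail_small eps0.
have eta1 : 0 < eta / d.+1%:R by rewrite divr_gt0.
(* a lag n large enough for the filter to be eta-close to its limit on the window *)
have [n hn] : exists n : nat, forall kl : 'I_b.*2 * 'I_d,
    normc (pact (lag_filter n rs) (fun k => M k i kl.2) (kl.1%:Z - b%:Z + n%:Z * D%:Z) -
       sg * M (kl.1%:Z - b%:Z) i kl.2) < eta / d.+1%:R.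
  have : \forall n \near \oo, forall kl : 'I_b.*2 * 'I_d,
    normc (pact (lag_filter n rs) (fun k => M k i kl.2) (kl.1%:Z - b%:Z + n%:Z * D%:Z) -
       sg * M (kl.1%:Z - b%:Z) i kl.2) < eta / d.+1%:R.
    apply: filter_forall => kl; have [_ h _] := lag_filter_limit rs (geoM i kl.2).
    move: (h (kl.1%:Z - b%:Z)) => /cvgrPdist_lt /(_ _ eta1); apply: filterS => n.
    by rewrite sub0r normrN ger0_norm ?normc_ge0.
  by case=> n _ h; exists n; exact: (h n (leqnn n)).
have [H0 hH0] := lag_filter_dvd n rs.
pose H1 := (lead_coef delta)^-1 *: H0.
have hH1 : H1 * delta = lag_filter n rs.
  by rewrite /H1 {2}dE -scalerAl -scalerAr scalerA mulVf // scale1r.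
(* the factor X^b moves the window, which starts at index - b, to nonnegative lags *)
pose H := 'X^b * H1.
pose L := (n * D + b.*2 + \max_l size (H * N i l)%R)%N.
have hL l : (size (H * N i l)%R <= L)%N.
  by apply: leq_trans (leq_addl _ _); exact: (leq_bigmax (F := fun l => size (H * N i l)%R)).
have tH : tails_le P (fun t x => mact ((H * delta)%:M : 'M[{poly C}]_m) (Y ^~ x) t)
    K2 (2 ^+ T * (8 * 2 ^+ T)^-1).
  move=> t; rewrite /H -mulrA hH1 -scale_scalar_mx.
  by under eq_fun do rewrite mactXn; exact: tailsY.
have := filtered_noise mY eqY tH hL.
have -> : 2 ^+ T * (8 * 2 ^+ T)^-1 + 2 ^+ T * (8 * 2 ^+ T)^-1 = 4^-1 :> R.
  have : 2 ^+ T != 0 :> R by rewrite expf_neq0.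
  by move: (2 ^+ T) => y y0; field.
set a := fun l : nat => _ => small.
have sum1 := sum_lag_tail mu_perm mu_groups small.
have aE (k : 'I_b.*2) : a (n * D + k)%N = \row_l pact (lag_filter n rs) (fun k => M k i l)
     (k%:Z - b%:Z + n%:Z * D%:Z).
  apply/rowP => l; rewrite [RHS]mxE mxE -hH1 pactM.
  have -> : forall z, pact H1 (pact delta (fun k => M k i l)) z = polyseqz (H1 * N i l) z.
    move=> z; rewrite -pact_polyseqz; apply: eq_pact => z'.
    by rewrite -mact_scalar recM mxE.
  rewrite /H -mulrA coefXnM; case: ltnP => hb.
    by have -> : k%:Z - b%:Z + n%:Z * D%:Z = Negz (b - (n * D + k)).-1 by lia.
  by have -> : k%:Z - b%:Z + n%:Z * D%:Z = (n * D + k - b)%N%:Z by lia.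
apply: (@le_trans _ _ (\sum_(k < b.*2) (lag_tail mu (a (n * D + k)%N) K0 + (b.*2.+1%:R)^-1))).
  apply: ler_sum => k _; rewrite -(lag_tailZ _ _ (normc_lag_sign rs)).
  apply: le_trans (lag_tail_add _ (a (n * D + k)%N) _) _; apply: lerD.
    by apply: lag_tail_mono; exact: ler_norm.
  apply: heta; rewrite aE /mxnorm big_ord1.
  apply: (@le_trans _ _ (\sum_(l < d) eta / d.+1%:R)).
    by apply: ler_sum => l _; rewrite !mxE normcB ltW //; exact: (hn (k, l)).
  rewrite sumr_const card_ord -[_ *+ d]mulr_natr mulrAC ler_pdivrMr // ler_wpM2l ?ltW //.
  by rewrite ltr_nat.
rewrite big_split /= sumr_const card_ord (_ : 2 = 1 + 1) // lerD //.
  apply: le_trans sum1; apply: (@sum_window _ (fun l => lag_tail mu (a l) K0)) => [l|].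
    exact: pr_ge0.
  exact: leq_addr.
by rewrite -[_ *+ _]mulr_natr mulrC ler_pdivrMr // mul1r ler_nat.
Qed.

Lemma two_point_independence (A B : set 'cV[C]_d) : measurable A -> measurable B ->
  pr P ([set x | A (W 0 x)] `&` [set x | B (W 1 x)]) =
  pr P [set x | A (W 0 x)] * pr P [set x | B (W 0 x)].
Proof.
move=> mA mB; have mp t D : measurable D -> measurable [set x | D (W t x)].
  by move=> mD; have := mW t measurableT mD; rewrite setTI.
have := iidW.1 [:: 0; 1] (fun t => if t == 0 then A else B) isT.
rewrite !big_cons big_nil mule1 /= => h.
apply: EFin_inj; rewrite EFinM -!prE //; last by apply: measurableI; exact: mp.
  rewrite -(iidW.2 1 B mB) -h => [|t]; last by case: ifP.
  congr (P _); apply/seteqP; split=> x.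
    by move=> [h1 h2] t /=; rewrite !inE => /orP[] /eqP ->.
  by move=> hx; split; [have := hx 0|have := hx 1]; apply; rewrite /= !inE.
exact: mp.
exact: mp.
Qed.

(** Desymmetrization: the rows of M_j are bounded, so |X'| = |rho W_1| is at most
beta with probability at least one half for all of them, and then |X| > K + beta forces
|X - X'| > K. *)
Lemma coef_tails_summable : exists K B : R, 0 < K /\
  forall b : nat, \sum_(k < b.*2) pr P [set x | K < mxnorm (M (k%:Z - b%:Z) *m W 0 x)] <= B.
Proof.
have /choice[Ki hKi] : forall i : 'I_m, exists K : R, 0 < K /\
    forall b : nat, \sum_(k < b.*2) lag_tail mu (row i (M (k%:Z - b%:Z))) K <= 2.
  by move=> i; have [K h1 h2] := lag_tails_summable i; exists K.
have [Bm Bm0 hBm] : exists2 Bm : R, 0 <= Bm & forall k, mxnorm (M k) <= Bm.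
  have /choice[b hb] : forall ij : 'I_m * 'I_d, exists b : R, 0 <= b /\
      forall k, normc (M k ij.1 ij.2) <= b.
    move=> ij; have [K [rho [K0 /andP[r0 r1] hK]]] := (geoP _).1 (geoM ij.1 ij.2).
    exists K; split => // k; apply: le_trans (hK k) _.
    by rewrite ler_piMr // exprn_ile1 // ltW.
  exists (\sum_i \sum_j b (i, j)) => [|k].
    by apply: sumr_ge0 => i _; apply: sumr_ge0 => j _; exact: (hb _).1.
  by apply: ler_sum => i _; apply: ler_sum => j _; exact: (hb (i, j)).2.
have mNW : measurable_fun setT (fun x => mxnorm (W 0 x)) by exact: measurable_mxnorm.
have half0 : 0 < 2^-1 :> R by rewrite invr_gt0.
have [beta hbeta] := pr_tail P mNW half0.
have rowE i k x : (row i (M k) *m W 0 x) 0 0 = (M k *m W 0 x) i 0.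
  by rewrite -row_mul mxE.
have mRow i k c : measurable [set x | c < normc ((M k *m W 0 x) i 0)].
  by apply: measurable_gt; apply: measurable_normc_mx; exact: measurable_mulmx.
pose be := Bm * beta%:R.
have desym i k : pr P [set x | Ki i + be < normc ((M k *m W 0 x) i 0)] <=
    2 * lag_tail mu (row i (M k)) (Ki i).
  have msr (f : 'cV[C]_d -> 'M[C]_1) : measurable_fun setT f -> measurable_fun setT (fun z => normc (f z 0 0)).
    by move=> mf; exact: measurable_normc_mx.
  have mr : measurable_fun setT (fun z : 'cV[C]_d => normc ((row i (M k) *m z) 0 0)).
    by apply: msr; apply: measurable_mulmx; exact: measurable_id.
  have := @two_point_independence [set z | Ki i + be < normc ((row i (M k) *m z) 0 0)]
    [set z | mxnorm z <= beta%:R] (measurable_gt _ mr).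
  have mn : measurable_fun setT (fun z : 'cV[C]_d => mxnorm z).
    by apply: measurable_mxnorm; exact: measurable_id.
  move=> /(_ (measurable_le _ mn)) /=.
  have p2 : 2^-1 <= pr P [set x | mxnorm (W 0 x) <= beta%:R].
    rewrite (_ : [set x | _] = ~` [set x | beta%:R < mxnorm (W 0 x)]).
      by rewrite prC; [lra|exact: measurable_gt].
    by apply/seteqP; split => x /=; rewrite leNgt => /negP.
  have -> : [set x | Ki i + be < normc ((row i (M k) *m W 0 x) 0 0)] =
     [set x | Ki i + be < normc ((M k *m W 0 x) i 0)].
    by apply/funext => x /=; rewrite rowE.
  set p := pr P [set x | Ki i + be < _] => h.
  have : p * pr P [set x | mxnorm (W 0 x) <= beta%:R] <= lag_tail mu (row i (M k)) (Ki i).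
    rewrite -h lag_tailE; apply: pr_mono => //.
      apply: measurableI; first exact: mRow.
      exact: (measurable_le _ (measurable_mxnorm (mW 1))).
    move=> x [/= h1 h2]; rewrite ltNge; apply/negP => h3.
    move: h1; apply/negP; rewrite -leNgt -rowE.
    have -> : row i (M k) *m W 0 x = row i (M k) *m (W 0 x - W 1 x) + row i (M k) *m W 1 x.
      by rewrite -mulmxDr subrK.
    rewrite mxE; apply: le_trans (le_normcD _ _) _; apply: lerD => //.
    apply: le_trans (normc_le_mxnorm _ _ _) _; apply: le_trans (mxnormM _ _) _.
    apply: ler_pM => //; try exact: mxnorm_ge0.
    apply: le_trans (hBm k); rewrite /mxnorm big_ord1 (bigD1 i) //=.
    rewrite (eq_bigr (fun j => normc (M k i j))) => [|j _]; last by rewrite mxE.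
    by rewrite lerDl; apply: sumr_ge0 => i' _; apply: sumr_ge0 => j _; exact: normc_ge0.
  have p0 : 0 <= p by exact: pr_ge0.
  nra.
have K0 : 0 < 1 + \sum_i (Ki i + be).
  rewrite ltr_pwDl //; apply: sumr_ge0 => i _; rewrite addr_ge0 ?(ltW (hKi i).1) //.
  by rewrite mulr_ge0.
exists (1 + \sum_i (Ki i + be)), (\sum_(i < m) 4); split => // b.
apply: (@le_trans _ _ (\sum_(k < b.*2) \sum_(i < m) 2 * lag_tail mu (row i (M (k%:Z - b%:Z))) (Ki i))).
  apply: ler_sum => k _; set j := k%:Z - b%:Z.
  case: (posnP m) => [m0|m0].
    have -> : [set x | 1 + \sum_i (Ki i + be) < mxnorm (M j *m W 0 x)] = set0.
      apply/seteqP; split => // x /=; rewrite /mxnorm !big1 ?addr0 ?ltr10 //.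
        by move=> i; have := ltn_ord i; rewrite {2}m0.
      by move=> i; have := ltn_ord i; rewrite {2}m0.
    rewrite /pr measure0; apply: sumr_ge0 => i _; rewrite mulr_ge0 //; exact: pr_ge0.
  pose F (n : nat) := [set x | Ki (insubd (Ordinal m0) n) + be < normc ((M j *m W 0 x) (insubd (Ordinal m0) n) 0)].
  have mF n : measurable (F n) by exact: mRow.
  have insE (i : 'I_m) : insubd (Ordinal m0) (nat_of_ord i) = i by exact: valKd.
  apply: (@le_trans _ _ (\sum_(i < m) pr P (F i))); last first.
    by apply: ler_sum => i _; rewrite /F insE; exact: desym.
  apply: le_trans (pr_bigsetU_le P m mF); apply: pr_mono.
  - by apply: measurable_norm_gt; exact: measurable_mulmx.
  - exact: bigsetU_measurable.
  move=> x /= hx; apply/bigsetU_ordP; apply: contrapT => hn; move: hx; apply/negP; rewrite -leNgt.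
  rewrite addrC (@le_trans _ _ (\sum_i (Ki i + be))) ?lerDl // /mxnorm; apply: ler_sum => i _.
  rewrite big_ord1 leNgt; apply/negP => hi; apply: hn; exists i => //.
  by rewrite /F insE.
rewrite exchange_big /=; apply: ler_sum => i _; rewrite -mulr_sumr.
by rewrite (_ : 4 = 2 * 2) ?ler_pM2l ?(hKi i).2 //; ring.
Qed.

End from_solution.
End summable_tails.

(** * From tails to logarithmic moments *)

Section absolute_convergence.
Context {R : realType}.
Local Notation C := R[i].

Lemma abs_cvg_bounded (V : Type) (N : V -> R) (f : int -> V) : (forall v, 0 <= N v) ->
  abs_cvg N f -> exists n : nat, forall j, N (f j) <= n%:R.
Proof.
move=> N0 hf; have le j : ((N (f j))%:E <= \esum_(k in [set: int]) (N (f k))%:E)%E.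
  rewrite (esumID [set j]) ?setTI ?esum_set1 ?lee_fin // => [|k _]; last by rewrite lee_fin.
  by rewrite leeDl // esum_ge0 // => k _; rewrite lee_fin.
have f0 : (0 <= \esum_(k in [set: int]) (N (f k))%:E)%E by apply: esum_ge0 => k _; rewrite lee_fin.
pose S := fine (\esum_(k in [set: int]) (N (f k))%:E)%E.
exists (Num.truncn S).+1 => j; apply: ltW; apply: le_lt_trans (truncnS_gt S).
by rewrite -lee_fin fineK // ge0_fin_numE.
Qed.

(** Nonnegative sums can be rearranged. *)
Lemma esum_int (a : int -> \bar R) : (forall j, (0 <= a j)%E) ->
  (\esum_(j in [set: int]) a j = \sum_(n <oo) a n%:Z + \sum_(n <oo) a (Negz n))%E.
Proof.
move=> a0; rewrite (esumID (range Posz)) // !setTI.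
have -> : ~` range Posz = range Negz.
  apply/seteqP; split; last by move=> _ [n _ <-] [k _].
  by case=> [n|n] h; [exfalso; apply: h; exists n|exists n].
rewrite !esum_image ?nneseries_esumT //.
  by move=> x y _ _ [].
by move=> x y _ _ [].
Qed.

Lemma ngeo_nneseries (x : nat -> R) : (forall n, 0 <= x n) -> ngeo x ->
  (\sum_(n <oo) (x n)%:E < +oo)%E.
Proof.
move=> x0 [K [rho [K0 /andP[r0 r1] hx]]].
apply: (@le_lt_trans _ _ (K / (1 - rho))%:E); last exact: ltry.
apply: lime_le; first by apply: is_cvg_nneseries => n _ _; rewrite lee_fin.
apply: nearW => n; rewrite sumEFin lee_fin ler_pdivlMr ?subr_gt0 //.
apply: (@le_trans _ _ ((\sum_(0 <= i < n) K * rho ^+ i) * (1 - rho))).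
  by rewrite ler_wpM2r ?subr_ge0 ?(ltW r1) //; apply: ler_sum.
rewrite -mulr_sumr big_mkord -mulrA -[leRHS]mulr1 ler_wpM2l //.
have := subrX1 rho n; have := exprn_ge0 n (ltW r0); set s := \sum_(i < n) _; nra.
Qed.

Lemma abs_cvg_geo m (N : 'cV[C]_m -> R) (f : int -> 'cV[C]_m) : vector_norm N ->
  (forall i, geo (fun j => f j i 0)) -> abs_cvg N f.
Proof.
move=> NP hf; have [B B0 hB] := vnorm_le_mxnorm NP.
have hn (h : nat -> int) : (forall i, ngeo (fun n => normc (f (h n) i 0))) ->
    ngeo (fun n => N (f (h n))).
  move=> hg; apply: (@ngeo_le _ _ (fun n => B * mxnorm (f (h n)))) => [n|]; first exact: hB.
  apply: ngeoZ; first exact: ltW.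
  have -> : (fun n => mxnorm (f (h n))) = (fun n => \sum_(i <- index_enum 'I_m) normc (f (h n) i 0)).
    by apply/funext => n; apply: eq_bigr => i _; rewrite big_ord1.
  elim: (index_enum _) => [|i r IHr].
    under eq_fun do rewrite big_nil.
    by exists 0, (1/2); split; [|apply/andP; split; lra|move=> n; rewrite mul0r].
  by under eq_fun do rewrite big_cons; exact: ngeoD.
have N0 v : 0 <= N v by exact: vnorm_ge0.
rewrite /abs_cvg esum_int => [|j]; last by rewrite lee_fin.
apply: lte_add_pinfty; apply: ngeo_nneseries => //.
  by apply: hn => i; exact: (hf i).1.
by apply: hn => i; exact: (ngeo_shift1 (hf i).2).
Qed.

End absolute_convergence.

Section from_tails_to_moments.
Context {R : realType} {disp : measure_display} {Om : measurableType disp}.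
Variable P : probability Om R.
Local Notation C := R[i].
Local Notation pr := (pr P).
Variables (d m : nat) (W : int -> {RV P >-> 'cV[C]_d}).
Hypothesis iidW : iid W.

Let mW t : measurable_fun setT (W t). Proof. exact: measurable_funPT. Qed.

Lemma log_moment_of_vector_recurrence (f : nat -> 'M[C]_(m, d)) D (c : nat -> C) K B :
  (forall n, f n = \sum_(e < D) c e *: f (n + e.+1)%N) -> 0 < K ->
  (forall b, \sum_(n < b) pr [set x | K < mxnorm (f n *m W 0 x)] <= B) ->
  ('E_P[fun x => log_plus (mxnorm (f 0%N *m W 0 x))] < +oo)%E.
Proof.
move=> hf K0 hB.
apply: (@log_moment_of_recurrence _ _ _ P (fun n x => mxnorm (f n *m W 0 x)) D
  (\sum_(e < D) normc (c e)) K B) => //.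
- by move=> n; apply: measurable_mxnorm; exact: measurable_mulmx.
- by move=> n x; exact: mxnorm_ge0.
- by apply: sumr_ge0 => e _; exact: normc_ge0.
move=> n x; rewrite {1}hf mulmx_suml; apply: le_trans (mxnorm_sum _ _ _) _.
rewrite mulr_suml; apply: ler_sum => e _; rewrite -scalemxAl mxnormZ.
rewrite ler_wpM2l ?normc_ge0 // (bigD1 e) //= lerDl; apply: sumr_ge0 => k _.
exact: mxnorm_ge0.
Qed.

Variables (delta : {poly C}) (N : 'M[{poly C}]_(m, d)) (M : int -> 'M[C]_(m, d)) (dN : nat).
Hypothesis delta0 : delta.[0] = 1.
Hypothesis sizeN : forall i j, (size (N i j) <= dN.+1)%N.
Hypothesis recM : forall k, mact (delta%:M : 'M[{poly C}]_m) M k = mxpolyseqz N k.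

Let c0E : delta`_0 = 1. Proof. by rewrite -horner_coef0. Qed.
Let delta_neq0 : delta != 0.
Proof. by apply/eqP => h; move: delta0; rewrite h horner0 => /eqP; rewrite eq_sym oner_eq0. Qed.

Lemma coef_recurrence0 k : k < 0 \/ dN%:Z < k ->
  \sum_(e < (size delta).-1.+1) delta`_e *: M (k - e%:Z) = 0.
Proof.
move=> hk; rewrite -(big_mkord xpredT (fun e => delta`_e *: M (k - e%:Z))).
rewrite prednK ?lt0n ?size_poly_eq0 // big_mkord -mact_scalarE recM; apply/matrixP => i j; rewrite !mxE.
case: k hk => [n|n] hk //=; rewrite nth_default //; apply: leq_trans (sizeN i j) _.
by lia.
Qed.

(** Solved for its oldest term, the recurrence of the Laurent coefficients beyond the
degree of N expresses each of them through later ones. *)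
Lemma coef_recurrence_up k : dN%:Z < k -> forall n : nat,
  M (k + n%:Z) = \sum_(e < (size delta).-1)
    (- (delta`_((size delta).-1 - e.+1)) / lead_coef delta) *: M (k + (n + e.+1)%N%:Z).
Proof.
move=> hk n.
have l0 : lead_coef delta != 0 by rewrite lead_coef_eq0.
have := @coef_recurrence0 (k + n%:Z + (size delta).-1%:Z); move=> /(_ (or_intror _)).
have -> : dN%:Z < k + n%:Z + (size delta).-1%:Z by lia.
move=> /(_ isT); rewrite big_ord_recr /= -/(lead_coef delta).
rewrite addrK => /eqP; rewrite addrC addr_eq0 => /eqP h.
have -> : M (k + n%:Z) = (lead_coef delta)^-1 *: (lead_coef delta *: M (k + n%:Z)).
  by rewrite scalerA mulVf // scale1r.
rewrite h -sumrN scaler_sumr.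
rewrite (reindex_inj rev_ord_inj) /=; apply: eq_bigr => e _.
have el := ltn_ord e.
rewrite -scaleNr scalerA mulrC; congr (_ *: M _); lia.
Qed.

(** Solved for its newest term, the recurrence at negative indices expresses each
coefficient through earlier ones; delta (0) = 1 makes this possible. *)
Lemma coef_recurrence_down k : k < 0 -> forall n : nat,
  M (k - n%:Z) = \sum_(e < (size delta).-1) (- delta`_e.+1) *: M (k - (n + e.+1)%N%:Z).
Proof.
move=> hk n.
have := @coef_recurrence0 (k - n%:Z); move=> /(_ (or_introl _)).
have -> : k - n%:Z < 0 by lia.
move=> /(_ isT); rewrite big_ord_recl /= subr0 c0E scale1r => /eqP.
rewrite addr_eq0 => /eqP ->; rewrite -sumrN; apply: eq_bigr => e _.
by rewrite scaleNr /bump /=; congr (- (_ *: M _)); lia.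
Qed.

(** At the ends of the index range the recurrence trades a bounded level for a
geometrically growing one, which turns the summable tails of all the terms into a
logarithmic moment of each. *)
Lemma log_moments_of_tails (K B : R) : 0 < K ->
  (forall b : nat, \sum_(k < b.*2) pr [set x | K < mxnorm (M (k%:Z - b%:Z) *m W 0 x)] <= B) ->
  forall k, k < 0 \/ dN%:Z < k ->
  ('E_P[fun x => log_plus (mxnorm (M k *m W 0 x))] < +oo)%E.
Proof.
move=> K0 hB k hk; pose g b (l : nat) := pr [set x | K < mxnorm (M (l%:Z - b%:Z) *m W 0 x)].
have g0 b l : 0 <= g b l by exact: pr_ge0.
case: hk => hk.
  have -> : M k = M (k - 0%N%:Z) by rewrite subr0.
  apply: (@log_moment_of_vector_recurrence (fun n => M (k - n%:Z)) _
    (fun e => - delta`_e.+1) K B (coef_recurrence_down hk) K0) => b.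
  apply: le_trans (hB (absz k + b)%N).
  rewrite (reindex_inj rev_ord_inj) /=.
  rewrite (eq_bigr (fun n : 'I_b => g (absz k + b)%N (1 + n)%N)) => [|n _].
    by apply: (@sum_window _ (g (absz k + b)%N)) => //; lia.
  rewrite /g; congr (pr _); apply/funext => x /=; congr (_ < mxnorm (M _ *m _)).
  by have := ltn_ord n; lia.
have -> : M k = M (k + 0%N%:Z) by rewrite addr0.
apply: (@log_moment_of_vector_recurrence (fun n => M (k + n%:Z)) _
    (fun e => - delta`_((size delta).-1 - e.+1) / lead_coef delta) K B (coef_recurrence_up hk) K0) => b.
apply: le_trans (hB (absz k + b)%N).
rewrite (eq_bigr (fun n : 'I_b => g (absz k + b)%N (absz k + absz k + b + n)%N)) => [|n _].
  by apply: (@sum_window _ (g (absz k + b)%N)) => //; lia.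
rewrite /g; congr (pr _); apply/funext => x /=; congr (_ < mxnorm (M _ *m _)).
by lia.
Qed.

End from_tails_to_moments.

Section abs_cvg_tails.
Context {R : realType} {disp : measure_display} {Om : measurableType disp}.
Variable P : probability Om R.
Local Notation C := R[i].
Local Notation pr := (pr P).
Variables (d m : nat) (W : int -> {RV P >-> 'cV[C]_d}) (M : int -> 'M[C]_(m, d)).
Hypothesis iidW : iid W.

Let mW t : measurable_fun setT (W t). Proof. exact: measurable_funPT. Qed.

(** An almost surely absolutely convergent series has almost surely bounded terms;
as these are independent, the probabilities that they exceed a large level are
summable. *)
Lemma tails_of_abs_cvg (nrm : 'cV[C]_m -> R) : vector_norm nrm ->
  {ae P, forall x, abs_cvg nrm (fun j => M j *m W (- j) x)} ->
  exists K : R, 0 < K /\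
    forall b : nat, \sum_(k < b.*2) pr [set x | K < mxnorm (M (k%:Z - b%:Z) *m W 0 x)] <= 1.
Proof.
move=> NP hae; have [B B0 hB] := mxnorm_le_vnorm NP.
pose E n j := [set x | n%:R < mxnorm (M j *m W (- j) x)].
have mE n j : measurable (E n j).
  by apply: measurable_norm_gt; exact: measurable_mulmx.
pose F n := \bigcup_k (E n k%:Z `|` E n (Negz k)).
have mF n : measurable (F n) by apply: bigcup_measurable => k _; exact: measurableU.
have [n hn] : exists n, pr (F n) <= 2^-1.
  apply: pr_decreasing => //.
    move=> i j ij x [k _ hk]; exists k => //.
    by case: hk => hk; [left|right]; apply: le_lt_trans hk; rewrite ler_nat.
  apply: filterS hae => x /(abs_cvg_bounded (vnorm_ge0 NP)) [n hn].
  exists (Num.truncn (B * n%:R)).+1 => -[k _] [] /=; apply/negP; rewrite -leNgt ltW //;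
    apply: le_lt_trans (truncnS_gt _); apply: le_trans (hB _) _; rewrite ler_pM2l //.
exists n.+1%:R; split => // b.
pose p k := pr [set x | n%:R < mxnorm (M (k%:Z - b%:Z) *m W 0 x)].
apply: (@le_trans _ _ (\sum_(k < b.*2) p k)).
  apply: ler_sum => k _; apply: pr_mono.
  - by apply: measurable_norm_gt; exact: measurable_mulmx.
  - by apply: measurable_norm_gt; exact: measurable_mulmx.
  - by move=> x /=; apply: le_lt_trans; rewrite ler_nat.
pose G (k : nat) : set int := [set b%:Z - k%:Z].
pose Bk (k : nat) := [set z : int -> 'cV[C]_d | mxnorm (M (k%:Z - b%:Z) *m z (b%:Z - k%:Z)) <= n%:R].
have mBk (k : nat) : <<s cylinders (G k) >> (Bk k).
  apply: (@measurable_le R _ (seqspace (G k))); apply: measurable_mxnorm.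
  by apply: measurable_mulmx; exact: measurable_coord.
have := noise_law_groups mW iidW.1 b.*2 (G := G) (B := Bk).
have GP : forall (i j : nat) (t : int), i != j -> G i t -> G j t -> False.
  by move=> i j t /eqP ij; rewrite /G /= => -> h; apply: ij; lia.
move=> /(_ GP mBk) hind.
have mP : measurable ((fun x => W ^~ x) @^-1` (\bigcap_(k < b.*2) Bk k)).
  have := measurable_pathZ mW measurableT (_ : measurable (\bigcap_(k < b.*2) Bk k : set (seqspace [set: int]))).
  rewrite setTI; apply; apply: bigcap_measurableType => k _.
  have sub : G k `<=` [set: int] by [].
  exact: (sigma_cylinders_sub sub (mBk k)).
have pE k : fine (noise_law P mW (Bk k)) = 1 - p k.
  rewrite noise_lawE -/(pr _).
  have -> : (fun x => W ^~ x) @^-1` Bk k = ~` [set x | n%:R < mxnorm (M (k%:Z - b%:Z) *m W (b%:Z - k%:Z) x)].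
    by apply/seteqP; split => x /=; rewrite /Bk /= leNgt => /negP.
  have mS : measurable [set z : 'cV[C]_d | n%:R < mxnorm (M (k%:Z - b%:Z) *m z)].
    by apply: measurable_norm_gt; apply: measurable_mulmx; exact: measurable_id.
  rewrite prC; last by apply: measurable_norm_gt; exact: measurable_mulmx.
  by congr (1 - fine _); exact: (iidW.2 (b%:Z - k%:Z) _ mS).
have half : 2^-1 <= \prod_(k < b.*2) (1 - p k).
  have -> : \prod_(k < b.*2) (1 - p k) = fine (noise_law P mW (\bigcap_(k < b.*2) Bk k)).
    transitivity (\prod_(k < b.*2) fine (noise_law P mW (Bk k))); last exact: esym hind.
    by apply: eq_bigr => k _; rewrite pE.
  rewrite noise_lawE -/(pr _).
  apply: (@le_trans _ _ (pr (~` F n))); first by rewrite prC //; lra.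
  apply: pr_mono => //; first exact: measurableC.
  move=> x hx k _; rewrite /Bk /= leNgt; apply/negP => h; apply: hx.
  have h' : E n (k%:Z - b%:Z) x by rewrite /E /= opprB.
  by case: (k%:Z - b%:Z) h' => [l|l] h'; exists l => //; [left|right].
have p01 k : 0 <= p k <= 1.
  rewrite pr_ge0 pr_le1 //; apply: measurable_norm_gt; exact: measurable_mulmx.
have := prod_sum_le1 b.*2 p01.
have : 0 <= \sum_(i < b.*2) p i by apply: sumr_ge0 => k _; case/andP: (p01 k).
move: half; set A := \prod_(k < b.*2) _; set S := \sum_(k < b.*2) _; nra.
Qed.

End abs_cvg_tails.

(** * Convergence of the moving average *)

Section moving_average.
Context {R : realType}.
Local Notation C := R[i].

Lemma mxnorm_geo m n (M : int -> 'M[C]_(m, n)) : (forall i j, geo (fun k => M k i j)) ->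
  exists K rho, [/\ 0 <= K, 0 < rho < 1 & forall k, mxnorm (M k) <= K * rho ^+ `|k|%N].
Proof.
move=> gM; have normcC (r : R) : 0 <= r -> normc (r%:C)%C = r.
  by move=> r0; rewrite /= expr0n /= addr0 sqrtr_sqr ger0_norm.
have g1 i j : geo (fun k => (normc (M k i j))%:C%C).
  have [h1 h2] := gM i j; split.
    by apply: ngeo_le h1 => k; rewrite normcC ?normc_ge0.
  by apply: ngeo_le h2 => k; rewrite normcC ?normc_ge0.
have := geo_sum (index_enum 'I_m) (fun i => geo_sum (index_enum 'I_n) (fun j => g1 i j)).
move/geoP => [K [rho [K0 hr hK]]]; exists K, rho; split => // k.
apply: le_trans (hK k).
have -> : \sum_i \sum_j (normc (M k i j))%:C%C = (mxnorm (M k))%:C%C.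
  by rewrite /mxnorm raddf_sum; apply: eq_bigr => i _; rewrite raddf_sum.
by rewrite normcC // mxnorm_ge0.
Qed.

(** A finite convolution is a Laurent series with finitely many nonzero terms. *)
Lemma has_zsum_pact_conv (p : {poly C}) (y : int -> C) t :
  has_zsum (fun j => polyseqz p j * y (t - j)) (pact p y t).
Proof.
exists (pact p y t), 0; split; first by rewrite addr0.
  apply: (cvgC_le (x := fun n => if (size p <= n)%N then 0
      else normc (\sum_(i < n) polyseqz p i%:Z * y (t - i%:Z) - pact p y t))) => [n|].
    case: leqP => // h; rewrite (pact_widen _ _ h) (eq_bigr (fun i : 'I_n => p`_i * y (t - i%:Z))) //.
    by rewrite subrr normc0.
  apply: cvg_near_cst.
  by exists (size p) => // n /= ->.
apply: (eq_cvgC (u := fun=> 0)) => [n|]; last exact: cvgC_cst.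
by rewrite big1 // => k _; exact: mul0r.
Qed.

Section convolution.
Variables (m d : nat) (M : int -> 'M[C]_(m, d)) (W : int -> 'cV[C]_d) (L : int -> 'cV[C]_m).
Hypothesis hL : forall t i, has_zsum (fun j => (M j *m W (t - j)) i 0) (L t i 0).

Lemma has_zsum_mact l (A : 'M[{poly C}]_(l, m)) t i :
  has_zsum (fun j => (mact A M j *m W (t - j)) i 0) (mact A L t i 0).
Proof.
have [N hN] := mx_size_bound A; rewrite (mactE _ _ hN) summxE.
apply: (@eq_has_zsum _ (fun j => \sum_(e <- index_enum 'I_N)
   \sum_(k <- index_enum 'I_m) (A i k)`_e * (M (j - e%:Z) *m W (t - j)) k 0)) => [j|].
  rewrite (mactE _ _ hN) mulmx_suml summxE; apply: eq_bigr => e _.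
  by rewrite -mulmxA [RHS]mxE; apply: eq_bigr => k _; congr (_ * _); rewrite mxE.
apply: has_zsum_sum => e; rewrite mxE (eq_bigr (fun k => (A i k)`_e * L (t - e%:Z) k 0)) => [|k _]; last by rewrite mxE.
apply: has_zsum_sum => k; apply: has_zsumZ.
have := has_zsum_shift (- e%:Z) (hL (t - e%:Z) k); apply: eq_has_zsum => j.
by congr ((M _ *m W _) k 0); lia.
Qed.

(** Multiplication of formal series: A (B) applied to M * W is (A M) * W, and A M is the
polynomial B. *)
Lemma convolution_recurrence l (A : 'M[{poly C}]_(l, m)) (B : 'M[{poly C}]_(l, d)) :
  (forall k, mact A M k = mxpolyseqz B k) -> forall t, mact A L t = mact B W t.
Proof.
move=> hAB t; apply/matrixP => i j; rewrite (ord1 j).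
apply: has_zsum_unique (has_zsum_mact A t i) _.
apply: (@eq_has_zsum _ (fun j => \sum_(k <- index_enum 'I_d) polyseqz (B i k) j * W (t - j) k 0)).
  by move=> k; rewrite hAB mxE; apply: eq_bigr => e _; rewrite mxE.
rewrite mxE; apply: has_zsum_sum => k.
exact: (has_zsum_pact_conv (B i k) (fun s => W s k 0)).
Qed.

End convolution.
End moving_average.

Section window.
Context {R : realType} {disp : measure_display} {Om : measurableType disp}.
Variable P : probability Om R.
Local Notation C := R[i].
Local Notation pr := (pr P).
Variables (d m p q : nat) (Psi : 'I_p -> 'M[C]_m) (B : 'M[{poly C}]_(m, d)).
Variables (M : int -> 'M[C]_(m, d)) (top : nat).
Hypothesis m_gt0 : (0 < m)%N.
Hypothesis topE : (q + p <= top)%N.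
Hypothesis sizeB : forall i j, (size (B i j) <= q.+1)%N.
Hypothesis geoM : forall i j, geo (fun k => M k i j).
Hypothesis recM : forall k, mact (arX Psi) M k = mxpolyseqz B k.

(** The p indices at the top of the upper window and the p indices just below 0: as
many as initial values of the recurrence of order p, in each direction. *)
Definition window_index (i : nat) : int := if (i < p)%N then top%:Z - i%:Z else - (i - p).+1%:Z.

(** Its row space is spanned by the rows of the window coefficients, so every matrix
with rows in that space factors through it on the right, and the moments of the
window control all of them. *)
Definition window_span : 'M[C]_d := (\sum_(i < p + p) genmx (M (window_index i)))%MS.

Lemma window_sub (k : int) : top%:Z - p%:Z < k <= top%:Z \/ - p%:Z <= k < 0 ->
  (M k <= window_span)%MS.
Proof.
move=> hk; have [i ip ->] : exists2 i, (i < p + p)%N & k = window_index i.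
  case: hk => hk; [exists (absz (top%:Z - k))|exists (p + (absz k).-1)%N]; rewrite ?/window_index; try lia.
    by case: ifP; lia.
  by case: ifP; lia.
by apply: (sumsmx_sup (Ordinal ip)) => //; rewrite genmxE.
Qed.

Lemma coef_rec0 k : k < 0 \/ q%:Z < k ->
  M k = \sum_(l < p) Psi l *m M (k - l.+1%:Z).
Proof.
move=> hk; apply/eqP; rewrite -subr_eq0 -mact_arX recM; apply/eqP/matrixP => i j; rewrite !mxE.
case: k hk => [n|n] hk //=; rewrite nth_default //; apply: leq_trans (sizeB i j) _.
by lia.
Qed.

(** Beyond degree q the recurrence of order p is homogeneous, and left multiplication
by Psi_l preserves the row space. *)
Lemma coef_up_sub k : top%:Z - p%:Z < k -> (M k <= window_span)%MS.
Proof.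
move=> hk; have [n ->] : exists n : nat, k = top%:Z - p%:Z + 1 + n%:Z.
  by exists (absz (k - (top%:Z - p%:Z + 1))%R); lia.
elim/ltn_ind: n => n IHn {k hk}.
have [np|pn] := ltnP n p; first by apply: window_sub; left; lia.
rewrite coef_rec0; last by right; lia.
apply: summx_sub => l _; apply: mulmx_sub.
have lp := ltn_ord l; have := IHn (n - l.+1)%N; rewrite ltn_subrL /=.
have -> : (0 < n)%N by lia.
move=> /(_ isT); congr (M _ <= _)%MS; lia.
Qed.

(** The coefficients of negative index form a decaying solution of the homogeneous
recurrence on the kernel of the window, and only the zero solution decays in both
directions. *)
Lemma coef_down_sub k : k < 0 -> (M k <= window_span)%MS.
Proof.
pose K0 := cokermx window_span.
pose a (j : int) := (if j < 0 then M j else 0) *m K0.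
have winK j : - p%:Z <= j < 0 -> M j *m K0 = 0.
  by move=> hj; apply/eqP; rewrite -submxE; apply: window_sub; right.
have geoa i j : geo (fun k => a k i j).
  have -> : (fun k => a k i j) = (fun k => \sum_(e <- index_enum 'I_d) K0 e j * (if k < 0 then M k i e else 0)).
    apply/funext => l; rewrite mxE; apply: eq_bigr => e _; rewrite mulrC; congr (_ * _).
    by case: ifP => _ //; rewrite mxE.
  have ifle (b : bool) (z : C) : normc (if b then z else 0) <= normc z.
    by case: b; rewrite // normc0 normc_ge0.
  apply: geo_sum => e; apply: geoZ; have [h1 h2] := geoM i e; split.
    by apply: ngeo_le h1 => n; exact: (ifle (n%:Z < 0)).
  by apply: ngeo_le h2 => n; exact: (ifle (- n%:Z < 0)).
have arXa j : mact (arX Psi) a j = 0.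
  rewrite mact_arX; have [j0|j0] := ltP j 0.
    rewrite {1}/a j0 coef_rec0; last by left.
    rewrite mulmx_suml -sumrB big1 // => l _.
    have -> : a (j - l.+1%:Z) = M (j - l.+1%:Z) *m K0.
      by rewrite /a (_ : j - l.+1%:Z < 0) //; lia.
    by rewrite mulmxA subrr.
  rewrite {1}/a ltNge j0 /= mul0mx sub0r big1 ?oppr0 // => l _.
  rewrite /a; case: ifP => h; last by rewrite mul0mx mulmx0.
  by rewrite winK ?mulmx0 //; have := ltn_ord l; lia.
have a0 j : a j = 0.
  apply/matrixP => i e; rewrite [RHS]mxE.
  apply: (pact_inj (geoa i e) (detX_neq0 Psi)) => l.
  have := mact_scalar (detX Psi) a l i e; rewrite -mul_adj_mx mactM => <-.
  by rewrite (eq_mact (x2 := fun=> 0) _ _ arXa) mact_cst mulmx0 mxE.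
by move=> k0; rewrite submxE; have := a0 k; rewrite /a k0 => ->.
Qed.

Variable W : int -> {RV P >-> 'cV[C]_d}.
Hypothesis iidW : iid W.
Hypothesis momW : forall k, top%:Z - p%:Z < k <= top%:Z \/ - p%:Z <= k < 0 ->
  ('E_P[fun x => log_plus (mxnorm (M k *m W 0 x))] < +oo)%E.

Let mW t : measurable_fun setT (W t). Proof. exact: measurable_funPT. Qed.

Lemma window_span_moment :
  ('E_P[fun x => log_plus (mxnorm (window_span *m W 0 x))] < +oo)%E.
Proof.
have /sub_sumsmxP[u hu] : (window_span <= \sum_(i < p + p) genmx (M (window_index i)))%MS by [].
have /choice[v hv] : forall i : 'I_(p + p), exists v, genmx (M (window_index i)) = v *m M (window_index i).
  by move=> i; apply/submxP; rewrite genmxE.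
apply: (@log_moment_le_sum _ _ _ P (p + p) _ (fun i x => mxnorm (M (window_index i) *m W 0 x))
   (1 + \sum_(i < p + p) mxnorm (u i *m v i))).
- by apply: measurable_mxnorm; exact: measurable_mulmx.
- by move=> i; apply: measurable_mxnorm; exact: measurable_mulmx.
- by rewrite ltr_pwDl //; apply: sumr_ge0 => i _; exact: mxnorm_ge0.
- move=> x; rewrite {1}hu mulmx_suml; apply: le_trans (mxnorm_sum _ _ _) _.
  rewrite mulr_sumr; apply: ler_sum => i _; rewrite hv mulmxA -(mulmxA (u i *m v i)).
  apply: le_trans (mxnormM _ _) _; rewrite ler_wpM2r ?mxnorm_ge0 //.
  rewrite (bigD1 i) //= addrCA lerDl addr_ge0 //; apply: sumr_ge0 => j _; exact: mxnorm_ge0.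
- by move=> i ip; apply: momW; rewrite /window_index; case: ifP; lia.
Qed.

Lemma ngeo_shift (N : nat) (x : nat -> R) : ngeo x -> ngeo (fun n => x (n + N)%N).
Proof.
elim: N x => [|N IHN] x h; first by move: h; under [X in _ -> ngeo X]eq_fun do rewrite addn0.
have := IHN _ (ngeo_shift1 h); congr ngeo; by apply/funext => n; rewrite addnS.
Qed.

(** Every coefficient outside a finite range factors through the window with a
geometrically small factor, which beats the subexponential growth of the noise. *)
Lemma terms_geo : {ae P, forall x, forall t i, geo (fun j => (M j *m W (t - j) x) i 0)}.
Proof.
apply: ae_int => t.
have gA i j : geo (fun k => (M k *m pinvmx window_span) i j).
  have -> : (fun k => (M k *m pinvmx window_span) i j) =
    (fun k => \sum_(e <- index_enum 'I_d) pinvmx window_span e j * M k i e).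
    by apply/funext => k; rewrite mxE; apply: eq_bigr => e _; rewrite mulrC.
  by apply: geo_sum => e; exact: geoZ.
have [K [rho [K0 hr hK]]] := mxnorm_geo gA.
have decay (h : nat -> int) : {ae P, forall x,
    ngeo (fun n => rho ^+ n * mxnorm (window_span *m W (h n) x))}.
  pose X n x := mxnorm (window_span *m W (if n is n'.+1 then h n' else 0) x).
  have mX n : measurable_fun setT (X n).
    by apply: measurable_mxnorm; exact: measurable_mulmx.
  have idX n c : pr [set x | c < X n x] = pr [set x | c < X 0%N x].
    have mS : measurable [set z : 'cV[C]_d | c < mxnorm (window_span *m z)].
      by apply: measurable_norm_gt; apply: measurable_mulmx; exact: measurable_id.
    by congr fine; exact: (iidW.2 (if n is n'.+1 then h n' else 0) _ mS).
  have X0 n x : 0 <= X n x by exact: mxnorm_ge0.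
  have := log_moment_decay mX X0 idX hr window_span_moment.
  apply: filterS => x /ngeo_shift1 hx; case/andP: (hr) => r0 r1.
  have ri : 0 <= rho^-1 by rewrite invr_ge0; case/andP: hr => /ltW.
  have := ngeoZ ri hx; congr ngeo; apply/funext => n /=.
  by rewrite exprS -mulrA mulKf // gt_eqF //; case/andP: hr.
have bound k x i : top%:Z - p%:Z < k \/ k < 0 ->
    normc ((M k *m W (t - k) x) i 0) <= K * (rho ^+ `|k|%N * mxnorm (window_span *m W (t - k) x)).
  move=> hk; have sub : (M k <= window_span)%MS.
    by case: hk => hk; [exact: coef_up_sub|exact: coef_down_sub].
  rewrite -{1}(mulmxKpV sub) -(mulmxA (M k *m pinvmx window_span)); apply: le_trans (normc_le_mxnorm _ _ _) _.
  apply: le_trans (mxnormM _ _) _; rewrite mulrA ler_wpM2r ?mxnorm_ge0 //.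
apply: filterS2 (decay (fun n => t - n%:Z)) (decay (fun n => t + n.+1%:Z)) => x h1 h2 i.
split.
  apply: (@ngeo_unshift _ top.+1).
  apply: ngeo_le (ngeoZ K0 (ngeo_shift top.+1 h1)) => n /=.
  by apply: bound; left; lia.
apply: ngeo_unshift1; have Kr : 0 <= K * rho by rewrite mulr_ge0 //; case/andP: hr => /ltW.
apply: ngeo_le (ngeoZ Kr h2) => n.
apply: le_trans (bound (- n.+1%:Z) x i (or_intror _)) _; first by lia.
by rewrite opprK abszN absz_nat exprS !mulrA.
Qed.

End window.

(** * Measurability and stationarity of the moving average *)

Section measurable_series.
Context {R : realType} {d m : nat}.
Local Notation C := R[i].
Local Notation S := (@seqspace int _ 'cV[C]_d [set: int]).
Variables (M : int -> 'M[C]_(m, d)).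

(** The two-sided moving average of a path, as a total function: the upper limit
of the symmetric partial sums is measurable, and is the sum when there is one. *)
Definition real_limit (u : nat -> R) : R := fine (limn_esup (fun n => (u n)%:E)).

Definition partial_ma (z : int -> 'cV[C]_d) (n : nat) : 'cV[C]_m :=
  \sum_(j < n) M j%:Z *m z (- j%:Z) + \sum_(j < n) M (- j.+1%:Z) *m z (j.+1%:Z).

Definition ma_limit (z : int -> 'cV[C]_d) : 'cV[C]_m :=
  \col_i (real_limit (fun n => complex.Re (partial_ma z n i 0)) +i*
          real_limit (fun n => complex.Im (partial_ma z n i 0)))%C.

Lemma real_limitE (u : nat -> R) l : u @ \oo --> l -> real_limit u = l.
Proof.
move=> h; rewrite /real_limit; have h' : (fun n => (u n)%:E) @ \oo --> l%:E by apply/fine_cvgP; split; [exact: nearW|exact: h].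
by rewrite is_cvg_limn_esupE ?(cvg_lim _ h') //; apply/cvg_ex; exists l%:E.
Qed.

Lemma measurable_real_limit dT (T : measurableType dT) (f : nat -> T -> R) :
  (forall n, measurable_fun setT (f n)) ->
  measurable_fun setT (fun x => real_limit (fun n => f n x)).
Proof.
move=> mf; apply: measurableT_comp; first exact: fine_measurable.
by apply: measurable_fun_limn_esup => n; apply/measurable_EFinP.
Qed.

Lemma measurable_ma_limit : measurable_fun setT (ma_limit : S -> 'cV[C]_m).
Proof.
have mp n : measurable_fun setT (fun z : S => partial_ma z n).
  by apply: measurable_mxD; apply: measurable_mx_sum => j _; apply: measurable_mulmx;
    exact: measurable_coord.
apply: measurable_mx => i j.
  rewrite [X in measurable_fun _ X](_ : _ = (fun z : S =>
    real_limit (fun n => complex.Re (partial_ma z n i 0)))); last first.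
    by apply/funext => z; rewrite mxE.
  apply: measurable_real_limit => n; exact: (measurable_mx_Re _ _ (mp n)).
rewrite [X in measurable_fun _ X](_ : _ = (fun z : S =>
  real_limit (fun n => complex.Im (partial_ma z n i 0)))); last first.
  by apply/funext => z; rewrite mxE.
apply: measurable_real_limit => n; exact: (measurable_mx_Im _ _ (mp n)).
Qed.

Lemma ma_limitE (z : int -> 'cV[C]_d) (l : 'cV[C]_m) :
  (forall i, has_zsum (fun j => (M j *m z (- j)) i 0) (l i 0)) -> ma_limit z = l.
Proof.
move=> h; apply/matrixP => i j; rewrite (ord1 j) mxE.
have [l1 [l2 [e h1 h2]]] := h i.
have hc : cvgC (fun n => partial_ma z n i 0) (l i 0).
  rewrite e; apply: eq_cvgC (cvgCD h1 h2) => n; rewrite mxE !summxE; congr (_ + _).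
have cv (p : C -> R) : (forall a, `|p a| <= normc a) -> (forall a b, p (a - b) = p a - p b) ->
    (fun n => p (partial_ma z n i 0)) @ \oo --> p (l i 0).
  move=> hp pB; apply/cvgrPdist_lt => eps eps0.
  move: hc => /cvgrPdist_lt /(_ eps eps0); apply: filterS => n.
  rewrite sub0r normrN ger0_norm ?normc_ge0 // -pB => hn; apply: le_lt_trans (hp _) _.
  by rewrite normcB.
rewrite (real_limitE (cv _ (@Re_le_normc R) _)); last by case=> ? ? [].
rewrite (real_limitE (cv _ (@Im_le_normc R) _)); last by case=> ? ? [].
by case: (l i 0).
Qed.

End measurable_series.

Section stationary_path.
Context {R : realType} {disp : measure_display} {Om : measurableType disp}.
Variable P : probability Om R.
Local Notation C := R[i].

(** Each finite-dimensional law of Y is the image of the law of the path X h, which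
is the same for all h. The index set has one extra point, so that a random phase
can accompany the path. *)
Lemma stationary_of_law d m (X : int -> option int -> Om -> 'cV[C]_d)
    (F : @seqspace (option int) _ 'cV[C]_d setT -> 'cV[C]_m) (Y : int -> {RV P >-> 'cV[C]_m}) :
  (forall h t, measurable_fun setT (X h t)) ->
  measurable_fun setT F ->
  (forall h (I : seq (option int)) (A : option int -> set 'cV[C]_d), uniq I ->
     (forall t, measurable (A t)) ->
     P (\bigcap_(t in [set` I]) (X h t @^-1` A t)) =
     P (\bigcap_(t in [set` I]) (X 0 t @^-1` A t))) ->
  (exists sh : int -> (option int -> 'cV[C]_d) -> (option int -> 'cV[C]_d),
     (forall t, measurable_fun setT (sh t : @seqspace (option int) _ 'cV[C]_d setT ->
        @seqspace (option int) _ 'cV[C]_d setT)) /\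
     forall t h x, Y (t + h) x = F (sh t ((X h) ^~ x))) ->
  strictly_stationary Y.
Proof.
move=> mX mF hX [sh [msh hY]] n t h A mA.
pose G (z : @seqspace (option int) _ 'cV[C]_d setT) : n.-tuple 'cV[C]_m :=
  [tuple F (sh (t i) z) | i < n].
have mG : measurable_fun setT G.
  apply/measurable_fun_tnthP => i.
  rewrite [X in measurable_fun _ X](_ : _ = (fun z => F (sh (t i) z))).
    exact: measurableT_comp mF (msh (t i)).
  by apply/funext => z; rewrite /G /= tnth_mktuple.
pose B := G @^-1` A; have mB : measurable B by have := mG measurableT A mA; rewrite setTI.
have e h' : (fun x => [tuple Y (t i + h') x | i < n]) @^-1` A = (fun x => (X h') ^~ x) @^-1` B.
  apply/funext => x; rewrite /B /G /preimage /=; congr A; apply: eq_mktuple => i.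
  by rewrite hY.
have e0 : (fun x => [tuple Y (t i) x | i < n]) @^-1` A = (fun x => (X 0) ^~ x) @^-1` B.
  rewrite -(e 0); apply/funext => x; rewrite /preimage /=; congr A; apply: eq_mktuple => i.
  by rewrite addr0.
rewrite e e0; exact: (eq_law (mX h) (mX 0) (hX h) mB).
Qed.

End stationary_path.

(** * A uniform phase on the unit circle *)

Section uniform_phase.
Context {R : realType}.
Local Notation C := R[i].
Local Notation leb := (@lebesgue_measure R).
Local Notation T := (measurableTypeR R).

Lemma lebesgue_translation (a : R) (A : set T) : measurable A ->
  leb ((fun x : R => x + a) @^-1` A) = leb A.
Proof.
move=> mA; have mf : measurable_fun (setT : set T) ((fun x : R => x + a) : T -> T).
  by apply: measurable_funD => //; exact: measurable_cst.
apply/esym; pose f : {mfun T >-> T} := @mfun_Sub _ _ T T _ (mem_set mf).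
apply: (lebesgue_measure_unique (mu := pushforward leb f)) => // X [[x y] _ <-] /=.
rewrite /pushforward /=.
have -> : (fun x0 : R => x0 + a) @^-1` `]x, y]%classic = `]x - a, y - a]%classic.
  by apply/seteqP; split=> z /=; rewrite !in_itv /= ltrBlDr lerBrDr.
rewrite !lebesgue_measure_itv /= !lte_fin ltrD2r; case: ifP => // _.
by rewrite -!EFinB; congr (_%:E); ring.
Qed.

(** The translated period ]a, 1 + a] is cut at 1, and the part beyond 1 is moved back
by one period. *)
Lemma periodic_lebesgue (S : set T) (a : R) : measurable S ->
  (forall x : R, S (x + 1) <-> S x) -> 0 <= a <= 1 ->
  leb ((fun x : R => x + a) @^-1` S `&` `]0, 1]%classic) = leb (S `&` `]0, 1]%classic).
Proof.
move=> mS per /andP[a0 a1].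
have mI (x y : R) : measurable (`]x, y]%classic : set T) by exact: measurable_itv.
have split3 (x y z : R) : x <= y <= z -> leb (S `&` `]x, z]%classic) =
    (leb (S `&` `]x, y]%classic) + leb (S `&` `]y, z]%classic))%E.
  move=> /andP[xy yz]; rewrite -measureU; try exact: measurableI.
    congr (leb _); rewrite -setIUr; congr (S `&` _); apply/seteqP; split=> u /=; rewrite !in_itv /=.
      by case: (leP u y) => h /andP[h1 h2]; [left; rewrite h1|right].
    by case=> /andP[h1 h2]; apply/andP; split=> //; [exact: le_trans yz|exact: le_lt_trans h1].
  apply/seteqP; split=> // u [[_ /=]] + [_ /=]; rewrite !in_itv /= => /andP[_ h] /andP[h' _].
  by move: (lt_le_trans h' h); rewrite ltxx.
have -> : (fun x : R => x + a) @^-1` S `&` `]0, 1]%classic =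
    (fun x : R => x + a) @^-1` (S `&` `]a, 1 + a]%classic).
  apply/seteqP; split=> u /= [h]; rewrite !in_itv /= => hu; split => //; move: hu.
    by rewrite ltrDr lerD2r.
  by rewrite ltrDr lerD2r.
rewrite lebesgue_translation; last exact: measurableI.
rewrite (split3 a 1) ?a1 ?lerDl // (split3 0 a) ?a0 // [RHS]addeC; congr (_ + _)%E.
rewrite -(lebesgue_translation 1); last exact: measurableI.
congr (leb _); apply/seteqP; split=> u /= [h]; rewrite !in_itv /= => /andP[h1 h2]; split.
- exact/per.
- by apply/andP; split; lra.
- exact/per.
- by apply/andP; split; lra.
Qed.

Lemma uniform_probE (A : set T) : measurable A ->
  uniform_prob (@ltr01 R) A = leb (A `&` `]0, 1]%classic).
Proof.
move=> mA; rewrite /uniform_prob integral_uniform_pdf.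
rewrite (eq_integral (fun=> 1%E)); last first.
  by move=> x; rewrite inE /= => -[_ /=]; rewrite in_itv /= /uniform_pdf => ->; rewrite subr0 invr1.
rewrite integral_cst; last by apply: measurableI => //; exact: measurable_itv.
rewrite mul1e; have -> : A `&` `[0, 1]%classic = (A `&` `]0, 1]%classic) `|` (A `&` [set 0]).
  rewrite -setIUr; congr (A `&` _); apply/seteqP; split=> u /=; rewrite !in_itv /=.
    by rewrite le_eqVlt => /andP[/orP[/eqP <-|h1] h2]; [right|left; rewrite h1].
  by case=> [/andP[h1 ->]|->]; rewrite ?(ltW h1) ?lexx ?ler01.
have m1 : measurable (A `&` `]0, 1]%classic : set T).
  by apply: measurableI => //; exact: measurable_itv.
have m2 : measurable (A `&` [set 0] : set T) by exact: measurableI.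
rewrite measureU //.
  have z0 : leb (A `&` [set 0]) = 0%E; last first.
    by transitivity (leb (A `&` `]0%R, 1%R]%classic) + 0)%E; [congr (_ + _)%E|rewrite adde0].
  apply/eqP; rewrite eq_le measure_ge0 andbT -(lebesgue_measure_set1 (0 : R)).
  by apply: le_measure; rewrite ?inE.
apply/seteqP; split=> // u [[_ /=]]; rewrite in_itv /= => /andP[h _] [_ /= h'].
by move: h; rewrite h' ltxx.
Qed.

(** Parametrized by turns, so that a variable uniform on the unit interval can be
inserted directly. *)
Definition circ (v : R) : C := (cos ((pi *+ 2) * v) +i* sin ((pi *+ 2) * v))%C.

Lemma circD v w : circ (v + w) = circ v * circ w.
Proof.
rewrite /circ mulrDr cosD sinD; congr (_ +i* _)%C.
by rewrite addrC.
Qed.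

Lemma circ1 v : circ (v + 1) = circ v.
Proof. by rewrite /circ mulrDr mulr1 cosD2pi sinD2pi. Qed.

Lemma normc_circ v : normc (circ v) = 1.
Proof. by rewrite /circ /= cos2Dsin2 sqrtr1. Qed.

Lemma circ_onto (c : C) : normc c = 1 -> exists2 a, 0 <= a <= 1 & c = circ a.
Proof.
case: c => x y /= h; have h2 : x ^+ 2 + y ^+ 2 = 1.
  by rewrite -[LHS]sqr_sqrtr ?addr_ge0 ?sqr_ge0 // h expr1n.
have x1 : -1 <= x <= 1.
  rewrite -ler_norml -(expr_le1 (n := 2)) // real_normK ?num_real // -h2 lerDl; exact: sqr_ge0.
have y2 : Num.sqrt (1 - x ^+ 2) = `|y| by rewrite -h2 addrC addKr sqrtr_sqr.
have p2 : 0 < pi *+ 2 :> R by rewrite mulrn_wgt0 // pi_gt0.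
have ac : cos (acos x) = x by apply: acosK; rewrite in_itv.
pose a := acos x / (pi *+ 2).
have aE : (pi *+ 2) * a = acos x by rewrite /a mulrC divfK // gt_eqF.
have a0 : 0 <= a by rewrite divr_ge0 ?acos_ge0 // ltW.
have a1 : a <= 1.
  rewrite ler_pdivrMr // mul1r; apply: le_trans (acos_lepi x1) _.
  by rewrite mulr2n lerDl pi_ge0.
have [y0|y0] := leP 0 y.
  exists a; first by rewrite a0.
  by rewrite /circ aE ac sin_acos // y2 ger0_norm.
exists (1 - a); first by rewrite subr_ge0 a1 lerBlDr lerDl.
by rewrite addrC circ1 /circ mulrN cosN sinN aE ac sin_acos // y2 ltr0_norm // opprK.
Qed.

Lemma measurable_circ n : measurable_fun (setT : set T) ((fun v : R => const_mx (circ v)) : T -> 'cV[C]_n).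
Proof.
have ms : measurable_fun (setT : set T) ((fun v : R => (pi *+ 2) * v) : T -> R) by exact: measurable_funM.
apply: measurable_mx => i j.
  rewrite [X in measurable_fun _ X](_ : _ = fun v : T => cos ((pi *+ 2) * v)).
    by apply: (@measurableT_comp _ _ _ _ _ _ (@cos R)) => //; apply: continuous_measurable_fun; exact: continuous_cos.
  by apply/funext => v; rewrite mxE.
rewrite [X in measurable_fun _ X](_ : _ = fun v : T => sin ((pi *+ 2) * v)).
  by apply: (@measurableT_comp _ _ _ _ _ _ (@sin R)) => //; apply: continuous_measurable_fun; exact: continuous_sin.
by apply/funext => v; rewrite mxE.
Qed.

(** Rotating by c = circ a is translating the uniform variable by a modulo 1. *)
Lemma phase_rotation {disp : measure_display} {Om : measurableType disp} (P : probability Om R)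
    (V : {RV P >-> T}) n (c : C) (A : set 'cV[C]_n) :
  (forall A, measurable A -> P (V @^-1` A) = uniform_prob (@ltr01 R) A) ->
  normc c = 1 -> measurable A ->
  P [set x | A (c *: const_mx (circ (V x)))] = P [set x | A (const_mx (circ (V x)))].
Proof.
move=> hV c1 mA; have [a a01 ->] := circ_onto c1.
pose S : set T := [set v : R | A (const_mx (circ v))].
have mS : measurable S by have := @measurable_circ n measurableT _ mA; rewrite setTI.
have mSa : measurable ((fun x : R => x + a) @^-1` S : set T).
  have mf : measurable_fun (setT : set T) ((fun x : R => x + a) : T -> T).
    by apply: measurable_funD => //; exact: measurable_cst.
  by have := mf measurableT S mS; rewrite setTI.
transitivity (P (V @^-1` ((fun x : R => x + a) @^-1` S))).
  congr (P _); apply/funext => x; rewrite /S /preimage /= circD; congr A.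
  by apply/matrixP => i j; rewrite !mxE mulrC.
rewrite hV // uniform_probE // periodic_lebesgue //; last by move=> x; rewrite /S /= circ1.
by rewrite -uniform_probE // -hV.
Qed.

End uniform_phase.

(** * Tight solutions of homogeneous equations *)

Section rigidity.
Context {R : realType} {disp : measure_display} {Om : measurableType disp}.
Variable P : probability Om R.
Local Notation C := R[i].
Local Notation pr := (pr P).
Variables (m : nat) (X : int -> Om -> 'cV[C]_m).
Hypothesis mX : measurable_process X.
Hypothesis tightX : tight P X.

(** X_t is dominated by arbitrarily small multiples of variables from a tight family,
so it exceeds any positive level with probability 0. *)
Lemma contracting_zero (rho : R) : 0 <= rho < 1 ->
  (forall t n, exists s, {ae P, forall x, mxnorm (X t x) <= rho ^+ n * mxnorm (X s x)}) ->
  {ae P, forall x, forall t, X t x = 0}.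
Proof.
move=> /andP[r0 r1] hX; apply: ae_int => t.
have hk k : {ae P, forall x, mxnorm (X t x) <= k.+1%:R^-1}.
  have mE := measurable_norm_gt (k.+1%:R^-1) (mX t).
  have p0 : pr [set x | k.+1%:R^-1 < mxnorm (X t x)] = 0.
    apply/eqP; rewrite eq_le pr_ge0 andbT; apply/ler_addgt0Pr => e e0; rewrite add0r.
    have [K hK] := tightX e0.
    have [n hn] : exists n : nat, rho ^+ n * (`|K| + 1) <= k.+1%:R^-1.
      have : geometric (`|K| + 1) rho n @[n --> \oo] --> (0 : R).
        by apply: cvg_geometric; rewrite ger0_norm.
      have k0 : 0 < k.+1%:R^-1 :> R by rewrite invr_gt0.
      move=> /cvgrPdist_lt /(_ _ k0) [n _ hn]; exists n.
      have := hn n (leqnn n); rewrite /= sub0r normrN => /ltW; apply: le_trans.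
      by rewrite mulrC; exact: ler_norm.
    have [s hs] := hX t n.
    apply: le_trans (hK s); apply: pr_ae_le => //; first exact: measurable_norm_gt.
    apply: filterS hs => x h1 /= h2; rewrite ltNge; apply/negP => h3.
    move: h2; apply/negP; rewrite -leNgt; apply: le_trans h1 _; apply: le_trans hn.
    rewrite ler_wpM2l ?exprn_ge0 //; apply: le_trans h3 _; have := ler_norm K; lra.
  by have := ae_of_pr0 mE p0; apply: filterS => x /= /negP; rewrite -leNgt.
apply: filterS (ae_foralln hk) => x hx; apply: mxnorm_eq0; apply/eqP.
rewrite eq_le mxnorm_ge0 andbT; apply/ler_addgt0Pr => e e0; rewrite add0r.
have [k hke] : exists k : nat, k.+1%:R^-1 < e.
  exists (Num.truncn e^-1); rewrite invf_plt ?posrE //; exact: truncnS_gt.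
exact: le_trans (hx k) (ltW hke).
Qed.

(** The direction of time in which X grows geometrically is the past when |c| > 1 and
the future when |c| < 1. *)
Lemma first_order_zero (c : C) : normc c != 1 ->
  {ae P, forall x, forall t, X (t - 1) x = c *: X t x} ->
  {ae P, forall x, forall t, X t x = 0}.
Proof.
move=> c1 hX.
have iter : {ae P, forall x, forall n t, X (t - n%:Z) x = c ^+ n *: X t x}.
  apply: filterS hX => x hx; elim=> [|n IHn] t; first by rewrite subr0 scale1r.
  by rewrite (_ : t - n.+1%:Z = t - n%:Z - 1) ?hx ?IHn ?scalerA -?exprS //; lia.
have [h|h|h] := ltgtP (normc c) 1; last by rewrite h eqxx in c1.
- apply: (@contracting_zero (normc c)) => [|t n]; first by rewrite normc_ge0.
  exists (t + n%:Z); apply: filterS iter => x hx.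
  have := hx n (t + n%:Z); rewrite addrK => ->; by rewrite mxnormZ normcX.
- have c0 : normc c != 0 by rewrite gt_eqF // (lt_trans _ h).
  apply: (@contracting_zero (normc c)^-1) => [|t n].
    by rewrite invr_ge0 normc_ge0 invf_lt1 // (lt_trans _ h).
  exists (t - n%:Z); apply: filterS iter => x hx.
  by rewrite hx mxnormZ normcX exprVn mulKf // expf_neq0.
Qed.

End rigidity.

Section homogeneous.
Context {R : realType} {disp : measure_display} {Om : measurableType disp}.
Variable P : probability Om R.
Local Notation C := R[i].
Variables (m : nat) (X : int -> Om -> 'cV[C]_m).
Hypothesis mX : measurable_process X.
Hypothesis tightX : tight P X.

(** One factor B - c at a time: a tight process that grows geometrically in one
direction of time vanishes. *)
Lemma homogeneous_zero (delta : {poly C}) : delta != 0 ->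
  (forall c, normc c = 1 -> delta.[c] != 0) ->
  {ae P, forall x, forall t, mact (delta%:M : 'M[{poly C}]_m) (X ^~ x) t = 0} ->
  {ae P, forall x, forall t, X t x = 0}.
Proof.
move=> d0; have [rs dE] := closed_field_poly_normal delta.
have l0 : lead_coef delta != 0 by rewrite lead_coef_eq0.
move=> hc h.
have {}hc : all (fun c => normc c != 1) rs.
  apply/allP => c crs; apply/eqP => /hc; rewrite dE hornerZ mulf_eq0 (negbTE l0) /=.
  by rewrite -rootE root_prod_XsubC crs.
have {}h : {ae P, forall x, forall t,
    mact ((\prod_(c <- rs) ('X - c%:P))%:M : 'M[{poly C}]_m) (X ^~ x) t = 0}.
  apply: filterS h => x hx t; apply/matrixP => i j; rewrite mact_scalar mxE.
  have := hx t => /matrixP /(_ i j); rewrite mact_scalar mxE dE -mul_polyC pactM pactC.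
  by move=> /eqP; rewrite mulf_eq0 (negbTE l0) /= => /eqP.
elim: rs hc h {dE} => [_ h|c rs IHrs /= /andP[c1 hrs] h].
  apply: filterS h => x hx t; apply/matrixP => i j; have := hx t => /matrixP /(_ i j).
  by rewrite mact_scalar big_nil pact1.
apply: IHrs => //.
pose Y t x := mact ((\prod_(c <- rs) ('X - c%:P))%:M : 'M[{poly C}]_m) (X ^~ x) t.
have mY : measurable_process Y by exact: measurable_mact.
have tY : tight P Y by exact: tight_mact.
apply: (first_order_zero mY tY c1); apply: filterS h => x hx t.
have := hx t; rewrite big_cons scalar_mxM mactM => hx'.
apply/eqP; rewrite -subr_eq0; apply/eqP; rewrite -hx'.
apply/matrixP => i j; rewrite [RHS]mact_scalar pactXsubC [LHS]mxE; congr (_ + _).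
by rewrite [LHS]mxE; congr (- _); rewrite [LHS]mxE.
Qed.

End homogeneous.

(** ** The noise path together with a random phase *)

Section path_with_phase.
Context {R : realType} {disp : measure_display} {Om : measurableType disp}.
Variable P : probability Om R.
Local Notation C := R[i].
Variables (d m : nat) (W : int -> {RV P >-> 'cV[C]_d}) (xi : Om -> 'cV[C]_d) (c : C).
Hypothesis iidW : iid W.
Hypothesis mxi : measurable_fun setT xi.
Hypothesis c_neq0 : c != 0.
Hypothesis xi_ind : forall (D : set 'cV[C]_d) (pi : int -> int) (J : seq int)
    (A : int -> set 'cV[C]_d), measurable D -> (forall t, measurable (A t)) ->
  P ([set x | D (xi x)] `&` \bigcap_(t in [set` J]) (W (pi t) @^-1` A t)) =
  (P [set x | D (xi x)] * P (\bigcap_(t in [set` J]) (W (pi t) @^-1` A t)))%E.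
Hypothesis xi_inv : forall (h : int) (D : set 'cV[C]_d), measurable D ->
  P [set x | D (c ^ h *: xi x)] = P [set x | D (xi x)].

Let mW t : measurable_fun setT (W t). Proof. exact: measurable_funPT. Qed.

(** The phase picks up the factor c ^ (- h) when time is shifted by h, and its law does
not notice; None is the index of the phase. *)
Definition path_phase (h : int) (o : option int) (x : Om) : 'cV[C]_d :=
  if o is Some s then W (s + h) x else c ^ (- h) *: xi x.

Lemma measurable_path_phase h o : measurable_fun setT (path_phase h o).
Proof. by case: o => [s|] /=; [exact: mW|exact: measurable_scale]. Qed.

Lemma path_phase_law h (I : seq (option int)) (A : option int -> set 'cV[C]_d) :
  uniq I -> (forall t, measurable (A t)) ->
  P (\bigcap_(t in [set` I]) (path_phase h t @^-1` A t)) =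
  P (\bigcap_(t in [set` I]) (path_phase 0 t @^-1` A t)).
Proof.
move=> uI mA; pose J := pmap id I; pose D := if None \in I then A None else setT.
have uJ : uniq J by apply: (pmap_uniq (g := Some)) uI; case.
have mD : measurable D by rewrite /D; case: ifP.
have memJ s : (s \in J) = (Some s \in I) by rewrite mem_pmap map_id.
have split h' : \bigcap_(t in [set` I]) (path_phase h' t @^-1` A t) =
    [set x | D (c ^ (- h') *: xi x)] `&` \bigcap_(s in [set` J]) (W (s + h') @^-1` A (Some s)).
  apply/seteqP; split=> x.
    move=> hx; split; first by rewrite /D /=; case: ifP => // /(hx None).
    by move=> s /=; rewrite memJ => /(hx (Some s)).
  move=> [hD hJ] [s|] /= ht; first by apply: hJ; rewrite /= memJ.
  by move: hD; rewrite /D /= ht.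
have value h' : P (\bigcap_(t in [set` I]) (path_phase h' t @^-1` A t)) =
    (P [set x | D (xi x)] * \prod_(s <- J) P (W 0%R @^-1` A (Some s)))%E.
  rewrite split; pose D' := [set z | D (c ^ (- h') *: z)].
  have mD' : measurable D'.
    have := measurable_scale (c ^ (- h')) (@measurable_id _ 'cV[C]_d setT).
    by move=> /(_ measurableT _ mD); rewrite setTI.
  have := xi_ind (fun s => s + h') J (A := fun s => A (Some s)) mD' (fun s => mA (Some s)).
  rewrite /D' /= => ->; rewrite xi_inv //; congr (_ * _)%E.
  have inj : injective (fun s : int => s + h') by move=> s s' /addIr.
  exact: (cylinder_prob_shift iidW.1 iidW.2 inj uJ (fun s => mA (Some s))).
by rewrite !value.
Qed.

Variables (M : int -> 'M[C]_(m, d)) (vu : 'cV[C]_d) (g : 'cV[C]_m) (G0 : 'M[C]_(m, d)).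

(** The moving average plus the homogeneous solution with values G0 c ^ (- t) xi; for
G0 = 0 it is the moving average alone. *)
Definition ma_with_phase (t : int) (x : Om) : 'cV[C]_m :=
  g + ma_limit M (fun s => W (s + t) x - vu) + G0 *m (c ^ (- t) *: xi x).

Let SO := @seqspace (option int) _ 'cV[C]_d setT.
Let F (z : option int -> 'cV[C]_d) : 'cV[C]_m :=
  g + ma_limit M (fun s => z (Some s) - vu) + G0 *m z None.
Let sh (t : int) (z : option int -> 'cV[C]_d) (o : option int) : 'cV[C]_d :=
  if o is Some s then z (Some (s + t)) else c ^ (- t) *: z None.

Let mF : measurable_fun setT (F : SO -> 'cV[C]_m).
Proof.
apply: measurable_mxD; last first.
  by apply: measurable_mulmx; exact: measurable_coord.
apply: measurable_mxD; first exact: measurable_cst.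
apply: (@measurableT_comp _ _ _ _ _ _ (ma_limit M : @seqspace int _ 'cV[C]_d setT -> 'cV[C]_m) _
  (fun z : SO => (fun s => z (Some s) - vu))); first exact: measurable_ma_limit.
apply: (@measurable_seqspace int _ _ _ SO setT (fun s z => z (Some s) - vu)) => s.
by apply: measurable_mxB; [exact: measurable_coord|exact: measurable_cst].
Qed.

Let msh t : measurable_fun setT (sh t : SO -> SO).
Proof.
apply: (@measurable_seqspace (option int) _ _ _ SO setT (fun o z => sh t z o)) => -[s|].
  exact: measurable_coord.
by apply: measurable_scale; exact: measurable_coord.
Qed.

Let phaseE t h x : ma_with_phase (t + h) x = F (sh t ((path_phase h) ^~ x)).
Proof.
have e1 : (fun s => W (s + (t + h)) x - vu) =
    (fun s => sh t ((path_phase h) ^~ x) (Some s) - vu).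
  by apply/funext => s; rewrite /sh /path_phase addrA.
have e2 : c ^ (- (t + h)) *: xi x = sh t ((path_phase h) ^~ x) None.
  by rewrite /sh /path_phase scalerA -expfzDr // opprD.
by rewrite /ma_with_phase e1 e2.
Qed.

Lemma measurable_ma_with_phase t : measurable_fun setT (ma_with_phase t).
Proof.
rewrite [X in measurable_fun _ X](_ : _ = F \o (sh t \o (fun x => (path_phase 0) ^~ x))).
  apply: measurableT_comp mF _; apply: measurableT_comp (msh t) _.
  exact: (@measurable_seqspace (option int) _ _ _ Om setT (path_phase 0)) (measurable_path_phase 0).
by apply/funext => x /=; rewrite -phaseE addr0.
Qed.

Lemma stationary_ma_with_phase (Y : int -> {RV P >-> 'cV[C]_m}) :
  (forall t x, Y t x = ma_with_phase t x) -> strictly_stationary Y.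
Proof.
move=> hY; apply: (stationary_of_law (X := path_phase) (F := F)) => //.
- exact: measurable_path_phase.
- exact: path_phase_law.
by exists sh; split; [exact: msh|move=> t h x; rewrite hY phaseE].
Qed.

End path_with_phase.

(** * Unit roots *)

Section unit_root.
Context {F : fieldType}.

Lemma solvable_dual m n (A : 'M[F]_(m, n)) (y : 'cV[F]_m) :
  (forall a : 'rV[F]_m, a *m A = 0 -> a *m y = 0) -> exists g : 'cV[F]_n, A *m g = y.
Proof.
move=> h; have : (y^T <= A^T)%MS.
  rewrite submxE; apply/eqP/trmx_inj; rewrite trmx_mul trmxK trmx0.
  apply/row_matrixP => i; rewrite row_mul row0; apply: h.
  by rewrite -row_mul -[A in _ *m A]trmxK -trmx_mul mulmx_coker trmx0 row0.
by move=> /submxP[D e]; exists D^T; apply: trmx_inj; rewrite trmx_mul trmxK.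
Qed.

Lemma mactZl m n l (p : {poly F}) (A : 'M[{poly F}]_(m, n)) (x : int -> 'M[F]_(n, l)) t i j :
  mact (p *: A) x t i j = pact p (fun s => mact A x s i j) t.
Proof.
rewrite mxE; under eq_bigr do rewrite mxE pactM.
by rewrite -pact_sumr; apply: eq_pact => s; rewrite mxE.
Qed.

(** Entries that vanish at 1 are divisible by X - 1, which acts as a difference in time. *)
Lemma divide_difference m n (A : 'M[{poly F}]_(m, n)) : map_mx (horner^~ 1) A = 0 ->
  exists B : 'M[{poly F}]_(m, n), forall l (x : int -> 'M[F]_(n, l)) t,
    mact A x t = mact B x (t - 1) - mact B x t.
Proof.
move=> h; exists (map_mx (fun r => r %/ ('X - 1%:P)) A) => l x t.
have {1}-> : A = ('X - 1%:P) *: map_mx (fun r => r %/ ('X - 1%:P)) A.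
  apply/matrixP => i j; rewrite !mxE mulrC divpK // dvdp_XsubCl rootE.
  by have := congr1 (fun B : 'M[F]_(m, n) => B i j) h; rewrite !mxE => ->.
apply/matrixP => i j; rewrite mactZl pactXsubC mul1r [RHS]mxE; congr (_ + _).
by rewrite [RHS]mxE.
Qed.

Lemma pact_exponential (p : {poly F}) (c w : F) t : c != 0 ->
  pact p (fun s => c ^ (- s) * w) t = c ^ (- t) * (p.[c] * w).
Proof.
move=> c0; rewrite /pact horner_coef mulr_suml mulr_sumr; apply: eq_bigr => e _.
by rewrite opprB addrC expfzDr // -exprnP; ring.
Qed.

(** The backshift operator multiplies c ^ (- t) by c. *)
Lemma mact_exponential m n (A : 'M[{poly F}]_(m, n)) (c : F) (v : 'cV[F]_n) t : c != 0 ->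
  mact A (fun s => c ^ (- s) *: v) t = c ^ (- t) *: (map_mx (horner^~ c) A *m v).
Proof.
move=> c0; apply/matrixP => i j; rewrite !mxE mulr_sumr; apply: eq_bigr => k _.
transitivity (pact (A i k) (fun s => c ^ (- s) * v k j) t).
  by apply: eq_pact => s; rewrite mxE.
by rewrite pact_exponential // mxE.
Qed.

End unit_root.

Section unit_root_necessity.
Context {R : realType} {disp : measure_display} {Om : measurableType disp}.
Variable P : probability Om R.
Local Notation C := R[i].
Local Notation pr := (pr P).

(** Where P (1) and Q (1) degenerate in a common direction a, the equation can be
summed: b (B) Y - e (B) W changes by the fixed amount a kappa at each step, and a
tight process has no drift. *)
Lemma no_drift d m (Y : int -> Om -> 'cV[C]_m) (W : int -> Om -> 'cV[C]_d)
    (A : 'M[{poly C}]_m) (B : 'M[{poly C}]_(m, d)) (kappa : 'cV[C]_m) (a : 'rV[C]_m) :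
  measurable_process Y -> measurable_process W -> tight P Y -> tight P W ->
  {ae P, forall x, forall t, mact A (Y ^~ x) t = mact B (W ^~ x) t + kappa} ->
  a *m map_mx (horner^~ 1) A = 0 -> a *m map_mx (horner^~ 1) B = 0 -> a *m kappa = 0.
Proof.
move=> mY mW tY tW hYW aA aB.
have [b hb] : exists b : 'M[{poly C}]_(1, m), forall l (x : int -> 'M[C]_(m, l)) t,
    mact (map_mx polyC a *m A) x t = mact b x (t - 1) - mact b x t.
  by apply: divide_difference; rewrite map_horner_mulmx map_horner_polyC.
have [e he] : exists e : 'M[{poly C}]_(1, d), forall l (x : int -> 'M[C]_(d, l)) t,
    mact (map_mx polyC a *m B) x t = mact e x (t - 1) - mact e x t.
  by apply: divide_difference; rewrite map_horner_mulmx map_horner_polyC.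
pose X t x := mact b (Y ^~ x) t + mact (- e) (W ^~ x) t.
have m1 : measurable_process (fun t x => mact b (Y ^~ x) t) by exact: measurable_mact.
have m2 : measurable_process (fun t x => mact (- e) (W ^~ x) t) by exact: measurable_mact.
have mX : measurable_process X by move=> t; apply: measurable_mxD; [exact: m1|exact: m2].
have tX : tight P X by apply: tightD => //; exact: tight_mact.
have eN x t : mact (- e) (W ^~ x) t = - mact e (W ^~ x) t.
  by apply/eqP; rewrite -addr_eq0 -mactDl addNr mact0l.
have step : {ae P, forall x, forall n : nat, X (- n%:Z) x = X 0 x + n%:R *: (a *m kappa)}.
  apply: filterS hYW => x hx; elim=> [|n IHn]; first by rewrite scale0r addr0.
  have := congr1 (mulmx a) (hx (- n%:Z)); rewrite mulmxDr.
  rewrite -(mact_const a (mact A (Y ^~ x))) -(mact_const a (mact B (W ^~ x))) -!mactM hb he => h.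
  have -> : - n.+1%:Z = - n%:Z - 1 :> int by lia.
  have -> : X (- n%:Z - 1) x = X (- n%:Z) x + a *m kappa.
    rewrite /X !eN; move: h; move: (mact b _ _) (mact b _ _) (mact e _ _) (mact e _ _) => b1 b2 e1 e2 h.
    have -> : b2 = e2 - e1 + a *m kappa + b1 by rewrite -h subrK.
    apply/matrixP => i j; rewrite !mxE; ring.
  by rewrite IHn -addrA -natr1 scalerDl scale1r.
have e0 : 0 < 4^-1 :> R by rewrite invr_gt0.
have [K hK] := tX _ e0.
apply: mxnorm_eq0; apply/eqP; rewrite eq_le mxnorm_ge0 andbT leNgt; apply/negP => k0.
have [n hn] : exists n : nat, K + K < n%:R * mxnorm (a *m kappa).
  by exists (Num.truncn ((K + K) / mxnorm (a *m kappa))).+1; rewrite -ltr_pdivrMr //; exact: truncnS_gt.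
have mE t := measurable_norm_gt K (mX t).
have : pr ([set x | K < mxnorm (X (- n%:Z) x)] `|` [set x | K < mxnorm (X 0 x)]) = 1.
  apply: pr_ae1; first exact: measurableU.
  apply: filterS step => x hx /=; apply: contrapT => /not_orP[/negP h1 /negP h2].
  rewrite -!leNgt in h1 h2; move: hn; apply/negP; rewrite -leNgt.
  have <- : mxnorm (X (- n%:Z) x - X 0 x) = n%:R * mxnorm (a *m kappa).
    rewrite hx addrAC subrr add0r mxnormZ; congr (_ * _).
    by rewrite normcMn normc1.
  by apply: le_trans (mxnormD _ _) _; rewrite mxnormN lerD.
have := prU_le P (mE (- n%:Z)) (mE 0); have := hK (- n%:Z); have := hK 0; lra.
Qed.

End unit_root_necessity.

(** * The ARMA equation *)

Section arma.
Context {R : realType} {disp : measure_display} {Om : measurableType disp}.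
Variable P : probability Om R.
Local Notation C := R[i].
Local Notation pr := (pr P).
Variables (m d p q s : nat) (Psi : 'I_p -> 'M[C]_m) (Theta : 'I_q.+1 -> 'M[C]_(m, d)).
Variables (Us : 'M[C]_d) (Z W : int -> {RV P >-> 'cV[C]_d}) (u0 : 'cV[C]_d).
Hypothesis m_gt0 : (0 < m)%N.
Hypothesis iidW : iid W.
Hypothesis ZW : forall t x, Z t x = Us *m W t x.
Hypothesis W_split : {ae P, forall x, forall t, W t x = (pid_mx s : 'M[C]_d) *m W t x + u0}.

Let mW t : measurable_fun setT (W t). Proof. exact: measurable_funPT. Qed.
Let mWp : measurable_process (fun t => W t : Om -> _). Proof. exact: mW. Qed.

Definition noise_mx : 'M[C]_d := Us *m pid_mx s.

Let V := noise_mx.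
Let N := numX Psi Theta V.
Let B : 'M[{poly C}]_(m, d) := maX Theta *m map_mx polyC V.
Let delta := detX Psi.

(** The constant coordinates of the noise contribute the same vector to the right-hand
side at all times. *)
Definition const_input : 'cV[C]_m := ma_poly Theta 1 *m (Us *m u0).

Lemma maX_noise : {ae P, forall x, forall t,
  mact (maX Theta) (fun k => Z k x) t = mact B (fun k => W k x) t + const_input}.
Proof.
apply: filterS W_split => x hx t.
have e k : Z k x = V *m W k x + Us *m u0 by rewrite ZW {1}hx mulmxDr mulmxA.
rewrite (eq_mact _ _ e) mactDr mact_cst maX_eval; congr (_ + _).
by rewrite /B mactM; apply: eq_mact => k; rewrite mact_const.
Qed.

Lemma arma_solutionP (Y : int -> {RV P >-> 'cV[C]_m}) :
  arma_solution Psi Theta Z Y <-> {ae P, forall x, forall t,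
    mact (arX Psi) (fun k => Y k x) t = mact B (fun k => W k x) t + const_input}.
Proof.
split=> [/ae_int h|h].
  apply: filterS2 h maX_noise => x h1 h2 t.
  by rewrite -h2 mact_arX mact_maX h1.
move=> t; apply: filterS2 h maX_noise => x h1 h2.
by rewrite -(mact_arX Psi (fun k => Y k x)) -(mact_maX Theta (fun k => Z k x)) h1 h2.
Qed.

(** Multiplying P by its adjugate decouples the components of Y, at the price of
replacing Q by the numerators of the transfer function. *)
Lemma det_equation (Y : int -> {RV P >-> 'cV[C]_m}) : arma_solution Psi Theta Z Y ->
  {ae P, forall x, forall t, mact (delta%:M : 'M[{poly C}]_m) (fun k => Y k x) t =
    mact N (fun k => W k x) t + map_mx (horner^~ 1) (\adj (arX Psi)) *m const_input}.
Proof.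
move=> /arma_solutionP; apply: filterS => x hx t.
by rewrite -mul_adj_mx mactM (eq_mact _ _ hx) mactDr mact_cst -mactM.
Qed.

Lemma numX_degenerate i (j : 'I_d) : (s <= j)%N -> N i j = 0.
Proof.
move=> sj; rewrite /N /numX /V /noise_mx map_mxM !mulmxA mxE big1 // => k _.
rewrite [map_mx _ _ _ _]mxE [pid_mx _ _ _]mxE.
by case: eqP => [e|_]; rewrite ?mulr0 // ltnNge e sj mulr0.
Qed.

Hypothesis nondeg : forall rho : 'rV[C]_d,
  (forall c : R, 0 < c -> pr [set x | c < normc ((rho *m (W 0 x - W 1 x)) 0 0)] = 0) ->
  rho *m (pid_mx s : 'M[C]_d) = 0.

Lemma tightW : tight P (fun t => W t : Om -> _).
Proof. by apply: tight_identically => //; exact: iidW.2. Qed.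

Lemma poles_removable (Y : int -> {RV P >-> 'cV[C]_m}) : strictly_stationary Y ->
  arma_solution Psi Theta Z Y ->
  removable_on_circle (singularities Psi) (transferV Psi Theta V).
Proof.
move=> sY /det_equation eY; apply: circle_divides_removable => i j c k c1 hk.
have mY : measurable_process (fun t => Y t : Om -> _) by move=> t; exact: measurable_funPT.
exact: (circle_zero_divides iidW nondeg mY (tight_stationary sY) numX_degenerate eY i c1 hk j).
Qed.

Section laurent_coefficients.
Variable M : int -> 'M[C]_(m, d).
Hypothesis laurentM : laurent_expansion (singularities Psi) (transferV Psi Theta V) M.

Let geoM i j : geo (fun k => M k i j). Proof. exact: laurent_expansion_geo laurentM i j. Qed.
Let recM k : mact (arX Psi) M k = mxpolyseqz B k.
Proof. exact: laurent_coef_recurrence laurentM k. Qed.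
Let recD k : mact (delta%:M : 'M[{poly C}]_m) M k = mxpolyseqz N k.
Proof. exact: laurent_det_recurrence recM k. Qed.

Let window k := ((m * p + q)%N%:Z - p%:Z + 1 <= k <= (m * p + q)%N%:Z) || (- p%:Z <= k <= -1).

(** The window of the moment condition starts at (m - 1) p + q + 1, just above the
degree of the numerators. *)
Lemma window_far k : window k -> k < 0 \/ (m.-1 * p + q)%N%:Z < k.
Proof.
move=> hk; have := mulSn m.-1 p; rewrite prednK // => e; move: hk; rewrite /window e.
by case/orP => /andP[h1 h2]; [right|left]; lia.
Qed.

Lemma moments_of_tails (nrm : 'cV[C]_m -> R) (K b0 : R) : vector_norm nrm -> 0 < K ->
  (forall b : nat, \sum_(k < b.*2) pr [set x | K < mxnorm (M (k%:Z - b%:Z) *m W 0 x)] <= b0) ->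
  forall k, window k -> ('E_P[fun x => log_plus (nrm (M k *m W 0 x))] < +oo)%E.
Proof.
move=> NP K0 hK k hk; have [c c0 hc] := vnorm_le_mxnorm NP.
have mn : measurable_fun setT (fun x => nrm (M k *m W 0 x)).
  by apply: measurable_vnorm => //; exact: measurable_mulmx.
apply: (@log_moment_le_sum _ _ _ P 1 _ (fun _ x => mxnorm (M k *m W 0 x)) c) => //.
- by move=> i; apply: measurable_mxnorm; exact: measurable_mulmx.
- by move=> x; rewrite big_ord1.
move=> _ _; exact: (log_moments_of_tails (detX0 Psi) (size_numX Psi Theta V) recD K0 hK (window_far hk)).
Qed.

Lemma moments_of_solution (nrm : 'cV[C]_m -> R) (Y : int -> {RV P >-> 'cV[C]_m}) :
  vector_norm nrm -> strictly_stationary Y -> arma_solution Psi Theta Z Y ->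
  forall k, window k -> ('E_P[fun x => log_plus (nrm (M k *m W 0 x))] < +oo)%E.
Proof.
move=> NP sY /det_equation eY.
have mY : measurable_process (fun t => Y t : Om -> _) by move=> t; exact: measurable_funPT.
have [K [b0 [K0 hK]]] := coef_tails_summable iidW (detX_neq0 Psi) mY (tight_stationary sY) eY geoM recD.
exact: moments_of_tails hK.
Qed.

Lemma moments_of_abs_cvg (nrm : 'cV[C]_m -> R) : vector_norm nrm ->
  {ae P, forall x, abs_cvg nrm (fun j => M j *m W (0 - j) x)} ->
  forall k, window k -> ('E_P[fun x => log_plus (nrm (M k *m W 0 x))] < +oo)%E.
Proof.
move=> NP h.
have {}h : {ae P, forall x, abs_cvg nrm (fun j => M j *m W (- j) x)}.
  apply: filterS h => x; rewrite /abs_cvg; under [X in (X < _)%E -> _]eq_esum do rewrite sub0r.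
  exact.
have [K [K0 hK]] := tails_of_abs_cvg iidW NP h.
exact: moments_of_tails hK.
Qed.

(** Feeding a constant into the moving average shows that P (1) divides Q (1) on the
non-degenerate directions. *)
Lemma const_response (v : 'cV[C]_d) : exists L : 'cV[C]_m,
  ar_poly Psi 1 *m L = ma_poly Theta 1 *m (V *m v).
Proof.
have gv i : geo (fun j => (M j *m v) i 0).
  have -> : (fun j => (M j *m v) i 0) = (fun j => \sum_(k <- index_enum 'I_d) v k 0 * M j i k).
    by apply/funext => j; rewrite mxE; apply: eq_bigr => k _; rewrite mulrC.
  by apply: geo_sum => k; exact: geoZ.
have /choice[l hl] : forall i, exists l, has_zsum (fun j => (M j *m v) i 0) l.
  by move=> i; exact: geo_zsum.
exists (\col_i l i).
have := @convolution_recurrence _ _ _ M (fun=> v) (fun=> \col_i l i) _ _ (arX Psi) B recM 0.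
rewrite !mact_cst arX_eval /B map_horner_mulmx maX_eval map_horner_polyC mulmxA; apply.
by move=> t i; rewrite mxE; exact: hl.
Qed.

(** By duality it is enough to pair with a row a such that a P (1) = 0; const_response
then gives a Q (1) V = 0 and no_drift excludes a constant input in the direction
a. *)
Lemma linear_equation_of_solution (Y : int -> {RV P >-> 'cV[C]_m}) :
  strictly_stationary Y -> arma_solution Psi Theta Z Y ->
  exists g, ar_poly Psi 1 *m g = const_input.
Proof.
move=> sY /arma_solutionP eY; apply: solvable_dual => a ha.
have mY : measurable_process (fun t => Y t : Om -> _) by move=> t; exact: measurable_funPT.
apply: (no_drift mY mWp (tight_stationary sY) tightW eY); rewrite ?arX_eval //.
rewrite /B map_horner_mulmx maX_eval map_horner_polyC.
apply/matrixP => i k; have [L hL] := const_response (delta_mx k 0).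
have e : a *m (ma_poly Theta 1 *m (V *m (delta_mx k 0 : 'cV[C]_d))) = 0.
  by rewrite -hL mulmxA ha mul0mx.
rewrite (mulmxA _ V) mulmxA -colE in e.
by have := congr1 (fun x : 'cV[C]_1 => x i 0) e; rewrite [X in X = _ -> _]mxE => ->; rewrite !mxE.
Qed.

Section sufficiency.
Variable nrm : 'cV[C]_m -> R.
Hypothesis NP : vector_norm nrm.
Hypothesis moments : forall k, window k ->
  ('E_P[fun x => log_plus (nrm (M k *m W 0 x))] < +oo)%E.

Lemma noise_terms_geo : {ae P, forall x, forall t i, geo (fun j => (M j *m W (t - j) x) i 0)}.
Proof.
have [c c0 hc] := mxnorm_le_vnorm NP.
have topE : (q + p <= m * p + q)%N by rewrite addnC leq_add2r leq_pmull.
apply: (terms_geo m_gt0 topE (size_maX_mul Theta V) geoM recM iidW) => k hk.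
apply: (@log_moment_le_sum _ _ _ P 1 _ (fun _ x => nrm (M k *m W 0 x)) c) => //.
- by apply: measurable_mxnorm; exact: measurable_mulmx.
- by move=> i; apply: measurable_vnorm => //; exact: measurable_mulmx.
- by move=> x; rewrite big_ord1.
by move=> _ _; apply: moments; rewrite /window; case: hk => hk; apply/orP; [left|right]; lia.
Qed.

Lemma abs_cvg_noise t : {ae P, forall x, abs_cvg nrm (fun j => M j *m W (t - j) x)}.
Proof. by apply: filterS noise_terms_geo => x hx; apply: abs_cvg_geo. Qed.

Variables (vu : 'cV[C]_d) (g : 'cV[C]_m).
Hypothesis vuE : vu = (pid_mx s : 'M[C]_d) *m vu + u0.
Hypothesis lin : ar_poly Psi 1 *m g = ma_poly Theta 1 *m (Us *m vu).

(** Subtracting vu from the noise subtracts the convolution of M with a constant, which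
decays geometrically by itself; the constant g compensates for it in the equation
by the choice of the linear equation. *)
Lemma deviations : {ae P, forall x, exists L : int -> 'cV[C]_m,
  [/\ forall t i, has_zsum (fun j => (M j *m (W (t - j) x - vu)) i 0) (L t i 0),
      forall t, abs_cvg nrm (fun j => M j *m (W (t - j) x - vu)) &
      forall t, mact (arX Psi) (fun k => g + L k) t =
        mact B (fun k => W k x) t + const_input]}.
Proof.
apply: filterS noise_terms_geo => x hx.
have gv t i : geo (fun j => (M j *m (W (t - j) x - vu)) i 0).
  have -> : (fun j => (M j *m (W (t - j) x - vu)) i 0) = (fun j => (M j *m W (t - j) x) i 0 +
      -1 * \sum_(k <- index_enum 'I_d) vu k 0 * M j i k).
    apply/funext => j; rewrite mulmxBr mxE [X in _ + X]mxE mulN1r; congr (_ - _).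
    by rewrite mxE; apply: eq_bigr => k _; rewrite mulrC.
  by apply: geoD => //; apply: geoZ; apply: geo_sum => k; exact: geoZ.
have /choice[l hl] : forall ti : int * 'I_m, exists l,
    has_zsum (fun j => (M j *m (W (ti.1 - j) x - vu)) ti.2 0) l.
  by move=> ti; exact: geo_zsum.
exists (fun t => \col_i l (t, i)); split.
- by move=> t i; rewrite mxE; exact: (hl (t, i)).
- by move=> t; apply: abs_cvg_geo => // i; exact: gv.
move=> t; rewrite mactDr mact_cst arX_eval lin.
rewrite (@convolution_recurrence _ _ _ M (fun k => W k x - vu) _ _ _ (arX Psi) B recM); last first.
  by move=> t' i; rewrite mxE; exact: (hl (t', i)).
rewrite mactBr mact_cst /B map_horner_mulmx maX_eval map_horner_polyC.
rewrite addrCA; congr (_ + _); rewrite {1}vuE mulmxDr mulmxDr mulmxA -/V -mulmxA addrAC.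
by rewrite !mulmxA subrr add0r /const_input mulmxA.
Qed.

Lemma ma_limit_solution (Y : int -> {RV P >-> 'cV[C]_m}) :
  {ae P, forall x, forall t, Y t x = g + ma_limit M (fun k => W (k + t) x - vu)} ->
  arma_solution Psi Theta Z Y /\ forall t, {ae P, forall x,
    abs_cvg nrm (fun j => M j *m (W (t - j) x - vu)) /\
    Y t x = g + zseries_sum (fun j => M j *m (W (t - j) x - vu))}.
Proof.
move=> hY.
have key : {ae P, forall x, exists L : int -> 'cV[C]_m,
  [/\ forall t, Y t x = g + L t, forall t, mact (arX Psi) (fun k => g + L k) t =
        mact B (fun k => W k x) t + const_input,
      forall t, abs_cvg nrm (fun j => M j *m (W (t - j) x - vu)) &
      forall t, zseries_sum (fun j => M j *m (W (t - j) x - vu)) = L t]}.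
  apply: filterS2 hY deviations => x h1 [L [h2 h3 h4]]; exists L; split => // t.
    rewrite h1; congr (_ + _); apply: ma_limitE => i.
    by apply: eq_has_zsum (h2 t i) => j; congr ((M j *m (W _ x - vu)) i 0); exact: addrC.
  by apply: (mx_zsumP _).2 => i j; rewrite (ord1 j); exact: h2.
split; last first.
  by move=> t; apply: filterS key => x [L [h1 h2 h3 h4]]; rewrite h4.
apply/arma_solutionP; apply: filterS key => x [L [h1 h2 h3 h4]] t.
by rewrite (eq_mact _ _ h1) h2.
Qed.

End sufficiency.
End laurent_coefficients.
End arma.

(** * Uniqueness *)

Section uniqueness.
Context {R : realType} {disp : measure_display} {Om : measurableType disp}.
Variable P : probability Om R.
Local Notation C := R[i].
Variables (m d p q : nat) (Psi : 'I_p -> 'M[C]_m) (Theta : 'I_q.+1 -> 'M[C]_(m, d)).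
Variable Z : int -> {RV P >-> 'cV[C]_d}.

(** The difference of two stationary solutions is tight, though not known to be
stationary, and solves the homogeneous equation for det P. *)
Lemma solution_unique (Y Y' : int -> {RV P >-> 'cV[C]_m}) :
  (forall z : C, normc z = 1 -> \det (ar_poly Psi z) != 0) ->
  strictly_stationary Y -> arma_solution Psi Theta Z Y ->
  strictly_stationary Y' -> arma_solution Psi Theta Z Y' ->
  forall t, {ae P, forall x, Y' t x = Y t x}.
Proof.
move=> hdet sY /ae_int aY sY' /ae_int aY'.
have mY : measurable_process (fun t => Y t : Om -> _) by move=> t; exact: measurable_funPT.
have mY' : measurable_process (fun t => Y' t : Om -> _) by move=> t; exact: measurable_funPT.
pose D t x := Y' t x + (-1 : C) *: Y t x.
have mD : measurable_process D.
  by move=> t; apply: measurable_mxD; [exact: mY'|apply: measurable_scale; exact: mY].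
have tD : tight P D.
  apply: tightD => //; [by move=> t; apply: measurable_scale; exact: mY|exact: tight_stationary|].
  move=> e e0; have [K hK] := tight_stationary sY e0; exists K => t.
  have n1 : normc (-1 : C) <= 1 by rewrite normcN normc1.
  by have := tails_leZ 0 n1 mY hK t; rewrite addr0.
have := homogeneous_zero mD tD (detX_neq0 Psi).
have hc c : normc c = 1 -> (detX Psi).[c] != 0 by rewrite detX_eval; exact: hdet.
move=> /(_ hc) h t; have {h} : {ae P, forall x, forall t, D t x = 0}.
  apply: h; apply: filterS2 aY aY' => x h1 h2 k.
  rewrite -mul_adj_mx mactM.
  have e k' : mact (arX Psi) (D ^~ x) k' = 0.
    have e2 s' : (-1 : C) *: Y s' x = - Y s' x by rewrite scaleN1r.
    by rewrite mactDr (eq_mact _ _ e2) mactNr !mact_arX h1 h2 subrr.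
  by rewrite (eq_mact _ _ e) mact_cst mulmx0.
by apply: filterS => x /(_ t) /eqP; rewrite /D scaleN1r subr_eq0 => /eqP.
Qed.

Variable W : int -> {RV P >-> 'cV[C]_d}.
Variable U : 'M[C]_d.
Hypothesis iidW : iid W.
Hypothesis WZ : forall t x, W t x = U *m Z t x.

(** When det P vanishes at a point z of the unit circle, z ^ (- t) g0 solves the
homogeneous equation, and a uniform independent phase makes it stationary together
with the noise. *)
Lemma nonunique (d_gt0 : (0 < d)%N) (Y : int -> {RV P >-> 'cV[C]_m}) M vu g (z : C) :
  supports_independent_uniform Z -> normc z = 1 -> \det (ar_poly Psi z) = 0 ->
  (forall t x, Y t x = g + ma_limit M (fun s => W (s + t) x - vu)) ->
  arma_solution Psi Theta Z Y ->
  exists Y', [/\ strictly_stationary Y', arma_solution Psi Theta Z Y'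
    & forall t x, Y' t x <> Y t x].
Proof.
move=> [V [hV indV]] z1 dz hY aY.
have z0 : z != 0 by rewrite -normc_eq0 z1 oner_neq0.
have [g0 g00 hg0] : exists2 g0 : 'cV[C]_m, g0 != 0 & ar_poly Psi z *m g0 = 0.
  have /det0P[v v0 hv] : \det (ar_poly Psi z)^T == 0 by rewrite det_tr dz.
  exists v^T; first by rewrite trmx_eq0.
  by apply: trmx_inj; rewrite trmx_mul trmxK hv trmx0.
pose xi x : 'cV[C]_d := const_mx (circ (V x)).
have mV : measurable_fun setT V by exact: measurable_funPT.
have mxi : measurable_fun setT xi by exact: measurableT_comp (@measurable_circ R d) mV.
have mZ t : measurable_fun setT (Z t) by exact: measurable_funPT.
pose G0 : 'M[C]_(m, d) := g0 *m delta_mx 0 (Ordinal d_gt0).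
have G0xi t x : G0 *m (z ^ (- t) *: xi x) = (circ (V x)) *: (z ^ (- t) *: g0).
  apply/matrixP => i j; rewrite (ord1 j) -scalemxAr /G0 -mulmxA -rowE !mxE big_ord1 !mxE; ring.
have xi_ind (D : set 'cV[C]_d) (pi : int -> int) (J : seq int) (A : int -> set 'cV[C]_d) :
    measurable D -> (forall t, measurable (A t)) ->
  P ([set x | D (xi x)] `&` \bigcap_(t in [set` J]) (W (pi t) @^-1` A t)) =
  (P [set x | D (xi x)] * P (\bigcap_(t in [set` J]) (W (pi t) @^-1` A t)))%E.
  move=> mD mA.
  have mS : measurable ((fun v : R => const_mx (circ v) : 'cV[C]_d) @^-1` D : set (measurableTypeR R)).
    by have := @measurable_circ R d measurableT _ mD; rewrite setTI.
  apply: (indV _ _ mS).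
  pose GZ : set (set Om) := \bigcup_t preimage_set_system [set: Om] (Z t) measurable.
  rewrite -/GZ bigcap_seq; elim: J => [|k J IHJ].
    by rewrite big_nil; exact: (@measurableT _ (g_sigma_algebraType GZ)).
  rewrite big_cons; apply: (@measurableI _ (g_sigma_algebraType GZ)) => //.
  apply: sub_sigma_algebra; exists (pi k) => //; exists [set y | A k (U *m y)].
    have mU : measurable_fun setT (fun y : 'cV[C]_d => U *m y).
      by apply: measurable_mulmx; exact: measurable_id.
    by have := mU measurableT _ (mA k); rewrite setTI.
  by rewrite setTI; apply/funext => x; rewrite /preimage /= WZ.
have xi_inv (h : int) (D : set 'cV[C]_d) : measurable D ->
    P [set x | D (z ^ h *: xi x)] = P [set x | D (xi x)].
  move=> mD; apply: (phase_rotation hV) => //.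
  case: h => n; first by rewrite -exprnP normcX z1 expr1n.
  by rewrite NegzE -exprnN normcV normcX z1 expr1n invr1.
have mY' t : measurable_fun setT (ma_with_phase W xi z M vu g G0 t).
  exact: measurable_ma_with_phase.
have /choice[Y' hY'] : forall t, exists Yt : {RV P >-> 'cV[C]_m},
    forall x, Yt x = ma_with_phase W xi z M vu g G0 t x.
  by move=> t; exact: exists_RV (mY' t).
have e t x : Y' t x = Y t x + circ (V x) *: (z ^ (- t) *: g0).
  by rewrite hY' /ma_with_phase G0xi hY.
exists Y'; split.
- exact: (stationary_ma_with_phase iidW mxi z0 xi_ind xi_inv hY').
- move=> t; apply: filterS (aY t) => x <-.
  rewrite -(mact_arX Psi (fun k => Y' k x)) -(mact_arX Psi (fun k => Y k x)).
  have e' k : Y' k x = Y k x + z ^ (- k) *: (circ (V x) *: g0).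
    by rewrite e !scalerA [circ _ * _]mulrC.
  rewrite (eq_mact _ _ e') mactDr mact_exponential // arX_eval -scalemxAr hg0.
  by rewrite !scaler0 addr0.
- move=> t x /eqP; rewrite e addrC -subr_eq0 addrK !scaler_eq0 (negbTE g00) orbF.
  by rewrite -(normc_eq0 (circ _)) normc_circ oner_eq0 /= expfz_eq0 (negbTE z0) andbF.
Qed.

End uniqueness.

Local Open Scope sesquilinear_scope.

Theorem theorem2p2
    (R : realType) (disp : measure_display) (Om : measurableType disp)
    (P : probability Om R)
    (nrm : forall r : nat, 'cV[R[i]]_r -> R)
    (nrmP : forall r : nat, vector_norm (nrm r))
    (m d p q : nat) (m_gt0 : (0 < m)%N) (d_gt0 : (0 < d)%N) (p_gt0 : (0 < p)%N)
    (Z : int -> {RV P >-> 'cV[R[i]]_d}) (Z_iid : iid Z)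
    (Psi : 'I_p -> 'M[R[i]]_m) (Theta : 'I_q.+1 -> 'M[R[i]]_(m, d))
    (K : set 'cV[R[i]]_d) (KE : K = degenerate_directions (Z 0))
    (s : nat) (sE : s = subspace_dim (orthocomp K))
    (U : 'M[R[i]]_d) (U_unitary : U \is unitarymx)
    (UKperp : [set U *m x | x in orthocomp K] =
              [set vstack w (0 : 'cV[R[i]]_(d - s)) | w in [set: 'cV[R[i]]_s]])
    (UK : [set U *m x | x in K] =
          [set vstack (0 : 'cV[R[i]]_s) v | v in [set: 'cV[R[i]]_(d - s)]]) :
  let singular := [set z : R[i] | \det (ar_poly Psi z) = 0] in
  let M := transfer Psi Theta U s in
  let Mc := laurent_coef singular M in
  let solution := fun Y : int -> {RV P >-> 'cV[R[i]]_m} =>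
    strictly_stationary Y /\ arma_solution Psi Theta Z Y in
  exists (u : 'cV[R[i]]_(d - s)) (w : int -> {RV P >-> 'cV[R[i]]_s}),
    let lin_eq := fun (v : 'cV[R[i]]_s) (g : 'cV[R[i]]_m) =>
      ar_poly Psi 1 *m g = ma_poly Theta 1 *m U ^t* *m vstack v u in
    let c_i := removable_on_circle singular M in
    let c_ii := forall j : int,
      ((m * p + q)%N%:Z - p%:Z + 1 <= j <= (m * p + q)%N%:Z) ||
        (- p%:Z <= j <= -1) ->
      ('E_P[fun x => (log_plus (nrm m (Mc j *m (U *m Z 0 x))))%R] < +oo)%E in
    let c_iii := exists v g, lin_eq v g in
    let c_ii' := forall t : int, {ae P, forall x,
      abs_cvg (nrm m) (fun j => Mc j *m (U *m Z (t - j) x))} in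
    let c_iii' := forall v, exists g, lin_eq v g in
    [/\ [/\ iid w,
            forall t, {ae P, forall x, U *m Z t x = vstack (w t x) u}
          & forall b : 'cV[R[i]]_s, b != 0 ->
              ~ dirac_degenerate P (fun x => b ^t* *m w 0 x)],
        (exists Y, solution Y) <-> [/\ c_i, c_ii & c_iii],
        c_i -> (c_ii <-> c_ii') /\ (c_iii <-> c_iii')
      & c_i -> c_ii -> c_iii ->
        forall v g, lin_eq v g ->
        let dev := fun t x (j : int) =>
          Mc j *m (U *m Z (t - j) x - vstack v u) in
        exists Y, [/\ solution Y,
          forall t, {ae P, forall x,
            abs_cvg (nrm m) (dev t x) /\ Y t x = g + zseries_sum (dev t x)}
        & supports_independent_uniform Z ->
          ((forall Y', solution Y' ->
              forall t, {ae P, forall x, Y' t x = Y t x}) <->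
           (forall z : R[i], `|z| = 1 -> \det (ar_poly Psi z) != 0))]].
Proof.
move=> singular M Mc solution.
have sd : (s <= d)%N.
  rewrite sE /subspace_dim; apply: leq_trans (dimvS (subvf _)) _.
  by rewrite dimvf /dim /= muln1.
have UU' : U *m U^t* = 1%:M by exact/unitarymxP.
have UU : U^t* *m U = 1%:M by exact: mulmx1C.
have mUZ t : measurable_fun setT (fun x => U *m Z t x) by apply: measurable_mulmx; exact: measurable_funPT.
have /choice[W hW] : forall t, exists Wt : {RV P >-> 'cV[R[i]]_d}, forall x, Wt x = U *m Z t x.
  by move=> t; exact: exists_RV (mUZ t).
have mU : measurable_fun setT (fun z : 'cV[R[i]]_d => U *m z).
  by apply: measurable_mulmx; exact: measurable_id.
have iidW : iid W by exact: iid_map mU hW Z_iid.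
have [u hu] := degenerate_tail_const Z_iid KE sd UU UK.
pose pw : 'M[R[i]]_(s, d) := pid_mx s.
have /choice[w hw] : forall t, exists wt : {RV P >-> 'cV[R[i]]_s}, forall x, wt x = pw *m (U *m Z t x).
  by move=> t; apply: exists_RV; exact: measurable_mulmx.
exists u, w => lin_eq c_i c_ii c_iii c_ii' c_iii'.
have const0 (rho : 'rV[R[i]]_d) (c : 'M[R[i]]_1) : {ae P, forall x, rho *m (U *m Z 0 x) = c} -> rho *m (pid_mx s : 'M[R[i]]_d) = 0.
  exact: (const_upper0 KE sd UU UK).
pose u0 : 'cV[R[i]]_d := vstack (0 : 'cV_s) u.
have vsE (v : 'cV[R[i]]_s) : vstack v u = (pid_mx s : 'M[R[i]]_(d, s)) *m v + u0.
  by rewrite /u0 !vstackE // mulmx0 add0r.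
have pidK (v : 'cV[R[i]]_s) : (pid_mx s : 'M[R[i]]_d) *m ((pid_mx s : 'M[R[i]]_(d, s)) *m v) = (pid_mx s : 'M[R[i]]_(d, s)) *m v.
  by rewrite mulmxA mul_pid_mx minnn (minn_idPr sd).
have pidu : (pid_mx s : 'M[R[i]]_d) *m u0 = 0.
  by rewrite /u0 vstackE // mulmx0 add0r mulmxA pid_lower // mul0mx.
have W_split : {ae P, forall x, forall t, W t x = (pid_mx s : 'M[R[i]]_d) *m W t x + u0}.
  apply: ae_int => t; apply: filterS (hu t) => x; rewrite -hW => {1}->.
  by rewrite vsE mulmxA mul_pid_mx !minnn.
have ZW t x : Z t x = U^t* *m W t x by rewrite hW mulmxA UU mul1mx.
have nondeg (rho : 'rV[R[i]]_d) : (forall c : R, 0 < c ->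
    pr P [set x | c < normc ((rho *m (W 0 x - W 1 x)) 0 0)] = 0) -> rho *m (pid_mx s : 'M[R[i]]_d) = 0.
  move=> /(lag0_const iidW) [c hc]; apply: (const0 rho c).
  by apply: filterS hc => x; rewrite hW.
pose V := noise_mx s (U^t*).
have ME : M = transferV Psi Theta V.
  by apply/funext => z; rewrite /M /transfer /transferV /V /noise_mx mulmxA.
have laurentM : c_i -> laurent_expansion (singularities Psi) (transferV Psi Theta V) Mc.
  rewrite /c_i ME => hi; rewrite /Mc ME /laurent_coef; apply: xgetPex.
  exact: laurent_expansion_exists hi.
have momE j : (fun x => log_plus (nrm m (Mc j *m (U *m Z 0 x)))) =
    (fun x => log_plus (nrm m (Mc j *m W 0 x))) by apply/funext => x; rewrite hW.
have absE t x : (fun j => Mc j *m (U *m Z (t - j) x)) = (fun j => Mc j *m W (t - j) x).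
  by apply/funext => j; rewrite hW.
have devE v t x : (fun j => Mc j *m (U *m Z (t - j) x - vstack v u)) =
    (fun j => Mc j *m (W (t - j) x - vstack v u)).
  by apply/funext => j; rewrite hW.
have linE v g : lin_eq v g <-> ar_poly Psi 1 *m g = ma_poly Theta 1 *m (U^t* *m vstack v u).
  by rewrite /lin_eq mulmxA.
have momW : c_ii -> forall k, ((m * p + q)%N%:Z - p%:Z + 1 <= k <= (m * p + q)%N%:Z) ||
    (- p%:Z <= k <= -1) -> ('E_P[fun x => log_plus (nrm m (Mc k *m W 0%R x))] < +oo)%E.
  by move=> hii k hk; rewrite -momE; exact: hii.
have exist : c_i -> c_ii -> forall v g, lin_eq v g -> exists Y : int -> {RV P >-> 'cV[R[i]]_m},
    [/\ solution Y, forall t, {ae P, forall x,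
          abs_cvg (nrm m) (fun j => Mc j *m (W (t - j) x - vstack v u)) /\
          Y t x = g + zseries_sum (fun j => Mc j *m (W (t - j) x - vstack v u))} &
        forall t x, Y t x = g + ma_limit Mc (fun k => W (k + t) x - vstack v u)].
  move=> hi hii v g /linE hlin; pose xi (x : Om) : 'cV[R[i]]_d := 0.
  have mxi : measurable_fun setT xi by exact: measurable_cst.
  have c10 : (1 : R[i]) != 0 by exact: oner_neq0.
  have /choice[Y hY] : forall t, exists Yt : {RV P >-> 'cV[R[i]]_m},
      forall x, Yt x = ma_with_phase W xi 1 Mc (vstack v u) g 0 t x.
    by move=> t; apply: exists_RV; exact: measurable_ma_with_phase.
  have hY' t x : Y t x = g + ma_limit Mc (fun k => W (k + t) x - vstack v u).
    by rewrite hY /ma_with_phase mul0mx addr0.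
  have [||aY dY] := @ma_limit_solution _ _ _ P m d p q s Psi Theta (U^t*) Z W u0 m_gt0 iidW ZW W_split
    Mc (laurentM hi) (nrm m) (nrmP m) (momW hii) (vstack v u) g _ hlin Y.
  - by rewrite vsE mulmxDr pidK pidu addr0.
  - by apply: aeW => x t; exact: hY'.
  exists Y; split; [split=> //|exact: dY|exact: hY'].
  apply: (stationary_ma_with_phase iidW mxi c10 _ _ hY) => [D pi J A mD mA|h D mD].
    have [D0|D0] := pselect (D 0).
      have E : [set x | D (xi x)] = setT by apply/seteqP; split.
      have P1 : P setT = 1%E by exact: probability_setT.
      by rewrite E setTI P1 mul1e.
    have E : [set x | D (xi x)] = set0 by apply/seteqP; split => // x; exact: D0.
    by rewrite E set0I measure0 mul0e.
  by congr (P _); apply/funext => x /=; rewrite /xi scaler0.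
split.
- split; first 1 last.
  + by move=> t; apply: filterS (hu t) => x; rewrite hw.
  + move=> b b0 /dirac_degenerateP hb.
    have mb : measurable_fun setT (fun x => b ^t* *m w 0 x).
      by apply: measurable_mulmx; exact: measurable_funPT.
    have [c hc] := hb mb.
    have h0 : b^t* *m pw *m (pid_mx s : 'M[R[i]]_d) = 0.
      by apply: (const0 _ c); apply: filterS hc => x e; rewrite -mulmxA -hw.
    have : b^t* = 0.
      have := congr1 (fun A => A *m (pid_mx s : 'M[R[i]]_(d, s))) h0.
      have h1 : pw *m (pid_mx s : 'M[R[i]]_d) *m (pid_mx s : 'M[R[i]]_(d, s)) = 1%:M.
        by rewrite /pw !mul_pid_mx !(minnn, minn_idPr sd) pid_mx_1.
      by rewrite mul0mx -!mulmxA (mulmxA pw) h1 mulmx1.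
    by move=> /(congr1 (fun A => A^t*)); rewrite trmxCK trmx0 map_mx0 => /eqP; apply/negP.
  + have mp : measurable_fun setT (fun z : 'cV[R[i]]_d => pw *m (U *m z)).
      by apply: measurable_mulmx.
    exact: iid_map mp hw Z_iid.
- split=> [[Y [sY aY]]|[hi hii [v [g hlin]]]]; last first.
    by have [Y [sY _ _]] := exist hi hii v g hlin; exists Y.
  have hi : c_i by rewrite /c_i ME; exact: (poles_removable iidW ZW W_split nondeg sY aY).
  split => //.
    by move=> j hj; rewrite momE; exact: (moments_of_solution m_gt0 iidW ZW W_split (laurentM hi) (nrmP m) sY aY hj).
  have [g hg] := linear_equation_of_solution iidW ZW W_split (laurentM hi) sY aY.
  by exists 0, g; apply/linE.
- move=> hi; split; split.
  + move=> hii t; have := abs_cvg_noise m_gt0 iidW (laurentM hi) (nrmP m) (momW hii) t.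
    by apply: filterS => x; rewrite absE.
  + move=> hii' j hj; rewrite momE.
    apply: (moments_of_abs_cvg m_gt0 iidW (laurentM hi) (nrmP m) _ hj).
    by apply: filterS (hii' 0) => x; rewrite absE.
  + move=> [v0 [g /linE hg]] v; have [L hL] := const_response (laurentM hi) ((pid_mx s : 'M[R[i]]_(d, s)) *m (v - v0)).
    exists (g + L); apply/linE; rewrite mulmxDr hg hL -mulmxDr; congr (_ *m _).
    by rewrite -mulmxA pidK -mulmxDr !vsE mulmxBr addrAC addrCA subrr addr0 addrC.
  + by move=> h; have [g hg] := h 0; exists 0, g.
move=> hi hii _ v g hlin dev.
have [Y [[sY aY] dY hY]] := exist hi hii v g hlin.
exists Y; split; first exact: (conj sY aY).
  by move=> t; apply: filterS (dY t) => x; rewrite -devE.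
move=> hsup; split=> [uniq z z1|hdet Y' [sY' aY']]; last first.
  apply: (solution_unique _ sY aY sY' aY') => z z1.
  by apply: hdet; rewrite normcE z1.
apply/negP => /eqP dz.
have nz : normc z = 1.
  by move: z1; rewrite normcE => /eqP; rewrite eq_complex /= => /andP[/eqP].
have [Y' [sY' aY' ne]] := nonunique iidW hW d_gt0 hsup nz dz hY aY.
have : pr P set0 = 1.
  apply: pr_ae1 => //; apply: filterS (uniq Y' (conj sY' aY') 0) => x; exact: ne.
by rewrite /pr measure0 /= => /eqP; rewrite eq_sym oner_eq0.
Qed.
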